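(* There is an algorithm for the i.i.d. contextual bandit problem with an optimal regret bound, i.e. regret $O\left(\sqrt{KT\log(|\Pi|/\delta)}\right)$ after $T$ rounds, requiring $$\tilde O\left(\sqrt{\frac{KT}{\ln(|\Pi|/\delta)}}\right)$$ calls to the optimization oracle over $T$ rounds, with probability at least $1-\delta$.
   Context: Setting. $A$ is a finite set of $K$ actions, $X$ is a space of contexts, $\Pi\subseteq A^X$ is a finite set of policies. $\mathcal D$ is a probability distribution over $X\times[0,1]^A$. The pairs $(x_t,r_t)$, $t=1,2,\dots$, are drawn independently from $\mathcal D$. In round $t$ the algorithm observes $x_t$, (randomly) chooses $a_t\in A$, and observes only the reward $r_t(a_t)$. Let $\mathcal R(\pi)=\mathbb E_{(x,r)\sim\mathcal D}[r(\pi(x))]$ and $\pi_\star\in\arg\max_{\pi\in\Pi}\mathcal R(\pi)$. The regret after $T$ rounds is $\sum_{t=1}^T\bigl(r_t(\pi_\star(x_t))-r_t(a_t)\bigr)$. Optimal regret. The optimal regret after $T$ rounds, relative to the policy set $\Pi$, is $O\left(\sqrt{KT\log(|\Pi|/\delta)}\right)$ with probability at least $1-\delta$. Oracle. The algorithm accesses $\Pi$ via an optimization oracle, which takes any sequence $(x_1,r_1),\dots,(x_s,r_s)$ of contexts and non-negative reward vectors ($r_i\in\mathbb R^A$, $r_i(a)\ge 0$) and returns a policy in $\arg\max_{\pi\in\Pi}\sum_{i=1}^s r_i(\pi(x_i))$. Notation. $\tilde O$ suppresses dependence on logarithmic factors in $T$ and $K$, as well as in $\log(|\Pi|/\delta)$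 (i.e. terms which are $O(\log\log(|\Pi|/\delta))$). *)

(* Defs.v *)
From HB Require Import structures.
From mathcomp Require Import all_boot all_order all_algebra.
From mathcomp Require Import all_classical all_reals all_analysis.

Set Implicit Arguments.
Unset Strict Implicit.
Unset Printing Implicit Defensive.

Import Order.TTheory GRing.Theory Num.Theory.

Local Open Scope classical_set_scope.
Local Open Scope ring_scope.

(* The action set is 'I_K.  Reward vectors are K.-tuple's, so that pairs of a
   context and a reward vector carry the product sigma-algebra. *)

Definition query (R : realType) (K : nat) (X : Type) : Type :=
  seq (X * K.-tuple R).

Definition nonneg_query (R : realType) (K : nat) (X : Type)
    (q : query R K X) : bool :=
  all (fun xr : X * K.-tuple R => [forall a, 0 <= tnth xr.2 a]) q.

(* The answer to a query with a negative reward is unconstrained. *)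
Definition opt_oracle (R : realType) (K : nat) (X : Type)
    (Pi : set (X -> 'I_K)) (orc : query R K X -> X -> 'I_K) : Prop :=
  forall q, nonneg_query q ->
    Pi (orc q) /\
    forall pi, Pi pi ->
      \sum_(xr <- q) tnth xr.2 (pi xr.1) <=
      \sum_(xr <- q) tnth xr.2 (orc q xr.1).

(* Ties may be broken in any measurable way. *)
Definition measurable_oracle (R : realType) (K : nat) (d : measure_display)
    (X : measurableType d) (Pi : set (X -> 'I_K))
    (orc : query R K X -> X -> 'I_K) : Prop :=
  forall (n : nat) (pi : X -> 'I_K), Pi pi ->
    measurable [set q : n.-tuple (X * K.-tuple R)%type |
                 nonneg_query q /\ orc q = pi].

Definition measurable_policy (K : nat) (d : measure_display)
    (X : measurableType d) (pi : X -> 'I_K) : Prop :=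
  forall a, measurable (pi @^-1` [set a]).

(* A computation that may query the oracle, adaptively and finitely often,
   before returning.  Queries are its only access to the policy set. *)
Inductive prog (R : realType) (K : nat) (X Res : Type) : Type :=
  | Ret of Res
  | Ask of query R K X & ((X -> 'I_K) -> prog R K X Res).

Arguments Ret {R K X Res}.
Arguments Ask {R K X Res}.

(* The second component counts the oracle calls. *)
Fixpoint run (R : realType) (K : nat) (X Res : Type)
    (orc : query R K X -> X -> 'I_K) (p : prog R K X Res) : Res * nat :=
  match p with
  | Ret r => (r, 0%N)
  | Ask q k => let o := run orc (k (orc q)) in (o.1, o.2.+1)
  end.

(* In a round, given its internal state, the observed context and a fresh
   random seed in [0, 1], the algorithm chooses an action together with its
   next state as a function of the reward of that action, which is the only
   part of the reward vector it sees. *)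
Record bandit_algorithm (R : realType) (K : nat) (X : Type) := BanditAlgorithm {
  alg_state : Type;
  alg_init : alg_state;
  alg_round : alg_state -> X -> R -> prog R K X ('I_K * (R -> alg_state))
}.

Section Execution.
Context (R : realType) (K : nat) (X : Type).
Context (alg : bandit_algorithm R K X) (orc : query R K X -> X -> 'I_K).

(* The element y t is ((x_t, r_t), u_t), with u_t the seed; rounds are numbered
   from 0. *)
Variable y : nat -> X * K.-tuple R * R.

Definition round_at (s : alg_state alg) (t : nat) :
    'I_K * (R -> alg_state alg) * nat :=
  run orc (alg_round s (y t).1.1 (y t).2).

Fixpoint state_at (t : nat) : alg_state alg :=
  if t is t'.+1 then
    let o := (round_at (state_at t') t').1 in o.2 (tnth (y t').1.2 o.1)
  else alg_init alg.

Definition action_at (t : nat) : 'I_K := (round_at (state_at t) t).1.1.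

Definition oracle_calls (T : nat) : nat :=
  (\sum_(t < T) (round_at (state_at t) t).2)%N.

Definition regret (pi : X -> 'I_K) (T : nat) : R :=
  \sum_(t < T) (tnth (y t).1.2 (pi (y t).1.1) - tnth (y t).1.2 (action_at t)).

End Execution.

(* The Y t are independent with common law mu. *)
Definition iid_with_law (R : realType) (d d' : measure_display)
    (Omega : measurableType d) (S : measurableType d')
    (P : probability Omega R) (mu : {measure set S -> \bar R})
    (Y : nat -> {RV P >-> S}) : Prop :=
  forall (n : nat) (B : nat -> set S), (forall t, measurable (B t)) ->
    P (\bigcap_(t in `I_n) (Y t @^-1` B t)) = (\prod_(t < n) mu (B t))%E.

Definition expected_reward (R : realType) (K : nat) (d : measure_display)
    (X : measurableType d) (D : probability (X * K.-tuple R)%type R)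
    (pi : X -> 'I_K) : \bar R :=
  'E_D[fun z : X * K.-tuple R => tnth z.2 (pi z.1)].

(* The factors suppressed by soft-O, up to a power; the shifts by 2 keep the
   logarithms bounded away from 0. *)
Definition log_factor (R : realType) (T K : nat) (L : R) : R :=
  ln (T%:R + 2) * ln (K%:R + 2) * ln (L + 2).

(* Main.v *)
Require Import Defs.
From HB Require Import structures.
From mathcomp Require Import all_boot all_order all_algebra.
From mathcomp Require Import all_classical all_reals all_analysis.
From mathcomp Require Import measurable_realfun.
From mathcomp Require Import ring lra.

Set Implicit Arguments.
Unset Strict Implicit.
Unset Printing Implicit Defensive.

Import Order.TTheory GRing.Theory Num.Theory.

Local Open Scope classical_set_scope.
Local Open Scope ring_scope.

(* Let L = ln(N/delta).  If L < ln 2 then N = 1 and one oracle call reveals the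
   only policy.  Otherwise rounds are grouped in the epochs [2^m, 2^(m+1)).  In
   epoch m actions are drawn from a mixture of policies, smoothed so that every
   action has probability at least mu_m, which is of order sqrt(L / (K 2^m)).
   The mixture is designed once, at the start of the epoch, from the
   importance-weighted rewards of the previous epoch, so as to have small
   estimated regret while the estimated variance of the importance-weighted
   reward of every policy is O(K + regret / mu_m).

   Such a mixture is found by Frank-Wolfe steps on a log-barrier potential: the
   oracle finds the policy of steepest descent, up to constants, and each step
   of size mu/8 decreases the potential, initially at most ln(1/mu), by at least
   mu/16.  Hence the design takes O(ln(1/mu) / mu) oracle calls, which
   sums to the announced number over the epochs.

   For the regret, exponential supermartingales give deviation bounds for the
   estimated rewards and for the variances.  The latter must hold for all
   mixtures at once: they are proved for mixtures of about 1/mu equally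
   weighted policies, by a union bound, and transferred to all mixtures by
   Maurey's sampling argument.  An induction over the epochs bounds the true
   variances, hence the regret of the mixtures.  The deviation levels
   L (M - m + 5), where M is the last epoch, have summable failure
   probabilities and only cost a constant factor against the geometric growth
   of the epochs; a fixed level L + ln T would lose a logarithm. *)

(** * Mixtures of policies and sampling from them *)

(** The mixture of an epoch depends on the data that estimate its variances, so those estimates must
    hold uniformly over mixtures. Lists of about [1/mu] policies cost a union bound of exponent
    about [L/mu]. This is affordable because the inverse probabilities are at most [1/mu] and their
    means are needed only up to a factor 2 and an additive [O(K)]: over [n] rounds, the lower tail
    then has an exponent of order [n K mu].

    Everything is calibrated by [mu^2 K n = L], with [n] the length of the previous epoch. It turns
    [n K mu] into [L/mu], and makes both parts of the error of an estimated reward, [mu] times a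
    variance of order [K] and [L / (n mu)], of order [K mu].

    In the induction over the epochs, the bound on a true variance contains the regret divided by
    [4 mu]. This coefficient has to reproduce itself from one epoch to the next, which fixes the
    weight given to rewards in the potential.

    The last epoch [M] and the deviation levels occur in the analysis only. The algorithm does not
    know the horizon, and it depends on [N] and [delta] through [L] alone. *)

Section ExpLn.
Context (R : realType).
Implicit Types x z : R.

(** Converts second moments into exponential moments. From [1 - x <= expR (- x)] one gets
    [expR x * (1 - x) <= 1], and the quadratic times [1 - x] is at least 1. *)
Lemma expR_le_quadratic x : x <= 1 / 2 -> expR x <= 1 + x + 2 * x ^+ 2.
Proof.
move=> x_le; have x1 : 0 < 1 - x by lra.
have e1 : expR x * (1 - x) <= 1.
  by rewrite -[leRHS](expRxMexpNx_1 x) ler_pM2l ?expR_gt0// expR_ge1Dx.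
rewrite -(ler_pM2r x1); apply: (le_trans e1).
have -> : (1 + x + 2 * x ^+ 2) * (1 - x) = 1 + x ^+ 2 * (1 - 2 * x) by ring.
by rewrite lerDl mulr_ge0 ?sqr_ge0//; lra.
Qed.

(** Second-order control of the log-barrier along a step: apply [ln (1 + x) <= x] to the inverse of
    [1 + z]. *)
Lemma lnN1D_le z : - 1 / 2 <= z -> - ln (1 + z) <= - z + 2 * z ^+ 2.
Proof.
move=> z_ge; have z1 : 0 < 1 + z by lra.
rewrite -lnV ?posrE//.
have -> : (1 + z)^-1 = 1 + - (z / (1 + z)) by field; lra.
have h : z / (1 + z) < 1 by rewrite ltr_pdivrMr//; lra.
apply: (le_trans (le_ln1Dx _)); first by lra.
have -> : - (z / (1 + z)) = - z + z ^+ 2 / (1 + z) by field; lra.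
rewrite lerD2l ler_pdivrMr//.
have -> : 2 * z ^+ 2 * (1 + z) = z ^+ 2 + z ^+ 2 * (1 + 2 * z) by ring.
by rewrite lerDl mulr_ge0 ?sqr_ge0//; lra.
Qed.

End ExpLn.

Section Mixture.
Context (R : realType) (T : Type) (al : R).
Hypotheses (al0 : 0 <= al) (al1 : al <= 1).
Implicit Types (P : T -> Prop) (l : seq T) (f g : T -> R).

Fixpoint all_in P l : Prop := if l is p :: l' then P p /\ all_in P l' else True.

(** Here [l] is the tail. The last policy of a list takes all the remaining weight, so that every
    nonempty list has total mass 1. *)
Definition head_weight l : R := if nilp l then 1 else al.

(* Prepending [p] to a nonempty list is a Frank-Wolfe step of size [al] towards
   [p]. *)
Fixpoint mixture l f : R :=
  if l is p :: l' then
    head_weight l' * f p + (1 - head_weight l') * mixture l' f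
  else 0.

Lemma head_weight_ge0 l : 0 <= head_weight l.
Proof. by rewrite /head_weight; case: ifP. Qed.

Lemma head_weight_le1 l : head_weight l <= 1.
Proof. by rewrite /head_weight; case: ifP. Qed.

Lemma le_mixture P l f g :
  all_in P l -> (forall p, P p -> f p <= g p) -> mixture l f <= mixture l g.
Proof.
move=> + fg; elim: l => [|p l ih]//= [Pp Pl].
have := head_weight_ge0 l; have := head_weight_le1 l => c1 c0.
by rewrite lerD// ler_wpM2l ?fg ?ih//; lra.
Qed.

Lemma eq_mixture P l f g :
  all_in P l -> (forall p, P p -> f p = g p) -> mixture l f = mixture l g.
Proof.
by move=> Pl fg; apply/eqP; rewrite eq_le !(@le_mixture P)// => p /fg ->.
Qed.

Lemma mixture_lin l (a b : R) f g :
  mixture l (fun p => a * f p + b * g p) = a * mixture l f + b * mixture l g.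
Proof. by elim: l => [|p l ih]/=; [ring|rewrite ih; ring]. Qed.

Lemma mixtureZ l (a : R) f : mixture l (fun p => a * f p) = a * mixture l f.
Proof. by elim: l => [|p l ih]/=; [ring|rewrite ih; ring]. Qed.

Lemma mixture_cst l (a : R) : ~~ nilp l -> mixture l (fun=> a) = a.
Proof.
elim: l => [|p l ih]//= _; rewrite /head_weight.
by case: ifPn => [_|/ih ->]; ring.
Qed.

Lemma mixture_sum (I : Type) (r : seq I) l (F : I -> T -> R) :
  mixture l (fun p => \sum_(i <- r) F i p) = \sum_(i <- r) mixture l (F i).
Proof.
elim: l => [|p l ih]/=; first by rewrite big1.
by rewrite ih !mulr_sumr -big_split.
Qed.

Lemma mixture_ge0 P l f :
  all_in P l -> (forall p, P p -> 0 <= f p) -> 0 <= mixture l f.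
Proof.
move=> Pl f0; apply: le_trans (le_mixture Pl f0).
by elim: {Pl} l => [|p l ih]//=; rewrite mulr0 add0r mulr_ge0// subr_ge0 head_weight_le1.
Qed.

Lemma all_in_true l : all_in (fun=> True) l.
Proof. by elim: l. Qed.

(* The expectation of [F sg] for [sg] made of [s] independent draws from the
   mixture. *)
Fixpoint mix_draws l (s : nat) (F : seq T -> R) : R :=
  if s is s'.+1 then mixture l (fun p => mix_draws l s' (fun sg => F (p :: sg)))
  else F [::].

Lemma mix_draws_lin l s (a b : R) (F G : seq T -> R) :
  mix_draws l s (fun sg => a * F sg + b * G sg) =
  a * mix_draws l s F + b * mix_draws l s G.
Proof.
elim: s F G => [|s ih] F G //=.
by under eq_fun do rewrite ih; rewrite mixture_lin.
Qed.

Lemma mix_drawsZ l s (a : R) (F : seq T -> R) :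
  mix_draws l s (fun sg => a * F sg) = a * mix_draws l s F.
Proof.
elim: s F => [|s ih] F //=.
by under eq_fun do rewrite ih; rewrite mixtureZ.
Qed.

Lemma le_mix_draws P l s (F G : seq T -> R) : all_in P l ->
  (forall sg, size sg = s -> all_in P sg -> F sg <= G sg) ->
  mix_draws l s F <= mix_draws l s G.
Proof.
move=> Pl; elim: s F G => [|s ih] F G FG /=; first exact: FG.
by apply: (le_mixture Pl) => p Pp; apply: ih => sg szs Psg; apply: FG => //=; rewrite szs.
Qed.

Lemma eq_mix_draws P l s (F G : seq T -> R) : all_in P l ->
  (forall sg, size sg = s -> all_in P sg -> F sg = G sg) ->
  mix_draws l s F = mix_draws l s G.
Proof.
move=> Pl FG; apply/eqP; rewrite eq_le.
by rewrite !(@le_mix_draws P)// => sg ssg Psg; rewrite FG.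
Qed.

Lemma mix_draws_cst l s (a : R) : ~~ nilp l -> mix_draws l s (fun=> a) = a.
Proof.
move=> l0; elim: s => [|s ih]//=.
by under eq_fun do rewrite ih; rewrite mixture_cst.
Qed.

Lemma mix_draws_sum (I : Type) (r : seq I) l s (F : I -> seq T -> R) :
  mix_draws l s (fun sg => \sum_(i <- r) F i sg) =
  \sum_(i <- r) mix_draws l s (F i).
Proof.
elim: s F => [|s ih] F //=.
by under eq_fun do rewrite ih; rewrite mixture_sum.
Qed.

Section Count.
Variables (l : seq T) (A : pred T).
Hypothesis l0 : ~~ nilp l.
Let q := mixture l (fun p => (A p)%:R).

Let mixture_if (u v : R) : mixture l (fun p => if A p then u else v) =
  q * u + (1 - q) * v.
Proof.
rewrite (@eq_mixture (fun=> True) l _ (fun p => (u - v) * (A p)%:R + v * 1)).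
- by rewrite mixture_lin mixture_cst// -/q; ring.
- exact: all_in_true.
- by move=> p _; case: (A p) => /=; ring.
Qed.

Lemma mix_drawsS_count s (g : nat -> R) :
  mix_draws l s.+1 (fun sg => g (count A sg)) =
  q * mix_draws l s (fun sg => g (count A sg).+1) +
  (1 - q) * mix_draws l s (fun sg => g (count A sg)).
Proof.
rewrite /= -mixture_if; apply: (@eq_mixture (fun=> True)); first exact: all_in_true.
move=> p _; case: (A p) => //.
Qed.

(* Size-biasing of the binomial law. *)
Lemma mix_draws_size_bias s (f : nat -> R) :
  mix_draws l s.+1 (fun sg => (count A sg)%:R * f (count A sg)) =
  s.+1%:R * q * mix_draws l s (fun sg => f (count A sg).+1).
Proof.
elim: s f => [|s ih] f.
  by rewrite (mix_drawsS_count 0 (fun k => k%:R * f k)) /=; ring.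
rewrite (mix_drawsS_count s.+1 (fun k => k%:R * f k)) ih.
have -> : mix_draws l s.+1 (fun sg => (count A sg).+1%:R * f (count A sg).+1) =
   mix_draws l s.+1 (fun sg => 1 * ((count A sg)%:R * f (count A sg).+1) +
                               1 * f (count A sg).+1).
  apply: (@eq_mix_draws (fun=> True)); first exact: all_in_true.
  by move=> sg _ _; rewrite -natr1; ring.
rewrite mix_draws_lin (ih (fun k => f k.+1)).
rewrite (mix_drawsS_count s (fun k => f k.+1)) -[s.+2%:R]natr1.
ring.
Qed.

Hypothesis l_ok : all_in (fun=> True) l.

Lemma mixture_prob01 : 0 <= q <= 1.
Proof.
apply/andP; split.
  by apply: (mixture_ge0 l_ok) => p _.
rewrite -[leRHS](mixture_cst 1 l0); apply: (le_mixture l_ok) => p _.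
by case: (A p).
Qed.

(** Size-biasing with the inverse as test function leaves the probability that the count is nonzero;
    the convention that 0 is its own inverse handles the count 0. *)
Lemma mix_draws_inv_count s :
  s.+1%:R * q * mix_draws l s (fun sg => (count A sg).+1%:R^-1) <= 1.
Proof.
rewrite -(mix_draws_size_bias s (fun k => k%:R^-1)) -[leRHS](mix_draws_cst s.+1 1 l0).
apply: (le_mix_draws l_ok) => sg _ _.
have [->|n0] := eqVneq (count A sg) 0%N; first by rewrite mul0r.
by rewrite divff// pnatr_eq0.
Qed.

Variables (s : nat) (c mu : R).
Hypotheses (c0 : 0 < c) (c1 : c <= 1) (mu0 : 0 < mu) (smu : 1 <= s%:R * mu).

Let s0 : 0 < s%:R :> R.
Proof. by rewrite -(pmulr_lgt0 _ mu0) (lt_le_trans _ smu). Qed.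

Let draw_gt0 (sg : seq T) : 0 < c * ((count A sg)%:R / s%:R) + mu.
Proof. by rewrite ltr_wpDl// mulr_ge0 ?divr_ge0// ltW. Qed.

(** The two terms of the denominator are treated separately: the expectation times [mu] is at most 1
    since each inverse is at most [1/mu], and times [c * q] it is at most 1 by
    [mix_draws_inv_count]. There [1 <= s * mu] pays for replacing the count by its successor. *)
Lemma mix_draws_inv_le :
  mix_draws l s (fun sg => (c * ((count A sg)%:R / s%:R) + mu)^-1) <=
  2 / (c * q + mu).
Proof.
have /andP[q0 q1] := mixture_prob01.
set E := mix_draws _ _ _.
have E1 : E <= mu^-1.
  rewrite -[leRHS](mix_draws_cst s mu^-1 l0); apply: (le_mix_draws l_ok) => sg _ _.
  by rewrite lef_pV2 ?posrE// lerDr mulr_ge0 ?divr_ge0// ltW.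
have E2 : E * q * c <= 1.
  apply: le_trans (mix_draws_inv_count s).
  have -> : s.+1%:R * q * mix_draws l s (fun sg => (count A sg).+1%:R^-1) =
     s.+1%:R * mix_draws l s (fun sg => (count A sg).+1%:R^-1) * q by ring.
  have -> : E * q * c = (c * E) * q by ring.
  rewrite ler_wpM2r//.
  rewrite /E -!mix_drawsZ; apply: (le_mix_draws l_ok) => sg _ _.
  set k := count A sg.
  rewrite ler_pdivrMr ?draw_gt0// mulrAC ler_pdivlMr ?ltr0n//.
  rewrite -[s.+1%:R]natr1 -[k.+1%:R]natr1.
  have k0 : 0 <= k%:R :> R by [].
  have -> : (s%:R + 1) * (c * (k%:R / s%:R) + mu) =
     c * k%:R + c * (k%:R / s%:R) + (s%:R * mu) + mu by field; rewrite gt_eqF.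
  have h : 0 <= c * (k%:R / s%:R) by rewrite mulr_ge0 ?divr_ge0// ltW.
  rewrite mulrDr mulr1; move: h smu; set w := c * (_ / _); set v := s%:R * mu.
  clearbody w v => w0 v1; rewrite -!addrA lerD2l; apply: (le_trans c1).
  by apply: (le_trans v1); rewrite [leRHS]addrCA lerDl addr_ge0// ltW.
have E0 : 0 <= E.
  rewrite -(mix_draws_cst s 0 l0); apply: (le_mix_draws l_ok) => sg _ _.
  by rewrite invr_ge0 ltW.
have cqm : 0 < c * q + mu by rewrite ltr_wpDl// mulr_ge0// ltW.
rewrite ler_pdivlMr//.
have : E * mu <= 1 by rewrite -ler_pdivlMr// mul1r.
have -> : E * (c * q + mu) = E * q * c + E * mu by ring.
lra.
Qed.

Lemma mix_draws_count : mix_draws l s (fun sg => (count A sg)%:R) = s%:R * q.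
Proof.
case: s => [|s']; first by rewrite mul0r.
rewrite -[RHS]mulr1 -[X in _ * X](mix_draws_cst s' 1 l0).
rewrite -(mix_draws_size_bias s' (fun=> 1)).
by apply: (@eq_mix_draws (fun=> True)) => // sg _ _; rewrite mulr1.
Qed.

(** Jensen's inequality for the inverse function: [a] and [b] are the coefficients, in terms of the
    count, of its tangent at the mean [y0]. *)
Lemma mix_draws_inv_ge :
  (c * q + mu)^-1 <=
  mix_draws l s (fun sg => (c * ((count A sg)%:R / s%:R) + mu)^-1).
Proof.
have /andP[q0 q1] := mixture_prob01.
set y0 := c * q + mu; have y00 : 0 < y0 by rewrite ltr_wpDl// mulr_ge0// ltW.
pose a := 2 / y0 - mu / y0 ^+ 2; pose b := - (c / (s%:R * y0 ^+ 2)).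
have -> : y0^-1 = mix_draws l s (fun sg => b * (count A sg)%:R + a * 1).
  rewrite mix_draws_lin mix_draws_cst// mix_draws_count /a /b.
  have -> : mu = y0 - c * q by rewrite /y0; ring.
  by field; rewrite !gt_eqF.
apply: (le_mix_draws l_ok) => sg _ _; rewrite /a /b.
set y := (c * _ + mu).
have y_gt0 : 0 < y := draw_gt0 sg.
have -> : - (c / (s%:R * y0 ^+ 2)) * (count A sg)%:R +
    (2 / y0 - mu / y0 ^+ 2) * 1 = 2 / y0 - y / y0 ^+ 2.
  by rewrite /y; field; rewrite !gt_eqF.
rewrite -subr_ge0.
have -> : y^-1 - (2 / y0 - y / y0 ^+ 2) = (y - y0) ^+ 2 / (y * y0 ^+ 2).
  by field; rewrite !gt_eqF.
by rewrite divr_ge0 ?sqr_ge0// mulr_ge0 ?sqr_ge0// ltW.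
Qed.

End Count.
End Mixture.

(** * Design of a low-variance mixture *)

Section LogBarrier.
Context (R : realType) (K : nat).
Variables (mu : R) (q : 'I_K -> R) (b : 'I_K).
Hypotheses (mu0 : 0 < mu) (Kmu : K%:R * mu <= 1 / 2).
Hypothesis q0 : forall a, 0 <= q a.

Let K1 : 1 <= K%:R :> R.
Proof. by rewrite ler1n (leq_trans _ (ltn_ord b)). Qed.

Let c := 1 - K%:R * mu.
Let al := mu / 8.
Let p a := c * q a + mu.

Let mu_le : mu <= 1 / 2.
Proof. by apply: le_trans Kmu; rewrite ler_peMl// ltW. Qed.

(** Each probability is multiplied by [1 + z] with [z] of order [al / p a]. At the action [b] the
    first-order gain is at least half of [al / p b], as [c >= 1/2]. The step size [mu / 8], with
    [p b >= mu], keeps the second-order loss below a quarter of [al / p b]. All other terms cost at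
    most [9/8 * al] per action, hence the same after averaging over the actions. *)
Lemma log_barrier_step :
  K%:R^-1 * \sum_a - ln (c * (al * (b == a)%:R + (1 - al) * q a) + mu) <=
  K%:R^-1 * (\sum_a - ln (p a)) - al * ((4 * K%:R)^-1 * (p b)^-1 - 9 / 8).
Proof.
have mu0' := mu0; have Kmu' := Kmu; have K1' := K1.
have Kmu0 : 0 <= K%:R * mu by rewrite mulr_ge0// ltW.
have c0 : 1 / 2 <= c by rewrite /c; lra.
have c1 : c <= 1 by rewrite /c; lra.
have al0 : 0 < al by rewrite /al; lra.
have alE : mu = 8 * al by rewrite /al; field.
clearbody al.
have cge0 : 0 <= c by apply: le_trans c0; lra.
clearbody c.
have al1 : al <= 1 / 16 by have := mu_le; lra.
have pmu a : mu <= p a by rewrite /p lerDr mulr_ge0//; lra.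
have p0 a : 0 < p a by apply: lt_le_trans (pmu a).
have step a : - ln (c * (al * (b == a)%:R + (1 - al) * q a) + mu) <=
    - ln (p a) + (- (al / 4) * ((b == a)%:R / p a) + 9 / 8 * al).
  pose d : R := (b == a)%:R; rewrite -/d.
  have d2 : d ^+ 2 = d by rewrite /d; case: eqP; rewrite ?expr1n ?expr0n.
  have d0 : 0 <= d by [].
  pose w := c * q a / p a; pose v := (p a)^-1.
  have v0 : 0 < v by rewrite invr_gt0.
  have vmu : mu * v <= 1 by rewrite -ler_pdivlMr ?invr_gt0// invrK mul1r.
  have w0 : 0 <= w by rewrite !mulr_ge0// invr_ge0 ltW.
  have w1 : w <= 1 by rewrite /w ler_pdivrMr// mul1r lerDl ltW.
  pose z := al * (c * d * v - w).
  have z_ge : - 1 / 2 <= z.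
    have : 0 <= c * d * v by rewrite !mulr_ge0// ltW.
    rewrite /z; nra.
  have -> : c * (al * d + (1 - al) * q a) + mu = p a * (1 + z).
    by rewrite /z /w /v /p; field; rewrite gt_eqF// p0.
  rewrite lnM ?posrE//; last by lra.
  rewrite opprD lerD2l; apply: (le_trans (lnN1D_le z_ge)).
  have u2 : (c * d * v - w) ^+ 2 <= d * v ^+ 2 + 1.
    apply: (@le_trans _ _ ((c * d * v) ^+ 2 + w ^+ 2)).
      have : 0 <= (c * d * v) * w by rewrite !mulr_ge0// ltW.
      rewrite sqrrB; lra.
    apply: lerD; last by rewrite expr_le1.
    rewrite !exprMn d2 -mulrA ler_piMl ?mulr_ge0 ?(ltW v0)//.
    by rewrite expr_le1//; lra.
  have e1 : 2 * z ^+ 2 <= al / 4 * (d * v) + al * (1 / 8).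
    rewrite /z exprMn.
    have -> : 2 * (al ^+ 2 * (c * d * v - w) ^+ 2) =
       al * (2 * al * (c * d * v - w) ^+ 2) by ring.
    have -> : al / 4 * (d * v) + al * (1 / 8) = al * (d * v / 4 + 1 / 8) by field.
    rewrite ler_pM2l//.
    apply: (@le_trans _ _ (2 * al * (d * v ^+ 2 + 1))).
      by rewrite ler_pM2l// mulr_gt0.
    have : al * (d * v ^+ 2) * 8 <= d * v.
      have -> : al * (d * v ^+ 2) * 8 = d * v * (mu * v) by rewrite alE; ring.
      by rewrite ler_piMr// mulr_ge0// ltW.
    have -> : 2 * al * (d * v ^+ 2 + 1) = al * (d * v ^+ 2) * 8 / 4 + 2 * al by field.
    lra.
  have e2 : - z <= - (al / 2) * (d * v) + al.
    have -> : - z = al * (- (c * (d * v)) + w) by rewrite /z; ring.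
    have -> : - (al / 2) * (d * v) + al = al * (- (1 / 2 * (d * v)) + 1) by field.
    rewrite ler_pM2l// lerD// lerN2 ler_wpM2r// mulr_ge0// ltW//.
  have -> : d / p a = d * v by [].
  lra.
apply: (@le_trans _ _ (K%:R^-1 * \sum_a (- ln (p a) +
    (- (al / 4) * ((b == a)%:R / p a) + 9 / 8 * al)))).
  by rewrite ler_wpM2l ?invr_ge0//; apply: ler_sum => a _; exact: step.
have sumd : \sum_a (b == a)%:R / p a = (p b)^-1.
  rewrite (bigD1 b)//= eqxx big1 ?addr0 ?mul1r// => a.
  by rewrite eq_sym => /negbTE ->; rewrite mul0r.
rewrite !big_split/= sumr_const card_ord -mulr_sumr sumd.
rewrite le_eqVlt; apply/orP; left; apply/eqP.
by rewrite -[_ *+ K]mulr_natr; field; rewrite !gt_eqF//; lra.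
Qed.

End LogBarrier.

Section Design.
Context (R : realType) (K : nat) (X : Type).
Implicit Types (mu : R) (p : X -> 'I_K) (l : seq (X -> 'I_K)) (dat : query R K X).

Definition act_prob mu l (x : X) (a : 'I_K) : R :=
  (1 - K%:R * mu) * mixture (mu / 8) l (fun p => (p x == a)%:R) + mu.

Definition average dat (f : X * K.-tuple R -> R) : R :=
  (\sum_(xr <- dat) f xr) / (size dat)%:R.

Definition emp_var mu l p dat : R :=
  average dat (fun xr => (act_prob mu l xr.1 (p xr.1))^-1).

Definition emp_reward dat p : R := average dat (fun xr => tnth xr.2 (p xr.1)).

(** With 80, the test [gap <= 2] bounds an empirical variance by [8 K] plus the estimated regret
    over [20 mu]. Passing to true quantities costs the factors 4 and 5/4, and [4 * (5/4) / 20 = 1/4]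
    is the coefficient assumed for the previous epoch. *)
Definition reward_weight mu : R := (80 * (K%:R * mu))^-1.

(* The decrease of the potential below in the direction of [p], with a factor
   [1 / 4] instead of [1 - K mu] before the variance: the rest absorbs the
   second-order term of a step. *)
Definition gap mu l dat p : R :=
  (4 * K%:R)^-1 * emp_var mu l p dat +
  reward_weight mu * (emp_reward dat p - mixture (mu / 8) l (emp_reward dat)).

(** The part of [gap] that varies with the policy is an average of terms that depend on its action
    at one data point, so a single oracle call maximises it. *)
Definition score_query mu l dat : query R K X :=
  [seq (xr.1, [tuple (4 * K%:R)^-1 * (act_prob mu l xr.1 a)^-1 +
                     reward_weight mu * tnth xr.2 a | a < K]) | xr <- dat].

(** The test is made on a maximiser of [gap], so success certifies all policies at once. The case of
    exhausted fuel is excluded by [design_loop_spec]. *)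
Fixpoint design_loop mu dat (k : nat) l : prog R K X (seq (X -> 'I_K)) :=
  if k is k'.+1 then
    Ask (score_query mu l dat) (fun p =>
      if gap mu l dat p <= 2 then Ret l else design_loop mu dat k' (p :: l))
  else Ret l.

(* The initial potential, at most [- ln mu], divided by the decrease [mu / 16]
   of a step. *)
Definition design_fuel mu : nat := (Num.truncn (16 * - ln mu / mu)).+1.

(** Starting from the empirical leader makes the regret part of the initial potential vanish. *)
Definition design mu dat : prog R K X (seq (X -> 'I_K)) :=
  Ask dat (fun p => design_loop mu dat (design_fuel mu) [:: p]).

Section Analysis.
Variables (Pi : set (X -> 'I_K)) (orc : query R K X -> X -> 'I_K).
Variables (mu : R) (dat : query R K X).
Hypotheses (HPi : opt_oracle Pi orc) (K_gt0 : (0 < K)%N).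
Hypotheses (mu0 : 0 < mu) (Kmu : K%:R * mu <= 1 / 2).
Hypotheses (dat0 : nonneg_query dat) (sdat : (0 < size dat)%N).

Let K1 : 1 <= K%:R :> R. Proof. by rewrite ler1n. Qed.
Let n0 : 0 < (size dat)%:R :> R. Proof. by rewrite ltr0n. Qed.
Let K0 : 0 < K%:R :> R. Proof. by rewrite ltr0n. Qed.
Let Kmu0 : 0 < K%:R * mu. Proof. by rewrite mulr_gt0. Qed.
Let mu_le : mu <= 1 / 2.
Proof. by apply: le_trans Kmu; rewrite ler_peMl// ltW. Qed.
Let al0 : 0 <= mu / 8. Proof. by have := mu0; lra. Qed.
Let al1 : mu / 8 <= 1. Proof. by have := mu_le; lra. Qed.

Let good_list l := ~~ nilp l /\ all_in Pi l.

Lemma mixture_act01 l (x : X) a : ~~ nilp l ->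
  0 <= mixture (mu / 8) l (fun p => (p x == a)%:R) <= 1.
Proof.
move=> l0; exact: (mixture_prob01 al0 al1 (fun p => p x == a) l0 (all_in_true l)).
Qed.

Lemma act_prob_ge l x a : ~~ nilp l -> mu <= act_prob mu l x a.
Proof.
move=> l0; have /andP[q0 _] := mixture_act01 x a l0.
by rewrite /act_prob lerDr mulr_ge0//; have := Kmu; lra.
Qed.

Lemma act_prob_gt0 l x a : ~~ nilp l -> 0 < act_prob mu l x a.
Proof. by move=> l0; apply: lt_le_trans (act_prob_ge x a l0). Qed.

Lemma act_prob_le1 l x a : ~~ nilp l -> act_prob mu l x a <= 1.
Proof.
move=> l0; have /andP[q0 q1] := mixture_act01 x a l0.
rewrite /act_prob.
have := Kmu; have : mu <= K%:R * mu by rewrite ler_peMl// ltW.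
nra.
Qed.

Lemma le_average (f g : X * K.-tuple R -> R) : (forall xr, f xr <= g xr) ->
  average dat f <= average dat g.
Proof. by move=> fg; rewrite ler_pM2r ?invr_gt0//; apply: ler_sum. Qed.

Lemma average_lin (a b c : R) (f g : X * K.-tuple R -> R) :
  average dat (fun xr => a * f xr + b * g xr + c) =
  a * average dat f + b * average dat g + c.
Proof.
rewrite /average !big_split/= -!mulr_sumr.
rewrite big_const_seq count_predT iter_addr_0 -[c *+ _]mulr_natr.
by field; rewrite gt_eqF.
Qed.

Lemma average_cst (a : R) : average dat (fun=> a) = a.
Proof.
rewrite /average big_const_seq count_predT iter_addr_0 -[a *+ _]mulr_natr.
by rewrite mulfK// gt_eqF.
Qed.

(** Up to the constant [ln K], the first term is the average relative entropy of the uniform law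
    with respect to the action probabilities; the second is the weighted empirical regret of the
    mixture. *)
Definition potential (lead : X -> 'I_K) l : R :=
  average dat (fun xr => K%:R^-1 * \sum_a - ln (act_prob mu l xr.1 a)) +
  reward_weight mu * (emp_reward dat lead - mixture (mu / 8) l (emp_reward dat)).

Let rw0 : 0 < reward_weight mu.
Proof. by rewrite invr_gt0 mulr_gt0. Qed.

Lemma potential_ge0 lead l : good_list l ->
  (forall p, Pi p -> emp_reward dat p <= emp_reward dat lead) ->
  0 <= potential lead l.
Proof.
move=> [l0 lPi] leadP; apply: addr_ge0.
  rewrite -[leLHS]average_cst; apply: le_average => xr.
  rewrite mulr_ge0 ?invr_ge0//; apply: sumr_ge0 => a _.
  by rewrite oppr_ge0 ln_le0// act_prob_le1.
rewrite mulr_ge0 ?(ltW rw0)// subr_ge0 -[leRHS](mixture_cst (mu / 8) _ l0).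
exact: (le_mixture al0 al1 lPi).
Qed.

Lemma potential_singleton lead : potential lead [:: lead] <= - ln mu.
Proof.
rewrite /potential /= mulr0 addr0 /head_weight/= mul1r subrr mulr0 addr0.
rewrite -[leRHS]average_cst; apply: le_average => xr.
apply: (@le_trans _ _ (K%:R^-1 * \sum_(a < K) - ln mu)); last first.
  by rewrite sumr_const card_ord -[- ln mu *+ K]mulr_natl mulrA mulVf ?mul1r// gt_eqF.
rewrite ler_wpM2l ?invr_ge0//; apply: ler_sum => a _.
by rewrite lerN2 ler_ln ?posrE ?act_prob_gt0//; apply: act_prob_ge.
Qed.

Lemma potential_step lead l p : good_list l ->
  potential lead (p :: l) <= potential lead l - mu / 8 * (gap mu l dat p - 9 / 8).
Proof.
move=> [l0 lPi]; rewrite /potential /gap /emp_var.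
set E := emp_reward dat; set rw := reward_weight mu.
have -> : mixture (mu / 8) (p :: l) E =
    mu / 8 * E p + (1 - mu / 8) * mixture (mu / 8) l E.
  by rewrite /= /head_weight (negbTE l0).
set Q := mixture _ l E.
set B := average dat (fun xr => (act_prob mu l xr.1 (p xr.1))^-1).
set A1 := average dat _; set A0 := average dat _.
suff : A1 <= A0 - mu / 8 * ((4 * K%:R)^-1 * B - 9 / 8).
  move=> h; apply: le_trans (lerD h (lexx _)) _.
  by rewrite le_eqVlt; apply/orP; left; apply/eqP; ring.
have -> : A0 - mu / 8 * ((4 * K%:R)^-1 * B - 9 / 8) =
  1 * A0 + (- (mu / 8) * (4 * K%:R)^-1) * B + mu / 8 * (9 / 8) by ring.
rewrite -average_lin; apply: le_average => xr; set x := xr.1.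
pose q a := mixture (mu / 8) l (fun p => (p x == a)%:R).
have q01 a : 0 <= q a <= 1 by exact: mixture_act01.
have := @log_barrier_step R K mu q (p x) mu0 Kmu
  (fun a => proj1 (andP (q01 a))).
rewrite mul1r => h; apply: le_trans (le_trans h _).
  rewrite le_eqVlt; apply/orP; left; apply/eqP; congr (_ * _).
  by apply: eq_bigr => a _; rewrite /act_prob /= /head_weight (negbTE l0).
by rewrite le_eqVlt; apply/orP; left; apply/eqP; rewrite /act_prob -/(q _); ring.
Qed.

Lemma score_query_nonneg l : ~~ nilp l -> nonneg_query (score_query mu l dat).
Proof.
move=> l0; rewrite /nonneg_query all_map.
apply: sub_all dat0 => xr /forallP r0; apply/forallP => a /=.
rewrite tnth_mktuple addr_ge0// mulr_ge0 ?invr_ge0// ?mulr_ge0//.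
- by rewrite ltW// act_prob_gt0.
- exact: ltW.
Qed.

Lemma gap_oracle l p : ~~ nilp l -> Pi p ->
  gap mu l dat p <= gap mu l dat (orc (score_query mu l dat)).
Proof.
move=> l0 Pip; have [_ /(_ p Pip)] := HPi (score_query_nonneg l0).
set o := orc _; rewrite !big_map.
have sumE p' : \sum_(j <- dat) tnth (j.1, [tuple (4 * K%:R)^-1 *
        (act_prob mu l j.1 a)^-1 + reward_weight mu * tnth j.2 a | a < K]).2
        (p' (j.1, [tuple (4 * K%:R)^-1 *
        (act_prob mu l j.1 a)^-1 + reward_weight mu * tnth j.2 a | a < K]).1) =
   (size dat)%:R * ((4 * K%:R)^-1 * emp_var mu l p' dat +
      reward_weight mu * emp_reward dat p').
  transitivity ((size dat)%:R * average dat (fun xr =>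
      (4 * K%:R)^-1 * (act_prob mu l xr.1 (p' xr.1))^-1 +
      reward_weight mu * tnth xr.2 (p' xr.1) + 0)).
    rewrite /average [RHS]mulrC mulfVK ?gt_eqF//.
    by apply: eq_bigr => xr _; rewrite tnth_mktuple addr0.
  by rewrite average_lin addr0.
by rewrite !sumE ler_pM2l// /gap !mulrBr !addrA lerD2r.
Qed.

(** A failed test [gap <= 2] decreases the potential by at least [mu / 8 * (2 - 9/8)], which exceeds
    [mu / 16]. The invariant bounds the potential by the remaining fuel, so fuel 0 would make it
    negative. *)
Lemma design_loop_spec lead k l : good_list l ->
  (forall p, Pi p -> emp_reward dat p <= emp_reward dat lead) ->
  potential lead l < mu / 16 * k%:R ->
  let o := run orc (design_loop mu dat k l) in
  [/\ good_list o.1, forall p, Pi p -> gap mu o.1 dat p <= 2 & (o.2 <= k)%N].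
Proof.
move=> + leadP; elim: k l => [|k ih] l lP.
  by rewrite mulr0 ltNge potential_ge0.
move=> pot /=; case: ifPn => [g2|].
  by split => //= p Pip; apply: le_trans g2; apply: gap_oracle => //; case: lP.
rewrite -ltNge => g2; case: (ih (orc (score_query mu l dat) :: l)).
- split => //=; split; last by case: lP.
  by case: lP => l0 _; case: (HPi (score_query_nonneg l0)).
- apply: le_lt_trans (potential_step _ _ lP) _.
  rewrite -[k.+1%:R]natr1 in pot; have h : 0 < mu / 16 by rewrite divr_gt0.
  move: g2; rewrite -subr_gt0 => g2; have := mulr_gt0 h g2.
  set g := gap _ _ _ _; set P := potential _ _ in pot * => g3; lra.
- by move=> h1 h2 h3; split.
Qed.

Lemma design_spec :
  let o := run orc (design mu dat) in
  [/\ ~~ nilp o.1, all_in Pi o.1,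
    exists2 lead, Pi lead & forall p, Pi p ->
      emp_reward dat p <= emp_reward dat lead,
    forall p, Pi p -> gap mu o.1 dat p <= 2 & (o.2 <= (design_fuel mu).+1)%N].
Proof.
have [Pil leadP] := HPi dat0; rewrite /design/=.
have leadP' p : Pi p -> emp_reward dat p <= emp_reward dat (orc dat).
  by move=> /leadP h; rewrite ler_pM2r ?invr_gt0.
have [//||[h1 h2] h3 h4] := @design_loop_spec (orc dat) (design_fuel mu) [:: orc dat] _ leadP'.
- apply: le_lt_trans (potential_singleton _) _.
  rewrite /design_fuel.
  have := @truncnS_gt R (16 * - ln mu / mu).
  set k := (_.+1)%:R; rewrite ltr_pdivrMr// => h; have := mu0; lra.
- by split => //; exists (orc dat).
Qed.

End Analysis.
End Design.

(** * Measurability and exponential supermartingales *)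

Section DiscreteFunctions.

Lemma countable_bigcup_measurable d (T : measurableType d) (A : Type)
    (D : set A) (F : A -> set T) : countable D ->
  (forall a, D a -> measurable (F a)) -> measurable (\bigcup_(a in D) F a).
Proof.
move=> /countable_injP[f finj] mF.
have -> : \bigcup_(a in D) F a =
    \bigcup_n \bigcup_(a in D `&` f @^-1` [set n]) F a.
  apply/seteqP; split => [t [a Da Fa]|t [n _ [a [Da _] Fa]]]; last by exists a.
  by exists (f a) => //; exists a.
apply: bigcupT_measurable => n.
have [[a [Da fa]]|no] := pselect (exists a, D a /\ f a = n).
  rewrite (_ : \bigcup_(_ in _) _ = F a); first exact: mF.
  apply/seteqP; split => [t [b [Db fb] Fb]|t Fa]; last by exists a.
  by rewrite (_ : a = b)//; apply: finj; rewrite ?inE// fa.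
rewrite (_ : \bigcup_(_ in _) _ = set0)//.
by apply/seteqP; split => [t [b [Db fb] Fb]|//]; apply: no; exists b.
Qed.

(* Countable range and measurable fibres: measurability for functions into a
   type without sigma-algebra, such as lists of policies. *)
Definition discrete_fun d (T : measurableType d) (A : Type) (f : T -> A) : Prop :=
  countable (range f) /\ forall a, measurable (f @^-1` [set a]).

Lemma discrete_cst d (T : measurableType d) (A : Type) (a : A) :
  discrete_fun (fun _ : T => a).
Proof.
split.
  by apply: sub_countable (countable1 a); apply: subset_card_le => _ [? _ <-].
move=> b; have [->|ba] := pselect (a = b).
  by rewrite (_ : _ @^-1` _ = setT)//; apply/seteqP; split.
by rewrite (_ : _ @^-1` _ = set0)//; apply/seteqP; split.
Qed.

Lemma preimage_bind (T A B : Type) (f : T -> A)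
    (g : A -> T -> B) (C : set B) :
  (fun t => g (f t) t) @^-1` C =
  \bigcup_(a in range f) (f @^-1` [set a] `&` g a @^-1` C).
Proof.
apply/seteqP; split => [t Ct|t [a _ [/= <- //]]].
by exists (f t).
Qed.

(** Only attained values of [f] are inspected. Properties that hold along every run, such as the
    validity of lists and of oracle answers, can thus be used when treating [g]. *)
Lemma discrete_bind d (T : measurableType d) (A B : Type) (f : T -> A)
    (g : A -> T -> B) :
  discrete_fun f -> (forall t, discrete_fun (g (f t))) ->
  discrete_fun (fun t => g (f t) t).
Proof.
move=> [cf mf] dg; split.
  apply: (@sub_countable _ _ _ (\bigcup_(a in range f) range (g a))).
    by apply: subset_card_le => _ [t _ <-]; exists (f t) => //; exists t.
  by apply: bigcup_countable => // _ [t _ <-]; case: (dg t).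
move=> b; rewrite (preimage_bind f g); apply: countable_bigcup_measurable => // _ [t _ <-].
by apply: measurableI => //; case: (dg t).
Qed.

Lemma discrete_map d (T : measurableType d) (A B : Type) (f : T -> A)
    (g : A -> B) : discrete_fun f -> discrete_fun (fun t => g (f t)).
Proof.
move=> df; apply: (@discrete_bind _ T A B f (fun a _ => g a) df) => t.
exact: discrete_cst.
Qed.

Lemma measurable_bind d (T : measurableType d) d' (U : measurableType d')
    (A : Type) (f : T -> A) (g : A -> T -> U) :
  discrete_fun f -> (forall t, measurable_fun setT (g (f t))) ->
  measurable_fun setT (fun t => g (f t) t).
Proof.
move=> [cf mf] mg _ C mC; rewrite setTI (preimage_bind f g).
apply: countable_bigcup_measurable => // _ [t _ <-].
by apply: measurableI => //; rewrite -[X in measurable X]setTI; exact: mg.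
Qed.

Lemma discrete_comp d d' (T : measurableType d) (T' : measurableType d')
    (A : Type) (f : T -> A) (h : T' -> T) :
  discrete_fun f -> measurable_fun setT h -> discrete_fun (f \o h).
Proof.
move=> [cf mf] mh; split.
  by apply: sub_countable cf; apply: subset_card_le => _ [t _ <-]; exists (h t).
by move=> a; rewrite comp_preimage -[X in measurable X]setTI; exact: mh.
Qed.

Lemma discrete_finite d (T : measurableType d) (A : finType) (f : T -> A) :
  (forall a, measurable (f @^-1` [set a])) -> discrete_fun f.
Proof. by split => //; exact: countableP. Qed.

Lemma discrete_bool d (T : measurableType d) (f : T -> bool) :
  measurable_fun setT f -> discrete_fun f.
Proof.
by move=> mf; apply: discrete_finite => a; rewrite -[X in measurable X]setTI; exact: mf.
Qed.

End DiscreteFunctions.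

(** * Independence from the past and exponential supermartingales *)

Section Past.
Context (R : realType) (d d' : measure_display).
Context (Omega : measurableType d) (S : measurableType d').
Variables (P : probability Omega R) (mu : probability S R).
Variable Y : nat -> {RV P >-> S}.
Hypothesis iidY : iid_with_law mu Y.

Definition past_rect (t : nat) : set (set Omega) :=
  [set A | exists B : nat -> set S, (forall s, measurable (B s)) /\
     A = \bigcap_(s in `I_t) Y s @^-1` B s].

(** The sigma-algebra of the rounds before [t], as a second measurable structure on [Omega]:
    adaptedness becomes measurability of a function on [past t]. *)
Definition past (t : nat) : measurableType (sigma_display (past_rect t)) :=
  g_sigma_algebraType (past_rect t).

Let mY s : measurable_fun setT (Y s : Omega -> S).
Proof. exact: measurable_funP. Qed.

Let mYpre s B : measurable B -> measurable (Y s @^-1` B).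
Proof. by move=> mB; rewrite -[X in measurable X]setTI; exact: mY. Qed.

Lemma past_rect_measurable t A : past_rect t A -> measurable A.
Proof.
move=> [B [mB ->]]; apply: bigcap_measurableType => // s _.
exact: mYpre.
Qed.

Lemma past_measurable t (A : set Omega) : <<s past_rect t >> A -> measurable A.
Proof.
apply: (smallest_sub (@sigma_algebra_measurable _ Omega)).
exact: past_rect_measurable.
Qed.

Lemma past_id_measurable t : measurable_fun setT (fun w : Omega => w : past t).
Proof. by move=> _ A mA; rewrite setTI; exact: (@past_measurable t). Qed.

Lemma past_Y_measurable t s : (s < t)%N ->
  measurable_fun setT (fun w : past t => Y s w).
Proof.
move=> st _ B mB; rewrite setTI; apply: sub_sigma_algebra.
exists (fun i => if i == s then B else setT); split; first by move=> i; case: ifP.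
apply/seteqP; split => [w Bw i /= _|w /(_ s st)/=]; last by rewrite eqxx.
by case: eqP => // ->.
Qed.

Lemma past_rect_setI t : setI_closed (past_rect t).
Proof.
move=> _ _ [B [mB ->]] [C [mC ->]]; exists (fun s => B s `&` C s); split.
  by move=> s; exact: measurableI.
by rewrite -bigcapI; apply: eq_bigcapr => s _; rewrite preimage_setI.
Qed.

Lemma past_rect_setT t : past_rect t setT.
Proof.
exists (fun=> setT); split => //; apply/esym; rewrite -subTset => w _ s _; exact: I.
Qed.

(** Both sides are finite measures in [A]. They agree on the cylinders, which are stable under
    intersection, hence on the sigma-algebra that these generate. *)
Lemma past_independent t (A : set Omega) (B : set S) :
  <<s past_rect t >> A -> measurable B ->
  (P (A `&` Y t @^-1` B) = P A * mu B)%E.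
Proof.
move=> sA mB.
have muB : mu B = (fine (mu B))%:E by rewrite fineK// fin_num_measure.
have muB0 : 0 <= fine (mu B) by rewrite fine_ge0.
pose m1 : {measure set Omega -> \bar R} := mrestr P (mYpre t mB).
pose m2 : {measure set Omega -> \bar R} := mscale (NngNum muB0) P.
have : m1 A = m2 A.
  apply: (@g_sigma_algebra_measure_unique _ _ _ (past_rect t) _ (fun=> setT)) => //.
  - exact: past_rect_measurable.
  - by move=> _; exact: past_rect_setT.
  - by rewrite bigcup_const//; exists 0%N.
  - exact: past_rect_setI.
  - move=> _ [C [mC ->]]; rewrite /m1 /m2/= /mrestr /mscale/= -muB iidY//.
    pose C' s := if (s < t)%N then C s else B.
    have mC' s : measurable (C' s) by rewrite /C'; case: ifP.
    rewrite (_ : _ `&` _ = \bigcap_(s in `I_t.+1) Y s @^-1` C' s).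
      rewrite iidY// big_ord_recr/= muleC; congr (_ * _)%E.
        by rewrite /C' ltnn.
      by apply: eq_bigr => s _; rewrite /C' ltn_ord.
    apply/seteqP; split => [w [Cw Bw] s /=|w Cw].
      rewrite ltnS leq_eqVlt /C' => /orP[/eqP ->|st]; first by rewrite ltnn.
      by rewrite st; exact: Cw.
    split => [s st|].
      by have := Cw s (ltnW st); rewrite /C' st.
    by have := Cw t (ltnSn t); rewrite /C' /= ltnn.
  - by move=> _; rewrite /m1/= /mrestr/= setTI -ge0_fin_numE// fin_num_measure//; exact: mYpre.
by rewrite /m1 /m2 /= /mrestr /mscale/= -muB muleC.
Qed.

Local Open Scope ereal_scope.

(** Conditioning on the past: by independence the joint law of the history and [Y t] is a product,
    and Tonelli's theorem applies. *)
Lemma past_tower t (f : past t * S -> \bar R) :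
  measurable_fun setT f -> (forall z, 0 <= f z) ->
  \int[P]_w f (w, Y t w) = \int[P]_w \int[mu]_y f (w, y).
Proof.
move=> mf f0.
pose phi0 := fun w : Omega => (w : past t, Y t w).
have mphi : measurable_fun setT phi0.
  by apply/measurable_fun_pairP; split; [exact: past_id_measurable|exact: mY].
pose phi : {mfun Omega >-> (past t * S)%type} :=
  HB.pack phi0 (isMeasurableFun.Build _ _ _ _ phi0 mphi).
pose idp : {mfun Omega >-> past t} :=
  HB.pack (fun w : Omega => w : past t)
    (isMeasurableFun.Build _ _ _ _ _ (@past_id_measurable t)).
pose P' : probability (past t) R := distribution P idp.
transitivity (\int[distribution P phi]_z f z).
  by rewrite ge0_integral_distribution.
transitivity (\int[P' \x mu]_z f z).
  apply: eq_measure_integral => /= A mA _; apply/esym.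
  apply: product_measure_unique => // B C mB mC.
  exact: (@past_independent t B C mB mC).
rewrite fubini_tonelli1// ge0_integral_distribution//.
  exact: measurable_fun_fubini_tonelli_F.
by move=> w; apply: integral_ge0.
Qed.

Section Supermartingale.
Local Open Scope ring_scope.
Variables (A : Type) (a : nat -> Omega -> A) (h : nat -> A -> S -> R).
Hypothesis da : forall t, @discrete_fun _ (past t) A (a t).
Hypothesis mh : forall t w, measurable_fun setT (h t (a t w)).
Hypothesis h_le1 : forall t w,
  (\int[mu]_y (expR (h t (a t w) y))%:E <= 1)%E.

Let past_incl s t : (s <= t)%N ->
  measurable_fun setT (fun w : past t => w : past s).
Proof.
move=> st _ B mB; rewrite setTI; move: B mB.
apply: smallest_sub; first exact: (@sigma_algebra_measurable _ (past t)).
move=> _ [B [mB ->]]; apply: (@bigcap_measurableType _ (past t)) => s' s's.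
have s't : (s' < t)%N by exact: leq_trans st.
by have := past_Y_measurable s't measurableT (mB s'); rewrite setTI.
Qed.

Let partial t (w : Omega) : R := \sum_(s < t) h s (a s w) (Y s w).

Let partial_measurable t t' : (t <= t')%N ->
  measurable_fun setT (partial t : past t' -> R).
Proof.
move=> tt'; apply: measurable_sum => s.
have st : (s < t')%N by exact: leq_trans tt'.
apply: (@measurable_bind _ (past t') _ _ _ (a s) (fun x w => h s x (Y s w))).
  exact: (discrete_comp (da s) (past_incl (ltnW st))).
move=> w; apply: measurableT_comp; first exact: mh.
exact: past_Y_measurable.
Qed.

Lemma adapted_sum_measurable t : measurable_fun setT (partial t : Omega -> R).
Proof.
exact: (measurableT_comp (@partial_measurable t t (leqnn t)) (@past_id_measurable t)).
Qed.

(** The list [a t] is a function of the past, so the last factor may be integrated first, with the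
    list frozen; [h_le1] then removes it. *)
Lemma exp_supermartingale t :
  (\int[P]_w (expR (\sum_(s < t) h s (a s w) (Y s w)))%:E <= 1)%E.
Proof.
elim: t => [|t ih].
  under eq_integral do rewrite big_ord0 expR0.
  by rewrite integral_cst// mul1e probability_le1.
apply: le_trans ih.
pose f (z : past t * S) := (expR (partial t z.1) * expR (h t (a t z.1) z.2))%:E.
have mf : measurable_fun setT f.
  apply/measurable_EFinP; apply: measurable_funM.
    apply: measurableT_comp => //.
    exact: (measurableT_comp (@partial_measurable t t (leqnn t))
      (@measurable_fst _ _ (past t) S)).
  apply: measurableT_comp => //.
  apply: (@measurable_bind _ (past t * S)%type _ _ _ (a t \o fst) (fun x z => h t x z.2)).
    exact: (discrete_comp (da t) (@measurable_fst _ _ (past t) S)).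
  by move=> z; apply: measurableT_comp => //; exact: mh.
have f0 z : (0 <= f z)%E by rewrite lee_fin mulr_ge0// expR_ge0.
under eq_integral do rewrite big_ord_recr/= expRD.
rewrite (past_tower mf f0).
apply: ge0_le_integral => //.
- by move=> w _; apply: integral_ge0.
- have mF : measurable_fun setT (fubini_F mu f).
    exact: measurable_fun_fubini_tonelli_F.
  exact: (measurableT_comp mF (@past_id_measurable t)).
- apply/measurable_EFinP; apply: measurableT_comp => //.
  exact: adapted_sum_measurable.
- move=> w _; rewrite /f/=.
  under eq_integral do rewrite EFinM.
  rewrite ge0_integralZl//.
  + by rewrite -[leRHS]mule1 lee_wpmul2l ?lee_fin ?expR_ge0// h_le1.
  + by apply/measurable_EFinP; apply: measurableT_comp => //; exact: mh.
Qed.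

End Supermartingale.
End Past.

Lemma discrete_measurable_fun d d' (T : measurableType d) (U : measurableType d')
    (f : T -> U) : discrete_fun f -> measurable_fun setT f.
Proof.
move=> df; apply: (@measurable_bind _ _ _ _ _ f (fun u _ => u)) => // t.
Qed.

(** * Expectations of bounded random variables *)

Section Expectation.
Context d (T : measurableType d) (R : realType) (D : probability T R).
Implicit Types f g : T -> R.

Definition bounded_rv f : Prop :=
  measurable_fun setT f /\ exists M : R, forall x, `|f x| <= M.

Definition expect f : R := \int[D]_x f x.

Lemma bounded_rv_integrable f : bounded_rv f -> D.-integrable setT (EFin \o f).
Proof.
move=> [mf [M fM]]; apply: measurable_bounded_integrable => //.
  by rewrite -ge0_fin_numE// fin_num_measure.
exists M; split; first exact: num_real.
by move=> x Mx y _; apply: le_trans (fM y) (ltW Mx).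
Qed.

Lemma bounded_rv_cst (c : R) : bounded_rv (fun=> c).
Proof. by split; [exact: measurable_cst|exists `|c|]. Qed.

Lemma bounded_rvD f g : bounded_rv f -> bounded_rv g -> bounded_rv (fun x => f x + g x).
Proof.
move=> [mf [M fM]] [mg [N gN]]; split; first exact: measurable_funD.
by exists (M + N) => x; apply: le_trans (ler_normD _ _) (lerD _ _).
Qed.

Lemma bounded_rvM f g : bounded_rv f -> bounded_rv g -> bounded_rv (fun x => f x * g x).
Proof.
move=> [mf [M fM]] [mg [N gN]]; split; first exact: measurable_funM.
by exists (M * N) => x; rewrite normrM ler_pM.
Qed.

Lemma bounded_rvZ (c : R) f : bounded_rv f -> bounded_rv (fun x => c * f x).
Proof. by move=> bf; apply: bounded_rvM => //; exact: bounded_rv_cst. Qed.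

Lemma bounded_rvB f g : bounded_rv f -> bounded_rv g -> bounded_rv (fun x => f x - g x).
Proof.
move=> bf /(bounded_rvZ (-1)) bg.
rewrite (_ : (fun x => _) = fun x => f x + -1 * g x); first exact: bounded_rvD.
by apply/funext => x; rewrite mulN1r.
Qed.

Lemma bounded_rv_sum (I : Type) (r : seq I) (F : I -> T -> R) :
  (forall i, bounded_rv (F i)) -> bounded_rv (fun x => \sum_(i <- r) F i x).
Proof.
move=> bF; elim: r => [|i r ih].
  rewrite (_ : (fun x => _) = fun=> 0); first exact: bounded_rv_cst.
  by apply/funext => x; rewrite big_nil.
rewrite (_ : (fun x => _) = fun x => F i x + \sum_(i <- r) F i x).
  exact: bounded_rvD.
by apply/funext => x; rewrite big_cons.
Qed.

Lemma expect_cst (c : R) : expect (fun=> c) = c.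
Proof.
rewrite /expect Rintegral_cst// (_ : fine _ = 1) ?mulr1//.
by rewrite [X in fine X](probability_setT D).
Qed.

Lemma expect_lin (a b : R) f g : bounded_rv f -> bounded_rv g ->
  expect (fun x => a * f x + b * g x) = a * expect f + b * expect g.
Proof.
move=> bf bg; rewrite /expect RintegralD//; last 2 first.
- by apply: bounded_rv_integrable; exact: bounded_rvZ.
- by apply: bounded_rv_integrable; exact: bounded_rvZ.
by rewrite !RintegralZl//; exact: bounded_rv_integrable.
Qed.

Lemma expectZ (a : R) f : bounded_rv f -> expect (fun x => a * f x) = a * expect f.
Proof. by move=> bf; rewrite /expect RintegralZl//; exact: bounded_rv_integrable. Qed.

Lemma expectD f g : bounded_rv f -> bounded_rv g ->
  expect (fun x => f x + g x) = expect f + expect g.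
Proof. by move=> bf bg; rewrite /expect RintegralD//; exact: bounded_rv_integrable. Qed.

Lemma expectB f g : bounded_rv f -> bounded_rv g ->
  expect (fun x => f x - g x) = expect f - expect g.
Proof. by move=> bf bg; rewrite /expect RintegralB//; exact: bounded_rv_integrable. Qed.

Lemma expect_sum (I : Type) (r : seq I) (F : I -> T -> R) :
  (forall i, bounded_rv (F i)) ->
  expect (fun x => \sum_(i <- r) F i x) = \sum_(i <- r) expect (F i).
Proof.
move=> bF; elim: r => [|i r ih].
  rewrite big_nil -[RHS]expect_cst; congr expect.
  by apply/funext => x; rewrite big_nil.
rewrite big_cons -ih -expectD//; last exact: bounded_rv_sum.
by congr expect; apply/funext => x; rewrite big_cons.
Qed.

Lemma le_expect f g : bounded_rv f -> bounded_rv g -> (forall x, f x <= g x) ->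
  expect f <= expect g.
Proof. by move=> bf bg fg; apply: le_Rintegral => //; exact: bounded_rv_integrable. Qed.

Lemma bounded_rv_discrete (A : Type) (f : T -> A) (g : A -> R) (M : R) :
  discrete_fun f -> (forall t, `|g (f t)| <= M) -> bounded_rv (fun t => g (f t)).
Proof.
move=> df gM; split; last by exists M.
exact: (discrete_measurable_fun (discrete_map g df)).
Qed.

(** The quadratic bound on the exponential gives an expectation of at most [1 + c], and
    [1 + c <= expR c]. *)
Lemma expect_exp_le1 f (c : R) : bounded_rv f -> (forall x, f x <= 1 / 2) ->
  expect f + 2 * expect (fun x => f x ^+ 2) <= c ->
  (\int[D]_x (expR (f x - c))%:E <= 1)%E.
Proof.
move=> bf f12 fc.
have bf2 : bounded_rv (fun x => f x ^+ 2) by exact: bounded_rvM.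
pose g x := expR (- c) * (1 + (1 * f x + 2 * f x ^+ 2)).
have bg : bounded_rv g.
  apply: bounded_rvZ; apply: bounded_rvD; first exact: bounded_rv_cst.
  by apply: bounded_rvD; exact: bounded_rvZ.
apply: (@le_trans _ _ (\int[D]_x (g x)%:E)%E).
  apply: ge0_le_integral => //.
  - apply/measurable_EFinP; apply: measurableT_comp => //.
    by apply: measurable_funB; [exact: bf.1|exact: measurable_cst].
  - by apply/measurable_EFinP; exact: bg.1.
  - move=> x _; rewrite lee_fin addrC expRD ler_wpM2l ?expR_ge0// mul1r addrA.
    exact: expR_le_quadratic.
rewrite -[X in (X <= _)%E]fineK; last first.
  exact: (integrable_fin_num measurableT (bounded_rv_integrable bg)).
rewrite lee_fin -[X in X <= _]/(expect g) /g expectZ; last first.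
  apply: bounded_rvD; first exact: bounded_rv_cst.
  by apply: bounded_rvD; exact: bounded_rvZ.
rewrite expectD ?expect_cst ?expect_lin//; last 2 first.
- exact: bounded_rv_cst.
- by apply: bounded_rvD; exact: bounded_rvZ.
rewrite expRN mulrC ler_pdivrMr ?expR_gt0// !mul1r.
by apply: le_trans (expR_ge1Dx c); lra.
Qed.

End Expectation.

(** * Sampling from a probability vector *)

Section Sampling.
Context (R : realType) (K : nat) (a0 : 'I_K).

Definition cumulative (p : 'I_K -> R) (a : 'I_K) : R :=
  \sum_(b < K | (b < a)%N) p b.

(* Inverse transform sampling from the probability vector [p]. *)
Definition sample (p : 'I_K -> R) (u : R) : 'I_K :=
  odflt a0 [pick a | cumulative p a <= u < cumulative p a + p a].

(** The chosen index depends on [t] only through a finite vector of truth values. *)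
Lemma discrete_pick d (T : measurableType d) (B : 'I_K -> T -> bool) :
  (forall a, measurable_fun setT (B a)) ->
  discrete_fun (fun t => odflt a0 [pick a | B a t]).
Proof.
move=> mB.
have dB : discrete_fun (fun t => [ffun a => B a t]).
  apply: discrete_finite => f.
  rewrite (_ : _ @^-1` _ = \bigcap_(a in [set: 'I_K]) (B a @^-1` [set f a])).
    apply: fin_bigcap_measurable => // a _.
    by rewrite -[X in measurable X]setTI; exact: mB.
  apply/seteqP; split => [t <- a _|t Bt] /=; first by rewrite ffunE.
  by apply/ffunP => a; rewrite ffunE; exact: Bt.
rewrite (_ : (fun t => _) = (fun t => odflt a0 [pick a | [ffun a => B a t] a])).
  exact: (discrete_map (fun f : {ffun 'I_K -> bool} => odflt a0 [pick a | f a]) dB).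
by apply/funext => t; congr odflt; apply: eq_pick => a; rewrite ffunE.
Qed.

Lemma discrete_sample d (T : measurableType d) (p : T -> 'I_K -> R) (u : T -> R) :
  (forall a, measurable_fun setT (fun t => p t a)) -> measurable_fun setT u ->
  discrete_fun (fun t => sample (p t) (u t)).
Proof.
move=> mp mu; apply: discrete_pick => a.
have mc : measurable_fun setT (fun t => cumulative (p t) a).
  rewrite (_ : (fun t => _) = fun t => \sum_(b < K) if (b < a)%N then p t b else 0).
    by apply: measurable_sum => b; case: (b < a)%N; [exact: mp|exact: measurable_cst].
  by apply/funext => t; rewrite /cumulative big_mkcond.
apply: measurable_and; first exact: measurable_fun_ler.
by apply: measurable_fun_ltr => //; exact: measurable_funD.
Qed.

Local Notation U := (uniform_prob (@ltr01 R)).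

Section Vector.
Variable p : 'I_K -> R.
Hypotheses (p0 : forall a, 0 <= p a) (p1 : \sum_a p a = 1).

Lemma cumulative_ge0 a : 0 <= cumulative p a.
Proof. by apply: sumr_ge0. Qed.

Lemma cumulativeS_le1 a : cumulative p a + p a <= 1.
Proof.
rewrite -p1 addrC /cumulative.
have -> : p a + \sum_(b < K | (b < a)%N) p b = \sum_(b < K | (b <= a)%N) p b.
  rewrite [RHS](bigD1 a)//=; congr (_ + _); apply: eq_bigl => b.
  by rewrite ltn_neqAle andbC.
by rewrite [leRHS](bigID (fun b : 'I_K => (b <= a)%N))/= lerDl sumr_ge0.
Qed.

Lemma sampleP a u : cumulative p a <= u < cumulative p a + p a -> sample p u = a.
Proof.
move=> ua; have key (b c : 'I_K) : (b < c)%N -> cumulative p b + p b <= cumulative p c.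
  move=> bc; rewrite addrC /cumulative [leRHS](bigD1 b)//= lerD2l.
  rewrite [leRHS](bigID (fun i : 'I_K => (i < b)%N))/=.
  rewrite ler_wpDr ?sumr_ge0//.
  rewrite le_eqVlt; apply/orP; left; apply/eqP; apply: eq_bigl => i.
  case: (ltnP i b) => ib; rewrite ?andbF// andbT; apply/esym.
  by rewrite (ltn_trans ib bc) -val_eqE/= (ltn_eqF ib).
rewrite /sample; case: pickP => [b|/(_ a)]; last by rewrite ua.
case/andP: ua => a1 a2 /andP[b1 b2] /=.
have [ab|ba|] := ltngtP b a; last exact: val_inj.
  by have := lt_le_trans b2 (le_trans (key _ _ ab) a1); rewrite ltxx.
by have := lt_le_trans a2 (le_trans (key _ _ ba) b1); rewrite ltxx.
Qed.

Lemma sample_indicator_bounded a :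
  @bounded_rv _ (measurableTypeR R) R (fun u => (sample p u == a)%:R).
Proof.
apply: (@bounded_rv_discrete _ (measurableTypeR R) _ _ (sample p)
  (fun b => (b == a)%:R) 1).
  by apply: (@discrete_sample _ (measurableTypeR R) (fun _ => p) id).
by move=> u; case: eqP; rewrite ?normr1 ?normr0.
Qed.

(** The interval attached to [a] only gives [p a] as a lower bound. Both families sum to 1, which
    forces equality without examining the seeds that fall back on the default [a0]. *)
Lemma expect_sample_indicator a : expect U (fun u => (sample p u == a)%:R) = p a.
Proof.
have itvE (c e : R) : 0 <= c -> c <= e -> e <= 1 ->
    expect U \1_[set` `[c, e[%R] = e - c.
  move=> c0 ce e1.
  have mA : measurable ([set` `[c, e[%R] : set (measurableTypeR R)) by [].
  rewrite /expect /Rintegral integral_uniform//=; last first.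
    by apply/measurable_EFinP; exact: measurable_indic.
  rewrite subr0 invr1 mul1e integral_indic// setIidl; last first.
    by move=> x /=; rewrite !in_itv/= => /andP[? ?]; apply/andP; split; lra.
  rewrite [X in fine X](@lebesgue_measure_itv R `[c, e[%R)/= lte_fin; case: ltP => //= ec.
  by rewrite (_ : e = c) ?subrr//; lra.
pose f b := expect U (fun u => (sample p u == b)%:R).
have lef b : p b <= f b.
  have -> : p b = cumulative p b + p b - cumulative p b by ring.
  rewrite -itvE ?cumulative_ge0 ?cumulativeS_le1 ?lerDl//.
  apply: le_expect.
  - split; first exact: measurable_indic.
    by exists 1 => u; rewrite indicE; case: (_ \in _); rewrite ?normr1 ?normr0.
  - exact: sample_indicator_bounded.
  - move=> u; rewrite indicE; case: (boolP (u \in _)) => [|_]; last by rewrite ler0n.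
    by rewrite inE/= in_itv/= => /sampleP ->; rewrite eqxx.
have sumf : \sum_b f b = 1.
  rewrite -expect_sum; last exact: sample_indicator_bounded.
  rewrite -[RHS](expect_cst U); congr expect; apply/funext => u.
  by rewrite (bigD1 (sample p u))//= eqxx big1 ?addr0// => b; rewrite eq_sym => /negbTE ->.
apply/eqP; rewrite eq_le lef andbT -/(f a).
have h : \sum_(b | b != a) p b <= \sum_(b | b != a) f b by exact: ler_sum.
move: sumf; have := p1; rewrite (bigD1 a)//= => p1a; rewrite (bigD1 a)//= => f1a.
rewrite -(lerD2r (\sum_(b | b != a) p b)) p1a -f1a lerD2l//.
Qed.

Lemma expect_sample (F : 'I_K -> R) :
  expect U (fun u => F (sample p u)) = \sum_a p a * F a.
Proof.
transitivity (expect U (fun u => \sum_a F a * (sample p u == a)%:R)).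
  congr expect; apply/funext => u.
  rewrite (bigD1 (sample p u))//= eqxx mulr1 big1 ?addr0// => b.
  by rewrite eq_sym => /negbTE ->; rewrite mulr0.
rewrite expect_sum; last by move=> b; apply: bounded_rvZ; exact: sample_indicator_bounded.
apply: eq_bigr => a _; rewrite expectZ; last exact: sample_indicator_bounded.
by rewrite expect_sample_indicator mulrC.
Qed.

End Vector.

Section Product.
Context d (Z : measurableType d) (D : probability Z R).
Variables (p : Z -> 'I_K -> R) (F : 'I_K -> Z -> R).
Hypotheses (mp : forall a, measurable_fun setT (fun z => p z a)).
Hypotheses (p0 : forall z a, 0 <= p z a) (p1 : forall z, \sum_a p z a = 1).
Hypothesis bF : forall a, bounded_rv (F a).

Lemma bounded_rv_fst d' (Z' : measurableType d') (f : Z -> R) : bounded_rv f ->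
  bounded_rv (fun y : Z * Z' => f y.1).
Proof.
move=> [mf [M fM]]; split; last by exists M => y.
exact: (measurableT_comp mf (@measurable_fst _ _ Z Z')).
Qed.

Lemma bounded_rv_sample :
  bounded_rv (fun y : (Z * measurableTypeR R)%type => F (sample (p y.1) y.2) y.1).
Proof.
have ds : @discrete_fun _ (Z * measurableTypeR R)%type _
    (fun y => sample (p y.1) y.2).
  apply: (@discrete_sample _ (Z * measurableTypeR R)%type (fun y => p y.1) snd) => //.
  by move=> a; exact: (measurableT_comp (mp a) (@measurable_fst _ _ Z _)).
split.
  apply: (@measurable_bind _ (Z * measurableTypeR R)%type _ _ _
    (fun y => sample (p y.1) y.2) (fun a y => F a y.1)) => // y.
  exact: (measurableT_comp (bF _).1 (@measurable_fst _ _ Z _)).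
have hM a : {M | forall x, `|F a x| <= M} by apply: cid; exact: (bF a).2.
exists (\sum_a `|sval (hM a)|) => y; set a := sample _ _.
apply: (le_trans (svalP (hM a) y.1)); apply: (le_trans (ler_norm _)).
by rewrite (bigD1 a)//= lerDl sumr_ge0.
Qed.

(** Fubini, integrating over the seed first. All moments of the importance-weighted rewards come
    from this identity. *)
Lemma expect_product_sample :
  expect (D \x U)%E (fun y => F (sample (p y.1) y.2) y.1) =
  expect D (fun z => \sum_a p z a * F a z).
Proof.
rewrite {1}/expect /Rintegral -integral12_prod_meas1; last first.
  exact: (bounded_rv_integrable (D \x U)%E bounded_rv_sample).
congr fine; apply: eq_integral => z _; rewrite /fubini_F/=.
rewrite -(expect_sample (p0 z) (p1 z) (F ^~ z)) /expect /Rintegral fineK//.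
apply: (integrable_fin_num measurableT).
apply: (@bounded_rv_integrable _ _ _ U).
apply: (@bounded_rv_discrete _ (measurableTypeR R) _ _ (sample (p z)) (F ^~ z)
  (\sum_a `|F a z|)).
  by apply: (@discrete_sample _ (measurableTypeR R) (fun _ => p z) id).
by move=> u; rewrite (bigD1 (sample (p z) u))//= lerDl sumr_ge0.
Qed.

End Product.
End Sampling.

(** * The algorithm *)

Section Programs.
Context (R : realType) (K : nat) (X : Type).

Fixpoint bind_prog (A B : Type) (p : prog R K X A) (f : A -> prog R K X B) :
    prog R K X B :=
  match p with
  | Ret r => f r
  | Ask q k => Ask q (fun pi => bind_prog (k pi) f)
  end.

Lemma run_bind_prog (A B : Type) orc (p : prog R K X A) (f : A -> prog R K X B) :
  run orc (bind_prog p f) =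
  ((run orc (f (run orc p).1)).1, ((run orc p).2 + (run orc (f (run orc p).1)).2)%N).
Proof.
elim: p => [r|q k ih] /=; first by case: (run _ _).
by rewrite ih.
Qed.

End Programs.

Section Algorithm.
Context (R : realType) (K : nat) (X : Type) (a0 : 'I_K) (L : R).

(* Before the first active epoch actions are uniform. *)
Definition active (m : nat) : bool :=
  if m is m'.+1 then 4 * K%:R * L <= 2 ^+ m' else false.

(** [2 ^+ m.-1] is the length of the previous epoch, whose data serve for the design. The value
    [1/K] cancels the factor of the mixture in [act_prob], which is then uniform whatever the
    list. *)
Definition rate (m : nat) : R :=
  if active m then Num.sqrt (L / (K%:R * 2 ^+ m.-1)) else K%:R^-1.

(** Round 0 falls into epoch 0, together with round 1, by the default value of [trunc_log]; epoch 0
    is never active. *)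
Definition epoch (t : nat) : nat := trunc_log 2 t.

Definition refresh (t : nat) : bool := (t == 2 ^ epoch t)%N && active (epoch t).

(* Almost all rewards are in [0, 1] already; clipping makes the queries valid on
   every run. *)
Definition clip (r : R) : R := Num.max 0 (Num.min 1 r).

Definition ips (m : nat) (l : seq (X -> 'I_K)) (x : X) (a : 'I_K) (r : R) :
    K.-tuple R :=
  [tuple if b == a then clip r / act_prob (rate m) l x a else 0 | b < K].

(** At a refresh the history has [2 ^ m] entries; dropping the first half leaves exactly those of
    epoch [m - 1]. *)
Definition epoch_list (s : seq (X -> 'I_K) * query R K X) :
    prog R K X (seq (X -> 'I_K)) :=
  let t := size s.2 in let m := epoch t in
  if refresh t then design (rate m) (drop (2 ^ m.-1) s.2) else Ret s.1.

Definition taming_round (s : seq (X -> 'I_K) * query R K X) (x : X) (u : R) :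
    prog R K X ('I_K * (R -> seq (X -> 'I_K) * query R K X)) :=
  let m := epoch (size s.2) in
  bind_prog (epoch_list s) (fun l =>
    let a := sample a0 (act_prob (rate m) l x) u in
    Ret (a, fun r => (l, rcons s.2 (x, ips m l x a r)))).

(* The state consists of the policies of the current mixture and of the
   importance-weighted history. *)
Definition taming : bandit_algorithm R K X :=
  BanditAlgorithm ([::], [::]) taming_round.

Section Rates.
Hypotheses (L0 : 0 < L) (K_gt0 : (0 < K)%N).

Let K0 : 0 < K%:R :> R. Proof. by rewrite ltr0n. Qed.
Let K1 : 1 <= K%:R :> R. Proof. by rewrite ler1n. Qed.

Lemma rate_inactive m : ~~ active m -> rate m = K%:R^-1.
Proof. by move=> am; rewrite /rate (negbTE am). Qed.

Lemma rate_gt0 m : 0 < rate m.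
Proof.
rewrite /rate; case: ifP => _; last by rewrite invr_gt0.
by rewrite sqrtr_gt0 divr_gt0// mulr_gt0// exprn_gt0.
Qed.

Lemma rate_active_sqr m : active m.+1 -> rate m.+1 ^+ 2 * (K%:R * 2 ^+ m) = L.
Proof.
move=> am; rewrite /rate am sqr_sqrtr/=; last first.
  by rewrite divr_ge0 ?ltW// mulr_gt0// exprn_gt0.
by rewrite divfK// gt_eqF// mulr_gt0// exprn_gt0.
Qed.

(** After squaring, this is the threshold in [active]: the square of [K * rate m.+1] is
    [K * L / 2 ^+ m]. *)
Lemma rate_active m : active m -> K%:R * rate m <= 1 / 2.
Proof.
case: m => [//|m] am; rewrite -(@ler_pXn2r _ 2)// ?nnegrE; last 2 first.
- by rewrite mulr_ge0// ltW// rate_gt0.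
- by rewrite divr_ge0.
have := rate_active_sqr am; have := am => /= h1 h2.
have p0 : 0 < 2 ^+ m :> R by rewrite exprn_gt0.
rewrite -(ler_pM2r p0) exprMn.
have -> : K%:R ^+ 2 * rate m.+1 ^+ 2 * 2 ^+ m = K%:R * L by rewrite -h2; ring.
by rewrite expr2; lra.
Qed.

Lemma active_mono m m' : (m <= m')%N -> active m -> active m'.
Proof.
case: m m' => [//|m] [//|m'] mm' /= h; apply: le_trans h _.
by rewrite ler_weXn2l// ler1n.
Qed.

Lemma rate_le_inv m : rate m <= K%:R^-1.
Proof.
case am : (active m); last by rewrite /rate am.
rewrite -[leRHS]mul1r ler_pdivlMr// mulrC.
by apply: le_trans (rate_active am) _; lra.
Qed.

Lemma rateS_le m : rate m.+1 <= rate m.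
Proof.
case am : (active m); last by rewrite {2}/rate am rate_le_inv.
have am1 := active_mono (leqnSn m) am.
case: m am am1 => [//|m] am am1; rewrite /rate am am1 /=.
rewrite ler_wsqrtr// ler_pM2l// lef_pV2 ?posrE ?mulr_gt0 ?exprn_gt0//.
by rewrite ler_pM2l// ler_weXn2l// ler1n.
Qed.

Definition valid_list (Pi : set (X -> 'I_K)) (m : nat) (l : seq (X -> 'I_K)) :=
  all_in Pi l /\ (active m -> ~~ nilp l).

Lemma act_prob_inactive m (l : seq (X -> 'I_K)) x a : ~~ active m ->
  act_prob (rate m) l x a = rate m.
Proof.
move=> am; rewrite /act_prob /rate (negbTE am) divff ?gt_eqF//.
by rewrite subrr mul0r add0r.
Qed.

Lemma act_prob_ge_rate Pi m l x a : valid_list Pi m l ->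
  rate m <= act_prob (rate m) l x a.
Proof.
move=> [_ l0]; case am : (active m); last by rewrite act_prob_inactive ?am.
exact: (act_prob_ge K_gt0 (rate_gt0 m) (rate_active am) x a (l0 am)).
Qed.

Lemma act_prob_pos Pi m l x a : valid_list Pi m l -> 0 < act_prob (rate m) l x a.
Proof. by move=> h; apply: lt_le_trans (rate_gt0 m) (act_prob_ge_rate x a h). Qed.

Lemma sum_act_prob Pi m l x : valid_list Pi m l ->
  \sum_a act_prob (rate m) l x a = 1.
Proof.
move=> [_ l0]; case am : (active m); last first.
  rewrite (eq_bigr (fun=> K%:R^-1)) => [|a _].
    by rewrite sumr_const card_ord -[_ *+ K]mulr_natl mulfV// gt_eqF.
  by rewrite act_prob_inactive ?am// /rate am.
rewrite big_split/= sumr_const card_ord -mulr_sumr -mixture_sum.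
have -> : mixture (rate m / 8) l (fun p => \sum_a (p x == a)%:R) =
          mixture (rate m / 8) l (fun=> 1).
  apply: (@eq_mixture _ _ _ _ _ (fun=> True)).
  - by rewrite divr_ge0// ltW// rate_gt0.
  - have := rate_active am; have : rate m <= K%:R * rate m.
      by rewrite ler_peMl// ltW// rate_gt0.
    lra.
  - exact: all_in_true.
  - move=> p _; rewrite (bigD1 (p x))//= eqxx big1 ?addr0// => a.
    by rewrite eq_sym => /negbTE ->.
rewrite mixture_cst ?l0// -[_ *+ K]mulr_natl; ring.
Qed.

End Rates.
End Algorithm.

(** * Runs of the algorithm: current lists and histories *)

Section Execution.
Context (R : realType) (K : nat) (X : Type) (a0 : 'I_K) (L : R).
Variables (orc : query R K X -> X -> 'I_K).
Implicit Types (y : nat -> X * K.-tuple R * R) (t m : nat).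

Local Notation alg := (taming X a0 L).

Definition state y t : seq (X -> 'I_K) * query R K X := @state_at R K X alg orc y t.

Definition cur_list y t : seq (X -> 'I_K) := (run orc (epoch_list L (state y t))).1.

Definition cur_prob y t (x : X) : 'I_K -> R :=
  act_prob (rate K L (epoch t)) (cur_list y t) x.

Definition act y t : 'I_K := sample a0 (cur_prob y t (y t).1.1) (y t).2.

Definition obs y t : X * K.-tuple R :=
  ((y t).1.1, ips L (epoch t) (cur_list y t) (y t).1.1 (act y t)
                  (tnth (y t).1.2 (act y t))).

Lemma taming_roundE (s : seq (X -> 'I_K) * query R K X) x u :
  let l := (run orc (epoch_list L s)).1 in
  let a := sample a0 (act_prob (rate K L (epoch (size s.2))) l x) u in
  run orc (taming_round a0 L s x u) =
  ((a, fun r => (l, rcons s.2 (x, ips L (epoch (size s.2)) l x a r))),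
   (run orc (epoch_list L s)).2).
Proof. by rewrite /taming_round run_bind_prog /= addn0. Qed.

Lemma size_state y t : size (state y t).2 = t.
Proof.
elim: t => [//|t ih]; rewrite /state /= /round_at/= -/(state y t).
by rewrite taming_roundE/= size_rcons ih.
Qed.

Lemma stateS y t : state y t.+1 = (cur_list y t, rcons (state y t).2 (obs y t)).
Proof.
rewrite {1}/state /= /round_at/= -/(state y t) taming_roundE/=.
by rewrite /obs /act /cur_prob /cur_list size_state.
Qed.

Lemma action_atE y t : @action_at R K X alg orc y t = act y t.
Proof.
rewrite /action_at /round_at/= -/(state y t) taming_roundE/=.
by rewrite /act /cur_prob /cur_list size_state.
Qed.

Lemma round_callsE y t : (@round_at R K X alg orc y (state y t) t).2 =
  (run orc (epoch_list L (state y t))).2.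
Proof. by rewrite /round_at/= taming_roundE. Qed.

Lemma historyE y t : (state y t).2 = mkseq (obs y) t.
Proof. by elim: t => [//|t ih]; rewrite stateS/= ih /mkseq -addn1 iotaD map_cat cats1. Qed.

Definition epoch_data y m : query R K X := mkseq (fun i => obs y (2 ^ m + i)) (2 ^ m).

Lemma epoch_bounds t : (0 < t)%N -> (2 ^ epoch t <= t < 2 ^ (epoch t).+1)%N.
Proof. by move=> t0; exact: trunc_log_bounds. Qed.

Lemma epoch_eq m t : (2 ^ m <= t < 2 ^ m.+1)%N -> epoch t = m.
Proof. by move=> h; exact: trunc_log_eq. Qed.

Lemma epoch_pow m : epoch (2 ^ m) = m.
Proof. by apply: epoch_eq; rewrite leqnn ltn_exp2l//=. Qed.

Lemma refreshP t : refresh K L t ->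
  exists2 m, active K L m.+1 & t = (2 ^ m.+1)%N.
Proof.
rewrite /refresh; case e : (epoch t) => [|m] /andP[/eqP te am] //.
by exists m.
Qed.

Lemma refresh_pow m : active K L m -> refresh K L (2 ^ m).
Proof.
by move=> am; rewrite /refresh epoch_pow am eqxx.
Qed.

Lemma epoch_listE y m : active K L m.+1 ->
  epoch_list L (state y (2 ^ m.+1)) = design (rate K L m.+1) (epoch_data y m).
Proof.
move=> am; rewrite /epoch_list size_state refresh_pow//.
rewrite epoch_pow /=; congr design.
rewrite historyE /epoch_data /mkseq -map_drop drop_iota add0n.
have -> : (2 ^ m.+1 - 2 ^ m)%N = (2 ^ m)%N by rewrite expnS mul2n -addnn addnK.
rewrite -[X in iota X](addn0) iotaDl -map_comp.
by apply: eq_map.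
Qed.

Lemma epoch_list_idle y t : ~~ refresh K L t -> epoch_list L (state y t) = Ret (state y t).1.
Proof. by move=> nr; rewrite /epoch_list size_state (negbTE nr). Qed.

Lemma cur_list_idle y t : ~~ refresh K L t.+1 -> cur_list y t.+1 = cur_list y t.
Proof. by move=> nr; rewrite {1}/cur_list epoch_list_idle// stateS. Qed.

Lemma refresh0 : refresh K L 0 = false.
Proof. by apply/negP => /refreshP[m _] /esym/eqP; rewrite expn_eq0. Qed.

Lemma cur_list0 y : cur_list y 0 = [::].
Proof. by rewrite /cur_list epoch_list_idle// refresh0. Qed.

Lemma cur_list_const y m i : (i < 2 ^ m)%N -> cur_list y (2 ^ m + i) = cur_list y (2 ^ m).
Proof.
elim: i => [|i ih] ib; first by rewrite addn0.
rewrite addnS cur_list_idle ?ih// 1?ltnW//.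
rewrite /refresh (@epoch_eq m).
  by rewrite -addnS -[X in _ == X]addn0 eqn_add2l.
by rewrite -addnS leq_addr/= expnS mul2n -addnn ltn_add2l.
Qed.

Variables (Pi : set (X -> 'I_K)).
Hypotheses (HPi : opt_oracle Pi orc) (L0 : 0 < L) (K_gt0 : (0 < K)%N).

Lemma clip01 (r : R) : 0 <= clip r <= 1.
Proof. by rewrite /clip le_max lexx/= ge_max ler01/= ge_min lexx. Qed.

Lemma ips_ge0 m l x a (r : R) b : valid_list L Pi m l -> 0 <= tnth (ips L m l x a r) b.
Proof.
move=> lP; rewrite tnth_mktuple; case: eqP => // _.
have /andP[c0 _] := clip01 r.
by rewrite divr_ge0// ltW// (act_prob_pos L0 K_gt0 x a lP).
Qed.

(** Strong induction, because of a circular dependence: the oracle is reliable on nonnegative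
    queries only, these need positive probabilities in the previous epoch, and positivity comes from
    the validity of the earlier lists. *)
Lemma valid_cur_list y t : valid_list L Pi (epoch t) (cur_list y t).
Proof.
elim/ltn_ind: t => t ih.
have [rt|nrt] := boolP (refresh K L t).
  have [m am tE] := refreshP rt; rewrite tE epoch_pow.
  rewrite /cur_list epoch_listE//.
  have data0 : nonneg_query (epoch_data y m).
    rewrite /nonneg_query all_map; apply/allP => i; rewrite mem_iota add0n /= => im.
    apply/forallP => b; apply: ips_ge0; apply: ih.
    by rewrite tE expnS mul2n -addnn ltn_add2l.
  have sd : (0 < size (epoch_data y m))%N by rewrite size_mkseq expn_gt0.
  by have [h1 h2 _ _ _] := design_spec HPi K_gt0 (rate_gt0 L0 K_gt0 _)
    (rate_active L0 K_gt0 am) data0 sd.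
case: t => [|t] in ih nrt *; first by rewrite cur_list0.
rewrite cur_list_idle//; have [h1 h2] := ih t (ltnSn t).
split => // am; apply: h2; move: nrt; rewrite /refresh am andbT => nrt.
have /andP[e1 e2] := epoch_bounds (ltn0Sn t).
rewrite (@epoch_eq (epoch t.+1))// (ltn_trans _ e2)// andbT.
by move: e1; rewrite leq_eqVlt eq_sym (negbTE nrt) ltnS.
Qed.

Lemma obs_nonneg y t b : 0 <= tnth (obs y t).2 b.
Proof. by apply: ips_ge0; exact: valid_cur_list. Qed.

Lemma epoch_data_nonneg y m : nonneg_query (epoch_data y m).
Proof.
rewrite /nonneg_query all_map; apply/allP => i _.
by apply/forallP => b; exact: obs_nonneg.
Qed.

Lemma epoch_design_spec y m : active K L m.+1 ->
  let l := cur_list y (2 ^ m.+1) in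
  let dat := epoch_data y m in let mu := rate K L m.+1 in
  [/\ ~~ nilp l, all_in Pi l,
    exists2 lead, Pi lead & forall p, Pi p ->
      emp_reward dat p <= emp_reward dat lead &
    forall p, Pi p -> gap mu l dat p <= 2].
Proof.
move=> am; rewrite /cur_list epoch_listE//.
have sd : (0 < size (epoch_data y m))%N by rewrite size_mkseq expn_gt0.
by have [] := design_spec HPi K_gt0 (rate_gt0 L0 K_gt0 _)
  (rate_active L0 K_gt0 am) (epoch_data_nonneg y m) sd.
Qed.

Lemma round_calls_le y t : ((@round_at R K X alg orc y (state y t) t).2 <=
  if refresh K L t then (design_fuel (rate K L (epoch t))).+1 else 0)%N.
Proof.
rewrite round_callsE; case: ifPn => [rt|nrt]; last by rewrite epoch_list_idle.
have [m am ->] := refreshP rt.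
rewrite epoch_pow epoch_listE//.
have sd : (0 < size (epoch_data y m))%N by rewrite size_mkseq expn_gt0.
by have [] := design_spec HPi K_gt0 (rate_gt0 L0 K_gt0 _)
  (rate_active L0 K_gt0 am) (epoch_data_nonneg y m) sd.
Qed.

End Execution.

(** * Measurability of oracle answers, mixtures and actions *)

Section MeasurablePolicies.
Context (R : realType) (K : nat) (d : measure_display) (X : measurableType d).
Variable Pi : set (X -> 'I_K).
Hypothesis mPi : forall pi, Pi pi -> measurable_policy pi.

Lemma discrete_policy d' (T : measurableType d') (pi : X -> 'I_K) (x : T -> X) :
  Pi pi -> measurable_fun setT x -> discrete_fun (fun w => pi (x w)).
Proof.
move=> Ppi mx; apply: discrete_finite => a.
by rewrite -[X in measurable X]setTI; apply: (mx measurableT (pi @^-1` [set a])); exact: mPi.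
Qed.

Lemma discrete_actions d' (T : measurableType d') (l : seq (X -> 'I_K)) (x : T -> X) :
  all_in Pi l -> measurable_fun setT x ->
  discrete_fun (fun w => [seq pi (x w) | pi <- l]).
Proof.
move=> + mx; elim: l => [_|pi l ih] /=; first exact: discrete_cst.
move=> [Ppi Pl].
apply: (@discrete_bind _ T _ _ (fun w => pi (x w))
  (fun a w => a :: [seq pi (x w) | pi <- l])).
  exact: (discrete_policy Ppi mx).
by move=> w; exact: (discrete_map (cons (pi (x w))) (ih Pl)).
Qed.

Lemma mixture_map (A B : Type) (al : R) (h : A -> B) (l : seq A) (f : B -> R) :
  mixture al (map h l) f = mixture al l (f \o h).
Proof.
elim: l => [//|p l ih] /=.
by rewrite ih /head_weight /nilp size_map.
Qed.

(** The context enters only through the list of actions that the policies choose, and this list is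
    discrete. *)
Lemma discrete_act_prob d' (T : measurableType d') (mu : R) (l : seq (X -> 'I_K))
    (x : T -> X) (a : 'I_K) : all_in Pi l -> measurable_fun setT x ->
  discrete_fun (fun w => act_prob mu l (x w) a).
Proof.
move=> Pl mx.
rewrite (_ : (fun w => _) = (fun w => (fun s => (1 - K%:R * mu) *
    mixture (mu / 8) s (fun b => (b == a)%:R) + mu) [seq pi (x w) | pi <- l])).
  exact: (discrete_map (fun s => (1 - K%:R * mu) *
    mixture (mu / 8) s (fun b => (b == a)%:R) + mu) (discrete_actions Pl mx)).
by apply/funext => w; rewrite mixture_map.
Qed.

Lemma discrete_policy_prob d' (T : measurableType d') (mu : R)
    (l : seq (X -> 'I_K)) (x : T -> X) (pi : X -> 'I_K) :
  all_in Pi l -> Pi pi -> measurable_fun setT x ->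
  discrete_fun (fun w => act_prob mu l (x w) (pi (x w))).
Proof.
move=> Pl Ppi mx.
apply: (@discrete_bind _ T _ _ (fun w => pi (x w)) (fun a w => act_prob mu l (x w) a)).
  exact: (discrete_policy Ppi mx).
by move=> w; exact: discrete_act_prob.
Qed.

Lemma measurable_policy_reward d' (T : measurableType d') (pi : X -> 'I_K)
    (z : T -> X * K.-tuple R) : Pi pi -> measurable_fun setT z ->
  measurable_fun setT (fun w => tnth (z w).2 (pi (z w).1)).
Proof.
move=> Ppi mz.
apply: (@measurable_bind _ T _ _ _ (fun w => pi (z w).1) (fun a w => tnth (z w).2 a)).
  exact: (discrete_policy Ppi (measurableT_comp (@measurable_fst _ _ X _) mz)).
move=> w; apply: (measurableT_comp (measurable_tnth _)).
exact: (measurableT_comp (@measurable_snd _ _ X _) mz).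
Qed.

Lemma measurable_average d' (T : measurableType d') n (f : X * K.-tuple R -> R)
    (dat : T -> n.-tuple (X * K.-tuple R)) :
  measurable_fun setT f -> measurable_fun setT dat ->
  measurable_fun setT (fun w => average (dat w) f).
Proof.
move=> mf mdat.
rewrite (_ : (fun w => _) =
    (fun w => (\sum_(i < n) f (tnth (dat w) i)) * n%:R^-1)).
  apply: measurable_funM; last exact: measurable_cst.
  apply: measurable_sum => i; apply: (measurableT_comp mf).
  exact: (measurableT_comp (measurable_tnth i) mdat).
by apply/funext => w; rewrite /average size_tuple big_tuple.
Qed.

Variable orc : query R K X -> X -> 'I_K.
Hypotheses (HPi : opt_oracle Pi orc) (morc : measurable_oracle Pi orc).
Hypothesis cPi : countable Pi.
Hypothesis K_gt0 : (0 < K)%N.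

Section Fixed.
Context d' (T : measurableType d') (n : nat).

Lemma discrete_oracle (q : T -> n.-tuple (X * K.-tuple R)) :
  measurable_fun setT q -> (forall w, nonneg_query (q w)) ->
  discrete_fun (fun w => orc (q w)).
Proof.
move=> mq q0; split.
  apply: sub_countable cPi; apply: subset_card_le => _ [w _ <-].
  by case: (HPi (q0 w)).
move=> pi; have [Ppi|nPi] := pselect (Pi pi).
  rewrite (_ : _ @^-1` _ = setT `&` q @^-1` [set q : n.-tuple (X * K.-tuple R)%type |
                 nonneg_query q /\ orc q = pi]).
    by apply: mq => //; exact: morc.
  apply/seteqP; split => [w <-|w [_ []]//] /=; split => //.
rewrite (_ : _ @^-1` _ = set0)//; apply/seteqP; split => // w /= h; apply: nPi.
by rewrite -h; case: (HPi (q0 w)).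
Qed.

Variables (mu : R) (dat : T -> n.-tuple (X * K.-tuple R)).
Hypotheses (mdat : measurable_fun setT dat) (dat0 : forall w, nonneg_query (dat w)).
Hypotheses (mu0 : 0 < mu) (Kmu : K%:R * mu <= 1 / 2) (n_gt0 : (0 < n)%N).

Lemma measurable_gap l pi : all_in Pi l -> Pi pi ->
  measurable_fun setT (fun w => gap mu l (dat w) pi).
Proof.
move=> Pl Ppi.
have mE p : Pi p -> measurable_fun setT (fun w => emp_reward (dat w) p).
  move=> Pp; apply: measurable_average => //.
  exact: (@measurable_policy_reward _ _ p id).
apply: measurable_funD; apply: measurable_funM; try exact: measurable_cst.
  apply: measurable_average => //; apply: discrete_measurable_fun.
  exact: (discrete_map (fun v : R => v^-1)
    (discrete_policy_prob mu Pl Ppi (@measurable_fst _ _ X _))).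
apply: measurable_funB; first exact: mE.
elim: l Pl => [_|p l ih] /=; first exact: measurable_cst.
move=> [Pp Pl]; apply: measurable_funD; apply: measurable_funM; try exact: measurable_cst.
  exact: mE.
exact: ih.
Qed.

(** Each turn binds twice: on the oracle's answer, which ranges over the countable set [Pi], and,
    for a fixed answer, on the outcome of the stopping test. *)
Lemma discrete_design_loop k l : ~~ nilp l -> all_in Pi l ->
  discrete_fun (fun w => run orc (design_loop mu (dat w) k l)).
Proof.
elim: k l => [|k ih] l l0 Pl /=; first exact: discrete_cst.
pose q w := [tuple of score_query mu l (dat w)].
have q0 w : nonneg_query (q w) by exact: score_query_nonneg.
have mq : measurable_fun setT q.
  apply/measurable_fun_tnthP => i.
  rewrite (_ : _ \o q = (fun xr : X * K.-tuple R => (xr.1,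
     [tuple (4 * K%:R)^-1 * (act_prob mu l xr.1 a)^-1 +
                     reward_weight K mu * tnth xr.2 a | a < K])) \o
      (fun w => tnth (dat w) i)); last first.
    by apply/funext => w /=; rewrite tnth_map.
  apply: measurableT_comp; last exact: (measurableT_comp (measurable_tnth i) mdat).
  apply: measurable_fun_pair; first exact: measurable_fst.
  apply/measurable_fun_tnthP => a.
  rewrite (_ : _ \o _ = (fun xr : X * K.-tuple R => (4 * K%:R)^-1 * (act_prob mu l xr.1 a)^-1 +
                     reward_weight K mu * tnth xr.2 a)); last first.
    by apply/funext => xr /=; rewrite tnth_mktuple.
  apply: measurable_funD; apply: measurable_funM; try exact: measurable_cst.
    apply: discrete_measurable_fun; exact: (discrete_map (fun v : R => v^-1)
      (discrete_act_prob mu a Pl (@measurable_fst _ _ X _))).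
  exact: (measurableT_comp (measurable_tnth a) (@measurable_snd _ _ X _)).
pose cont p w := run orc (if gap mu l (dat w) p <= 2 then Ret l
                          else design_loop mu (dat w) k (p :: l)).
apply: (@discrete_bind _ T _ _ (fun w => orc (q w))
   (fun p w => ((cont p w).1, (cont p w).2.+1))).
  exact: discrete_oracle.
move=> w0; have [Pp _] := HPi (q0 w0); set p := orc _ in Pp *.
suff dc : discrete_fun (cont p).
  exact: (discrete_map (fun o : _ * nat => (o.1, o.2.+1)) dc).
apply: (@discrete_bind _ T _ _ (fun w => gap mu l (dat w) p <= 2)
  (fun b w => run orc (if b then Ret l else design_loop mu (dat w) k (p :: l)))).
  apply: discrete_bool; apply: measurable_fun_ler; last exact: measurable_cst.
  exact: measurable_gap.
move=> w /=; case: (gap mu l (dat w) p <= 2); first exact: discrete_cst.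
exact: ih.
Qed.

Lemma discrete_design : discrete_fun (fun w => run orc (design mu (dat w))).
Proof.
rewrite /design /=.
apply: (@discrete_bind _ T _ _ (fun w => orc (dat w))
   (fun p w => ((run orc (design_loop mu (dat w) (design_fuel mu) [:: p])).1,
                (run orc (design_loop mu (dat w) (design_fuel mu) [:: p])).2.+1))).
  exact: discrete_oracle.
move=> w0; have [Pp _] := HPi (dat0 w0).
apply: (discrete_map (fun o : _ * nat => (o.1, o.2.+1)) (discrete_design_loop _ _ _)) => //.
Qed.

End Fixed.

Section Run.
Context (a0 : 'I_K) (L : R) (L0 : 0 < L).
Context d' (T : measurableType d') (y : T -> nat -> X * K.-tuple R * measurableTypeR R).

Let mu m := rate K L m.

Let valid w t : valid_list L Pi (epoch t) (cur_list a0 L orc (y w) t).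
Proof. exact: valid_cur_list. Qed.

Lemma measurable_clip d1 (U : measurableType d1) (f : U -> R) :
  measurable_fun setT f -> measurable_fun setT (fun w => clip (f w)).
Proof.
move=> mf; apply: measurable_maxr; first exact: measurable_cst.
by apply: measurable_minr => //; exact: measurable_cst.
Qed.

Let discrete_act t :
  discrete_fun (fun w => cur_list a0 L orc (y w) t) ->
  measurable_fun setT (fun w => y w t) ->
  discrete_fun (fun w => act a0 L orc (y w) t).
Proof.
move=> dl my.
apply: (@discrete_bind _ T _ _ (fun w => cur_list a0 L orc (y w) t)
  (fun l w => sample a0 (act_prob (mu (epoch t)) l (y w t).1.1) (y w t).2)) => // w.
have [Pl _] := valid w t.
have m1 := measurableT_comp (@measurable_fst _ _ _ _) my.
apply: discrete_sample.
  move=> a; apply: discrete_measurable_fun; apply: (discrete_act_prob _ _ Pl).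
  exact: (measurableT_comp (@measurable_fst _ _ _ _) m1).
exact: (measurableT_comp (@measurable_snd _ _ _ _) my).
Qed.

Let measurable_obs t :
  discrete_fun (fun w => cur_list a0 L orc (y w) t) ->
  measurable_fun setT (fun w => y w t) ->
  measurable_fun setT (fun w => obs a0 L orc (y w) t).
Proof.
move=> dl my; have da := discrete_act dl my.
have m1 := measurableT_comp (@measurable_fst _ _ _ _) my.
have mx := measurableT_comp (@measurable_fst _ _ _ _) m1.
have mr := measurableT_comp (@measurable_snd _ _ _ _) m1.
apply: (@measurable_bind _ T _ _ _ (fun w => cur_list a0 L orc (y w) t)
  (fun l w => ((y w t).1.1, ips L (epoch t) l (y w t).1.1 (act a0 L orc (y w) t)
                  (tnth (y w t).1.2 (act a0 L orc (y w) t))))) => // w0.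
have [Pl _] := valid w0 t; set l := cur_list _ _ _ _ _ in Pl *.
apply: (@measurable_bind _ T _ _ _ (fun w => act a0 L orc (y w) t)
  (fun a w => ((y w t).1.1, ips L (epoch t) l (y w t).1.1 a
                  (tnth (y w t).1.2 a)))) => // w1; set a := act _ _ _ _ _.
apply: measurable_fun_pair => //; apply/measurable_fun_tnthP => b.
rewrite (_ : _ \o _ = (fun w => if b == a then
  clip (tnth (y w t).1.2 a) / act_prob (mu (epoch t)) l (y w t).1.1 a else 0)); last first.
  by apply/funext => w /=; rewrite tnth_mktuple.
case: (b == a); last exact: measurable_cst.
apply: measurable_funM.
  by apply: measurable_clip; exact: (measurableT_comp (measurable_tnth a) mr).
apply: discrete_measurable_fun.
exact: (discrete_map (fun v : R => v^-1) (discrete_act_prob _ _ Pl mx)).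
Qed.

(** Only rounds before [t] are assumed measurable, so that [T] can be [past t]: the list is then
    predictable, as the supermartingale argument requires. *)
Lemma discrete_cur_list t :
  (forall s, (s < t)%N -> measurable_fun setT (fun w => y w s)) ->
  discrete_fun (fun w => cur_list a0 L orc (y w) t).
Proof.
elim/ltn_ind: t => t ih my.
have [rt|nrt] := boolP (refresh K L t).
  have [m am tE] := refreshP rt.
  pose dat w := [tuple of epoch_data a0 L orc (y w) m].
  have mdat : measurable_fun setT dat.
    apply/measurable_fun_tnthP => i.
    have it : (2 ^ m + i < t)%N.
      by rewrite tE expnS mul2n -addnn ltn_add2l.
    rewrite (_ : _ \o dat = fun w => obs a0 L orc (y w) (2 ^ m + i)).
      apply: measurable_obs; last exact: my.
      by apply: ih => // s st; apply: my; exact: (ltn_trans st it).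
    apply/funext => w /=.
    by rewrite (tnth_nth (obs a0 L orc (y w) 0)) /= nth_mkseq.
  rewrite (_ : (fun w => _) = (fun w => (run orc (design (mu m.+1) (dat w))).1)).
    have dd : discrete_fun (fun w => run orc (design (mu m.+1) (dat w))).
      apply: discrete_design => //.
      + by move=> w; exact: (epoch_data_nonneg _ HPi L0 K_gt0).
      + exact: (rate_gt0 L0 K_gt0).
      + exact: (rate_active L0 K_gt0 am).
    exact: (discrete_map (fun o : _ * nat => o.1) dd).
  by apply/funext => w; rewrite /cur_list tE epoch_listE.
case: t => [|t] in ih my nrt *.
  rewrite (_ : (fun w => _) = fun=> [::]); first exact: discrete_cst.
  by apply/funext => w; rewrite cur_list0.
rewrite (_ : (fun w => _) = (fun w => cur_list a0 L orc (y w) t)).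
  by apply: ih => // s st; apply: my; exact: ltnW.
by apply/funext => w; rewrite cur_list_idle.
Qed.

Lemma discrete_action t :
  (forall s, (s <= t)%N -> measurable_fun setT (fun w => y w s)) ->
  discrete_fun (fun w => act a0 L orc (y w) t).
Proof.
move=> my; apply: discrete_act; last exact: my.
by apply: discrete_cur_list => s st; apply: my; exact: ltnW.
Qed.

End Run.
End MeasurablePolicies.

(** * Deviation bounds *)

Section HighProbability.
Context d (Omega : measurableType d) (R : realType) (P : probability Omega R).

(* The event [A] need not be measurable. *)
Definition high_prob (A : set Omega) (e : R) : Prop :=
  exists B, [/\ measurable B, ~` A `<=` B & (P B <= e%:E)%E].

Lemma high_prob_setT : high_prob setT 0.
Proof. by exists set0; split => //; rewrite ?setCT// measure0. Qed.

Lemma high_prob_sub (A A' : set Omega) e : A `<=` A' -> high_prob A e -> high_prob A' e.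
Proof.
move=> AA' [B [mB AB Pe]]; exists B; split => //.
by apply: subset_trans AB; apply: subsetC.
Qed.

Lemma high_probW (A : set Omega) e e' : e <= e' -> high_prob A e -> high_prob A e'.
Proof.
move=> ee' [B [mB AB Pe]]; exists B; split => //.
by apply: le_trans Pe _; rewrite lee_fin.
Qed.

Lemma high_probI (A A' : set Omega) e e' :
  high_prob A e -> high_prob A' e' -> high_prob (A `&` A') (e + e').
Proof.
move=> [B [mB AB Pe]] [B' [mB' AB' Pe']]; exists (B `|` B'); split.
- exact: measurableU.
- by rewrite setCI; apply: setUSS.
- by rewrite EFinD; apply: le_trans (measureU2 P mB mB') _; apply: leeD.
Qed.

Lemma high_prob_bigcap (I : finType) (A : I -> set Omega) (e : I -> R) :
  (forall i, high_prob (A i) (e i)) ->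
  high_prob [set w | forall i, A i w] (\sum_i e i).
Proof.
move=> hA.
suff h (r : seq I) : high_prob [set w | forall i, i \in r -> A i w] (\sum_(i <- r) e i).
  have := h (index_enum I); apply: high_prob_sub => w /= Aw i.
  by apply: Aw; rewrite mem_index_enum.
elim: r => [|i r ih].
  by rewrite big_nil; apply: high_prob_sub high_prob_setT => w _.
rewrite big_cons; apply: high_prob_sub (high_probI (hA i) ih) => w [Ai Ar] j.
by rewrite inE => /orP[/eqP -> //|]; exact: Ar.
Qed.

(** Markov's inequality for the exponential of [H]. *)
Lemma high_prob_chernoff (H : Omega -> R) (c : R) : measurable_fun setT H ->
  (\int[P]_w (expR (H w))%:E <= 1)%E ->
  high_prob [set w | H w <= c] (expR (- c)).
Proof.
move=> mH H1.
pose B := [set w | c < H w].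
have mB : measurable B.
  have mb := measurable_fun_ltr (@measurable_cst _ _ _ _ setT c) mH.
  by have := mb measurableT [set true] I; rewrite setTI.
exists B; split => //.
  by move=> w /= /negP; rewrite -ltNge.
rewrite expRN.
have : ((expR c)%:E * P B <= 1)%E.
  apply: le_trans H1; rewrite -[X in P X]setIT -integral_indic//.
  rewrite -ge0_integralZl//; last by apply/measurable_EFinP; exact: measurable_indic.
  apply: ge0_le_integral => //.
  - by apply: measurable_funeM; apply/measurable_EFinP; exact: measurable_indic.
  - by apply/measurable_EFinP; exact: measurableT_comp.
  - move=> w _; rewrite -EFinM lee_fin indicE; case: (boolP (w \in _)).
      by rewrite inE/= mulr1 ler_expR => /ltW.
    by rewrite mulr0 expR_ge0.
rewrite -[P _]fineK ?fin_num_measure// -EFinM !lee_fin => h.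
by rewrite -[leRHS]mul1r ler_pdivlMr ?expR_gt0// mulrC.
Qed.

End HighProbability.

Section Centered.
Context d (S : measurableType d) (R : realType) (Q : probability S R).

Lemma expect_centered_sqr (g : S -> R) : bounded_rv g ->
  expect Q (fun y => (g y - expect Q g) ^+ 2) <= expect Q (fun y => g y ^+ 2).
Proof.
move=> bg; set e := expect Q g.
have bg2 : bounded_rv (fun y => g y ^+ 2) by exact: bounded_rvM.
have -> : expect Q (fun y => (g y - e) ^+ 2) =
    expect Q (fun y => 1 * g y ^+ 2 + 1 * (- (2 * e) * g y + e ^+ 2 * 1)).
  by congr expect; apply/funext => y; ring.
have b1 := @bounded_rv_cst _ S R 1.
rewrite expect_lin//; last by apply: bounded_rvD; exact: bounded_rvZ.
rewrite expect_lin// expect_cst -/e.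
have -> : 1 * expect Q (fun y => g y ^+ 2) + 1 * (- (2 * e) * e + e ^+ 2 * 1) =
  expect Q (fun y => g y ^+ 2) - e ^+ 2 by ring.
by rewrite gerBl sqr_ge0.
Qed.

Lemma centered_exp_le1 (g : S -> R) (s c : R) : bounded_rv g ->
  (forall y, s * (g y - expect Q g) <= 1 / 2) ->
  2 * s ^+ 2 * expect Q (fun y => g y ^+ 2) <= c ->
  (\int[Q]_y (expR (s * (g y - expect Q g) - c))%:E <= 1)%E.
Proof.
move=> bg gs gc; set e := expect Q g.
have b0 : bounded_rv (fun y => g y - e) by apply: bounded_rvB => //; exact: bounded_rv_cst.
have b2 : bounded_rv (fun y => (g y - e) ^+ 2) by exact: bounded_rvM.
apply: expect_exp_le1 => //; first exact: bounded_rvZ.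
rewrite expectZ// expectB//; last exact: bounded_rv_cst.
rewrite expect_cst subrr mulr0 add0r.
have -> : expect Q (fun y => (s * (g y - e)) ^+ 2) =
    s ^+ 2 * expect Q (fun y => (g y - e) ^+ 2).
  by rewrite -expectZ//; congr expect; apply/funext => y; rewrite exprMn.
apply: le_trans gc; rewrite -mulrA ler_pM2l// ler_wpM2l ?sqr_ge0//.
exact: expect_centered_sqr.
Qed.

Lemma expect_ge0 (f : S -> R) : (forall y, 0 <= f y) -> 0 <= expect Q f.
Proof. by move=> f0; apply: Rintegral_ge0. Qed.

End Centered.

(** * Moments of the importance-weighted rewards and of the regret of a round *)

Section Moments.
Context (R : realType) (K : nat) (d : measure_display) (X : measurableType d).
Context (a0 : 'I_K) (L : R) (D : probability (X * K.-tuple R)%type R).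
Variable Pi : set (X -> 'I_K).
Hypothesis mPi : forall pi, Pi pi -> measurable_policy pi.
Hypotheses (L0 : 0 < L) (K_gt0 : (0 < K)%N).

Local Notation Z := (X * K.-tuple R)%type.
Local Notation law := (D \x uniform_prob (@ltr01 R))%E.
Local Notation rate := (rate K L).
Implicit Types (m : nat) (l : seq (X -> 'I_K)) (p : X -> 'I_K).

Definition clipped p (z : Z) : R := clip (tnth z.2 (p z.1)).

Definition mean_reward p : R := expect D (clipped p).

(** Bounds the second moment of the importance-weighted reward of [p], by [expect_ips_sqr]; rewards
    in the unit interval cost nothing there. *)
Definition true_var m l p : R :=
  expect D (fun z => (act_prob (rate m) l z.1 (p z.1))^-1).

Definition draw m l (y : Z * measurableTypeR R) : 'I_K :=
  sample a0 (act_prob (rate m) l y.1.1) y.2.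

Definition ips_value m l p (y : Z * measurableTypeR R) : R :=
  tnth (ips L m l y.1.1 (draw m l y) (tnth y.1.2 (draw m l y))) (p y.1.1).

Let clip0 (r : R) : 0 <= clip r. Proof. by case/andP: (clip01 r). Qed.
Let clip1 (r : R) : clip r <= 1. Proof. by case/andP: (clip01 r). Qed.
Let clipped0 p z : 0 <= clipped p z. Proof. exact: clip0. Qed.
Let clipped1 p z : clipped p z <= 1. Proof. exact: clip1. Qed.
Let K0 : 0 < K%:R :> R. Proof. by rewrite ltr0n. Qed.
Let rate0 m : 0 < rate m. Proof. exact: rate_gt0. Qed.

Lemma bounded_rv_coord (a : 'I_K) : bounded_rv (fun z : Z => clip (tnth z.2 a)).
Proof.
split; last by exists 1 => z; rewrite ger0_norm ?clip0 ?clip1.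
apply: measurable_clip.
exact: (measurableT_comp (measurable_tnth a) (@measurable_snd _ _ X _)).
Qed.

Lemma bounded_rv_clipped p : Pi p -> bounded_rv (clipped p).
Proof.
move=> Pp; split; last by exists 1 => z; rewrite ger0_norm ?clipped0 ?clipped1.
have mc := @measurable_policy_reward R K _ X Pi mPi _ _ p id Pp (@measurable_id _ _ _).
exact: (measurable_clip mc).
Qed.

Lemma mean_reward01 p : Pi p -> 0 <= mean_reward p <= 1.
Proof.
move=> Pp; apply/andP; split; first by apply: expect_ge0 => z; exact: clipped0.
rewrite -[leRHS](expect_cst D); apply: le_expect.
- exact: bounded_rv_clipped.
- exact: bounded_rv_cst.
- by move=> z; exact: clipped1.
Qed.

Section List.
Variables (m : nat) (l : seq (X -> 'I_K)).
Hypothesis lP : valid_list L Pi m l.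

Let prob x a := act_prob (rate m) l x a.

Let prob_ge x a : rate m <= prob x a.
Proof. exact: (act_prob_ge_rate L0 K_gt0 x a lP). Qed.

Let prob_gt0 x a : 0 < prob x a.
Proof. exact: (act_prob_pos L0 K_gt0 x a lP). Qed.

Let inv_prob_norm x a : `|(prob x a)^-1| <= (rate m)^-1.
Proof.
by rewrite ger0_norm ?invr_ge0 ?(ltW (prob_gt0 _ _))// lef_pV2 ?posrE ?prob_gt0 ?rate0.
Qed.

Let measurable_prob a : measurable_fun setT (fun z : Z => prob z.1 a).
Proof.
apply: discrete_measurable_fun.
exact: (discrete_act_prob mPi _ _ lP.1 (@measurable_fst _ _ X _)).
Qed.

Let prob_sum x : \sum_a prob x a = 1.
Proof. exact: (sum_act_prob L0 K_gt0 x lP). Qed.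

Lemma bounded_rv_inv_prob p : Pi p ->
  bounded_rv (fun z : Z => (act_prob (rate m) l z.1 (p z.1))^-1).
Proof.
move=> Pp.
apply: (bounded_rv_discrete (f := fun z : Z => act_prob (rate m) l z.1 (p z.1))
  (g := fun v => v^-1) (M := (rate m)^-1)) => //.
exact: (discrete_policy_prob mPi _ lP.1 Pp (@measurable_fst _ _ X _)).
Qed.

Let bounded_rv_inv_prob1 a : bounded_rv (fun z : Z => (prob z.1 a)^-1).
Proof.
apply: (bounded_rv_discrete (f := fun z : Z => prob z.1 a)
  (g := fun v => v^-1) (M := (rate m)^-1)) => //.
exact: (discrete_act_prob mPi _ _ lP.1 (@measurable_fst _ _ X _)).
Qed.

Let ips_coord p a (z : Z) : R :=
  (p z.1 == a)%:R * (clip (tnth z.2 a) * (prob z.1 a)^-1).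

Let ips_valueE p y : ips_value m l p y = ips_coord p (draw m l y) y.1.
Proof.
rewrite /ips_value /ips_coord tnth_mktuple; case: eqP => _ /=.
  by rewrite mul1r.
by rewrite mul0r.
Qed.

Let bounded_ips_coord p a : Pi p -> bounded_rv (ips_coord p a).
Proof.
move=> Pp; apply: bounded_rvM; last by apply: bounded_rvM => //; exact: bounded_rv_coord.
apply: (bounded_rv_discrete (f := fun z : Z => p z.1)
  (g := fun b => (b == a)%:R) (M := 1)).
  exact: (discrete_policy mPi Pp (@measurable_fst _ _ X _)).
by move=> z; case: eqP; rewrite ?normr1 ?normr0.
Qed.

Lemma bounded_rv_ips p : Pi p -> bounded_rv (ips_value m l p).
Proof.
move=> Pp; rewrite (_ : ips_value m l p = fun y => ips_coord p (draw m l y) y.1).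
  exact: (bounded_rv_sample a0 (p := fun z : Z => prob z.1)
    (F := ips_coord p) measurable_prob (fun a => bounded_ips_coord a Pp)).
by apply/funext => y; exact: ips_valueE.
Qed.

Lemma expect_ips p : Pi p -> expect law (ips_value m l p) = mean_reward p.
Proof.
move=> Pp; rewrite (_ : ips_value m l p = fun y => ips_coord p (draw m l y) y.1); last first.
  by apply/funext => y; exact: ips_valueE.
have := @expect_product_sample _ _ a0 _ _ D (fun z : Z => prob z.1) (ips_coord p)
  measurable_prob (fun z a => ltW (prob_gt0 z.1 a)) (fun z => prob_sum z.1)
  (fun a => bounded_ips_coord a Pp).
move=> ->; congr expect; apply/funext => z.
rewrite (bigD1 (p z.1))//= big1 ?addr0 => [|a].
  rewrite /ips_coord eqxx mul1r mulrCA divff ?mulr1//.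
  by rewrite gt_eqF.
by rewrite /ips_coord eq_sym => /negbTE ->; rewrite mul0r mulr0.
Qed.

Lemma expect_ips_sqr p : Pi p ->
  expect law (fun y => ips_value m l p y ^+ 2) <= true_var m l p.
Proof.
move=> Pp; pose G a z := ips_coord p a z ^+ 2.
rewrite (_ : (fun y => _) = fun y => G (draw m l y) y.1); last first.
  by apply/funext => y; rewrite ips_valueE.
have bG a : bounded_rv (G a) by apply: bounded_rvM; exact: bounded_ips_coord.
have := @expect_product_sample _ _ a0 _ _ D (fun z : Z => prob z.1) G
  measurable_prob (fun z a => ltW (prob_gt0 z.1 a)) (fun z => prob_sum z.1) bG.
move=> ->.
have -> : (fun z : Z => \sum_a prob z.1 a * G a z) =
   (fun z : Z => clipped p z ^+ 2 * (prob z.1 (p z.1))^-1).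
  apply/funext => z; rewrite (bigD1 (p z.1))//= big1 ?addr0 => [|a].
    by rewrite /G /ips_coord eqxx mul1r /clipped; field; rewrite gt_eqF.
  by rewrite /G /ips_coord eq_sym => /negbTE ->; rewrite mul0r expr0n mulr0.
have bi := bounded_rv_inv_prob Pp.
apply: le_expect => //.
  by apply: bounded_rvM => //; apply: bounded_rvM; exact: bounded_rv_clipped.
move=> z; rewrite -[leRHS]mul1r; apply: ler_wpM2r; first by rewrite invr_ge0 ltW ?prob_gt0.
by rewrite expr_le1 ?clipped0 ?clipped1.
Qed.

Lemma ips_value_ge0 p y : 0 <= ips_value m l p y.
Proof. by rewrite ips_valueE mulr_ge0// mulr_ge0 ?clip0// invr_ge0 ltW ?prob_gt0. Qed.

Lemma ips_value_le p y : ips_value m l p y <= (rate m)^-1.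
Proof.
rewrite ips_valueE /ips_coord; case: eqP => _; rewrite ?mul1r ?mul0r; last first.
  by rewrite invr_ge0 ltW.
rewrite -[leRHS]mul1r ler_pM ?clip0 ?clip1 ?invr_ge0 ?(ltW (prob_gt0 _ _))//.
by rewrite lef_pV2 ?posrE ?prob_gt0 ?rate0.
Qed.

(** Bernstein's argument: the centered value is at most [1 / rate m] in absolute value, so this
    range of [s] keeps the exponent below 1/2. *)
Lemma ips_exp_le1 p (s : R) : Pi p -> `|s| <= rate m / 2 ->
  (\int[law]_y (expR (s * (ips_value m l p y - mean_reward p) -
     2 * s ^+ 2 * true_var m l p))%:E <= 1)%E.
Proof.
move=> Pp sm; have e := expect_ips Pp; rewrite -e.
apply: centered_exp_le1; first exact: bounded_rv_ips.
- move=> y; rewrite e; apply: (le_trans (ler_norm _)); rewrite normrM.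
  have r1 : 1 <= (rate m)^-1.
    rewrite invf_ge1//; apply: le_trans (rate_le_inv L0 K_gt0 m) _.
    by rewrite invf_le1// ler1n.
  have h : `|ips_value m l p y - mean_reward p| <= (rate m)^-1.
    have := ips_value_ge0 p y; have := ips_value_le p y.
    have /andP[w0 w1] := mean_reward01 Pp.
    by rewrite ler_norml => v1 v0; apply/andP; split; lra.
  apply: (le_trans (ler_pM _ _ sm h)) => //.
  by rewrite mulrAC divff ?mul1r// gt_eqF.
- apply: ler_wpM2l; first by rewrite mulr_ge0 ?sqr_ge0.
  exact: expect_ips_sqr.
Qed.

Section Regret.
Variable pistar : X -> 'I_K.
Hypothesis Pstar : Pi pistar.

Definition round_regret (y : Z * measurableTypeR R) : R :=
  clipped pistar y.1 - clip (tnth y.1.2 (draw m l y)).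

Definition mean_regret : R := expect law round_regret.

Lemma bounded_rv_regret : bounded_rv round_regret.
Proof.
exact: (bounded_rv_sample a0 (p := fun z : Z => prob z.1)
  (F := fun a z => clipped pistar z - clip (tnth z.2 a)) measurable_prob
  (fun a => bounded_rvB (bounded_rv_clipped Pstar) (bounded_rv_coord a))).
Qed.

Lemma round_regret_norm y : `|round_regret y| <= 1.
Proof.
rewrite /round_regret /clipped.
have := clip0 (tnth y.1.2 (pistar y.1.1)); have := clip1 (tnth y.1.2 (pistar y.1.1)).
have := clip0 (tnth y.1.2 (draw m l y)); have := clip1 (tnth y.1.2 (draw m l y)).
by move=> *; rewrite ler_norml; apply/andP; split; lra.
Qed.

Lemma mean_regret_norm : `|mean_regret| <= 1.
Proof.
have br := bounded_rv_regret.
rewrite ler_norml; apply/andP; split.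
  rewrite -(expect_cst law (-1)); apply: le_expect => //; first exact: bounded_rv_cst.
  by move=> y; have := round_regret_norm y; rewrite ler_norml => /andP[].
rewrite -[leRHS](expect_cst law 1); apply: le_expect => //; first exact: bounded_rv_cst.
by move=> y; have := round_regret_norm y; rewrite ler_norml => /andP[].
Qed.

Lemma regret_exp_le1 (s : R) : 0 <= s -> s <= 1 / 4 ->
  (\int[law]_y (expR (s * (round_regret y - mean_regret) - 2 * s ^+ 2))%:E <= 1)%E.
Proof.
have br := bounded_rv_regret; move=> s0 s4; apply: centered_exp_le1 => //.
- move=> y; have := round_regret_norm y; have := mean_regret_norm.
  rewrite /mean_regret; set e := expect _ _; set v := round_regret y.
  rewrite !ler_norml => /andP[e1 e2] /andP[v1 v2].
  apply: (@le_trans _ _ (s * 2)); last by lra.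
  by rewrite ler_wpM2l//; lra.
- rewrite -[leRHS]mulr1; apply: ler_wpM2l; first by rewrite mulr_ge0 ?sqr_ge0.
  rewrite -[leRHS](expect_cst law); apply: le_expect => //.
  + exact: bounded_rvM.
  + exact: bounded_rv_cst.
  + by move=> y; rewrite -real_normK ?num_real// expr_le1// round_regret_norm.
Qed.

Lemma mean_regretE : mean_regret =
  mean_reward pistar - expect D (fun z => \sum_a prob z.1 a * clip (tnth z.2 a)).
Proof.
have := @expect_product_sample _ _ a0 _ _ D (fun z : Z => prob z.1)
  (fun a z => clipped pistar z - clip (tnth z.2 a))
  measurable_prob (fun z a => ltW (prob_gt0 z.1 a)) (fun z => prob_sum z.1)
  (fun a => bounded_rvB (bounded_rv_clipped Pstar) (bounded_rv_coord a)).
rewrite /mean_regret => ->; rewrite /mean_reward -expectB.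
- congr expect; apply/funext => z.
  rewrite (eq_bigr (fun a => prob z.1 a * clipped pistar z -
    prob z.1 a * clip (tnth z.2 a))) => [|a _]; last by rewrite mulrBr.
  by rewrite sumrB -mulr_suml prob_sum mul1r.
- exact: bounded_rv_clipped.
- apply: bounded_rv_sum => a; apply: bounded_rvM; last exact: bounded_rv_coord.
  apply: (bounded_rv_discrete (f := fun z : Z => prob z.1 a) (g := id) (M := 1)).
    exact: (discrete_act_prob mPi _ _ lP.1 (@measurable_fst _ _ X _)).
  move=> z; rewrite ger0_norm ?(ltW (prob_gt0 _ _))//.
  rewrite -[leRHS](prob_sum z.1) [leRHS](bigD1 a)//= lerDl.
  by apply: sumr_ge0 => b _; exact: ltW.
Qed.

End Regret.
End List.
End Moments.

(** * Sparse mixtures and the transfer to all mixtures *)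

Section Sparse.
Context (R : realType) (K : nat) (d : measure_display) (X : measurableType d).
Context (a0 : 'I_K) (D : probability (X * K.-tuple R)%type R).
Variable Pi : set (X -> 'I_K).
Hypothesis mPi : forall pi, Pi pi -> measurable_policy pi.
Hypothesis K_gt0 : (0 < K)%N.

Local Notation Z := (X * K.-tuple R)%type.
Local Notation law := (D \x uniform_prob (@ltr01 R))%E.

Let K0 : 0 < K%:R :> R. Proof. by rewrite ltr0n. Qed.

(** Obtained from the sampling identity with uniform probabilities and an integrand that ignores the
    action. *)
Lemma expect_fst (g : Z -> R) : bounded_rv g ->
  expect law (fun y => g y.1) = expect D g.
Proof.
move=> bg.
have p1 (z : Z) : \sum_(a < K) K%:R^-1 = 1 :> R.
  by rewrite sumr_const card_ord -[_ *+ K]mulr_natl mulfV// gt_eqF.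
have := @expect_product_sample _ _ a0 _ _ D (fun _ _ => K%:R^-1) (fun _ => g)
  (fun a => @measurable_cst _ _ _ _ _ _) _ p1 (fun _ => bg).
move=> ->; last by move=> *; rewrite invr_ge0.
by congr expect; apply/funext => z; rewrite -mulr_suml p1 // mul1r.
Qed.

Definition sparse_prob (mu : R) (sg : seq (X -> 'I_K)) (x : X) (a : 'I_K) : R :=
  (1 - K%:R * mu) * ((count (fun p => p x == a) sg)%:R / (size sg)%:R) + mu.

Section Rate.
Variable mu : R.
Hypotheses (mu0 : 0 < mu) (Kmu : K%:R * mu <= 1 / 2).

Lemma sparse_prob_ge sg x a : mu <= sparse_prob mu sg x a.
Proof.
rewrite /sparse_prob lerDr mulr_ge0// ?divr_ge0//.
by have := Kmu; lra.
Qed.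

Let sparse_gt0 sg x a : 0 < sparse_prob mu sg x a.
Proof. exact: lt_le_trans (sparse_prob_ge sg x a). Qed.

Definition sparse_inv sg p (z : Z) : R := (sparse_prob mu sg z.1 (p z.1))^-1.

Let sparse_inv0 sg p z : 0 <= sparse_inv sg p z.
Proof. by rewrite invr_ge0 ltW. Qed.

Let sparse_inv_le sg p z : sparse_inv sg p z <= mu^-1.
Proof. by rewrite lef_pV2 ?posrE ?sparse_gt0// sparse_prob_ge. Qed.

Lemma bounded_rv_sparse_inv sg p : all_in Pi sg -> Pi p ->
  bounded_rv (sparse_inv sg p).
Proof.
move=> Psg Pp.
have dp := discrete_policy mPi Pp (@measurable_fst _ _ X (K.-tuple R)).
have dsg := discrete_actions mPi Psg (@measurable_fst _ _ X (K.-tuple R)).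
have ds : discrete_fun (fun z : Z => (p z.1, [seq pi z.1 | pi <- sg])).
  apply: (@discrete_bind _ Z _ _ (fun z => p z.1)
    (fun a z => (a, [seq pi z.1 | pi <- sg]))) => // z.
  exact: (discrete_map (fun s => (p z.1, s)) dsg).
pose g (v : 'I_K * seq 'I_K) : R := ((1 - K%:R * mu) *
  ((count (fun b => b == v.1) v.2)%:R / (size v.2)%:R) + mu)^-1.
have gE z : sparse_inv sg p z = g (p z.1, [seq pi z.1 | pi <- sg]).
  by rewrite /g /= count_map size_map.
rewrite (_ : sparse_inv sg p = (fun z => g (p z.1, [seq pi z.1 | pi <- sg]))).
  apply: (bounded_rv_discrete (g := g) (M := mu^-1) ds) => z.
  by rewrite -gE ger0_norm.
exact/funext.
Qed.

(** Lower tail of a variable with values between 0 and [1/mu]: its second moment is at most its mean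
    over [mu], so at scale [mu / 4] the second-order term takes back only half of the first-order
    one. The remaining half is the source of the factor 2 in [hp_sparse]. *)
Lemma sparse_exp_le1 sg p : all_in Pi sg -> Pi p ->
  (\int[law]_y (expR (- (mu / 4) * sparse_inv sg p y.1 -
     - (mu / 8 * expect D (sparse_inv sg p))))%:E <= 1)%E.
Proof.
move=> Psg Pp; have b := bounded_rv_sparse_inv Psg Pp.
have b1 := bounded_rv_fst (measurableTypeR R) b.
apply: expect_exp_le1; first exact: bounded_rvZ.
  move=> y; apply: (@le_trans _ _ 0); last by rewrite divr_ge0.
  by rewrite mulNr oppr_le0 mulr_ge0// divr_ge0// ltW.
rewrite expectZ// expect_fst//.
have -> : (fun y : Z * measurableTypeR R => (- (mu / 4) * sparse_inv sg p y.1) ^+ 2) =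
   (fun y => (mu ^+ 2 / 16) * (sparse_inv sg p y.1 ^+ 2)).
  by apply/funext => y; field.
have b2 : bounded_rv (fun z => sparse_inv sg p z ^+ 2) by exact: bounded_rvM.
rewrite expectZ; last exact: (bounded_rv_fst (measurableTypeR R) b2).
rewrite (expect_fst b2).
have h : expect D (fun z => sparse_inv sg p z ^+ 2) <=
    mu^-1 * expect D (sparse_inv sg p).
  rewrite -expectZ//; apply: le_expect => //; first exact: bounded_rvZ.
  by move=> z; rewrite expr2 ler_wpM2r.
have : mu ^+ 2 / 8 * expect D (fun z => sparse_inv sg p z ^+ 2) <=
    mu ^+ 2 / 8 * (mu^-1 * expect D (sparse_inv sg p)).
  by rewrite ler_wpM2l// divr_ge0// sqr_ge0.
have -> : mu ^+ 2 / 8 * (mu^-1 * expect D (sparse_inv sg p)) =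
   mu / 8 * expect D (sparse_inv sg p) by field; rewrite gt_eqF.
set E := expect D (sparse_inv sg p); set E2 := expect D _.
by move: E E2 => E E2; lra.
Qed.

Section Exchange.
Variable al : R.
Hypotheses (al0 : 0 <= al) (al1 : al <= 1).

Lemma expect_mixture (l : seq (X -> 'I_K)) (F : (X -> 'I_K) -> Z -> R) :
  all_in Pi l -> (forall p, Pi p -> bounded_rv (F p)) ->
  bounded_rv (fun z => mixture al l (F ^~ z)) /\
  expect D (fun z => mixture al l (F ^~ z)) =
    mixture al l (fun p => expect D (F p)).
Proof.
move=> + bF; elim: l => [_|p l ih] /=.
  by split; [exact: bounded_rv_cst|exact: expect_cst].
move=> [Pp Pl]; have [b e] := ih Pl; have bp := bF p Pp; split.
  by apply: bounded_rvD; apply: bounded_rvZ.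
by rewrite expect_lin// e.
Qed.

Lemma expect_mix_draws (l : seq (X -> 'I_K)) s (F : seq (X -> 'I_K) -> Z -> R) :
  all_in Pi l -> (forall sg, all_in Pi sg -> bounded_rv (F sg)) ->
  bounded_rv (fun z => mix_draws al l s (F ^~ z)) /\
  expect D (fun z => mix_draws al l s (F ^~ z)) =
    mix_draws al l s (fun sg => expect D (F sg)).
Proof.
move=> Pl; elim: s F => [|s ih] F bF /=; first by split => //; exact: bF.
have h p : Pi p -> bounded_rv (fun z => mix_draws al l s (fun sg => F (p :: sg) z)) /\
  expect D (fun z => mix_draws al l s (fun sg => F (p :: sg) z)) =
    mix_draws al l s (fun sg => expect D (F (p :: sg))).
  by move=> Pp; apply: (ih (fun sg => F (p :: sg))) => sg Psg; exact: bF.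
have [b e] := expect_mixture Pl (fun p Pp => (h p Pp).1).
split => //; rewrite e; apply: (eq_mixture al0 al1 Pl) => p Pp.
exact: (h p Pp).2.
Qed.

End Exchange.

Lemma average_mix_draws (al : R) (l : seq (X -> 'I_K)) s
    (F : seq (X -> 'I_K) -> Z -> R) (dat : query R K X) :
  average dat (fun z => mix_draws al l s (F ^~ z)) =
  mix_draws al l s (fun sg => average dat (F sg)).
Proof.
rewrite /average -(mix_draws_sum al dat l s (fun z sg => F sg z)) mulrC -mix_drawsZ.
by congr mix_draws; apply/funext => sg; rewrite mulrC.
Qed.

(* Maurey's argument: an inequality for all sparse mixtures transfers to all
   mixtures, by comparing a mixture with the average of independent draws. *)
Lemma sparse_transfer (l : seq (X -> 'I_K)) (s : nat) (p : X -> 'I_K)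
    (dat : query R K X) (c : R) :
  ~~ nilp l -> all_in Pi l -> Pi p -> 1 <= s%:R * mu -> (0 < size dat)%N ->
  (forall sg, size sg = s -> all_in Pi sg ->
    expect D (sparse_inv sg p) <= 2 * average dat (sparse_inv sg p) + c) ->
  expect D (fun z => (act_prob mu l z.1 (p z.1))^-1) <=
  4 * emp_var mu l p dat + c.
Proof.
move=> l0 Pl Pp smu sd H; pose al := mu / 8; pose kap := 1 - K%:R * mu.
have mu_le : mu <= 1 / 2.
  by apply: le_trans Kmu; rewrite ler_peMl ?ler1n// ltW.
have al0 : 0 <= al by rewrite divr_ge0// ltW.
have al1 : al <= 1 by rewrite /al; lra.
have kap0 : 0 < kap by rewrite /kap; have := Kmu; lra.
have kap1 : kap <= 1 by rewrite /kap gerBl mulr_ge0// ltW.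
have Kmu0 : 0 < K%:R * mu by rewrite mulr_gt0.
have drawE z : mix_draws al l s (fun sg => sparse_inv sg p z) =
    mix_draws al l s (fun sg =>
      (kap * ((count (fun q => q z.1 == p z.1) sg)%:R / s%:R) + mu)^-1).
  by apply: (eq_mix_draws al0 al1 Pl) => sg <- _.
have lower z : (act_prob mu l z.1 (p z.1))^-1 <= mix_draws al l s (fun sg => sparse_inv sg p z).
  rewrite drawE; exact: (mix_draws_inv_ge al0 al1 (fun q => q z.1 == p z.1) l0
    (all_in_true l) kap0 mu0 smu).
have upper z : mix_draws al l s (fun sg => sparse_inv sg p z) <=
    2 * (act_prob mu l z.1 (p z.1))^-1.
  rewrite drawE; exact: (mix_draws_inv_le al0 al1 (fun q => q z.1 == p z.1) l0
    (all_in_true l) kap0 kap1 mu0 smu).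
have [b e] := expect_mix_draws al0 al1 s Pl
  (fun sg Psg => bounded_rv_sparse_inv Psg Pp).
have bi : bounded_rv (fun z : Z => (act_prob mu l z.1 (p z.1))^-1).
  apply: (bounded_rv_discrete (f := fun z : Z => act_prob mu l z.1 (p z.1))
    (g := fun v => v^-1) (M := mu^-1)).
    exact: (discrete_policy_prob mPi mu Pl Pp (@measurable_fst _ _ X _)).
  have pge x a := act_prob_ge K_gt0 mu0 Kmu x a l0.
  have pgt x a := act_prob_gt0 K_gt0 mu0 Kmu x a l0.
  move=> z; rewrite ger0_norm ?invr_ge0 ?(ltW (pgt _ _))//.
  by rewrite lef_pV2 ?posrE ?pgt.
(* The final factor 4 is 2 from the hypothesis on sparse mixtures times 2 from [upper]; [lower] is
   Jensen's inequality and loses no constant. *)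
apply: (@le_trans _ _ (expect D (fun z => mix_draws al l s
    (fun sg => sparse_inv sg p z)))); first exact: le_expect.
rewrite e.
apply: (@le_trans _ _ (mix_draws al l s
    (fun sg => 2 * average dat (sparse_inv sg p) + c * 1))).
  by apply: (le_mix_draws al0 al1 Pl) => sg ssg Psg; rewrite mulr1; exact: H.
rewrite mix_draws_lin mix_draws_cst// mulr1 lerD2r -average_mix_draws.
have -> : 4 * emp_var mu l p dat = 2 * (2 * emp_var mu l p dat) by ring.
rewrite ler_pM2l// /emp_var.
have <- : average dat (fun xr => 2 * (act_prob mu l xr.1 (p xr.1))^-1) =
    2 * average dat (fun xr => (act_prob mu l xr.1 (p xr.1))^-1).
  by rewrite /average -mulr_sumr mulrA.
by apply: le_average.
Qed.

End Rate.
End Sparse.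

(** * Deviation bounds along a run *)

Section Events.
Context (R : realType) (K : nat) (d : measure_display) (X : measurableType d).
Context (a0 : 'I_K) (L : R) (D : probability (X * K.-tuple R)%type R).
Variables (Pi : set (X -> 'I_K)) (orc : query R K X -> X -> 'I_K).
Hypothesis mPi : forall pi, Pi pi -> measurable_policy pi.
Hypotheses (HPi : opt_oracle Pi orc) (morc : measurable_oracle Pi orc).
Hypothesis cPi : countable Pi.
Hypotheses (L0 : 0 < L) (K_gt0 : (0 < K)%N).

Local Notation Z := (X * K.-tuple R)%type.
Local Notation S := (X * K.-tuple R * measurableTypeR R)%type.
Local Notation law := (D \x uniform_prob (@ltr01 R))%E.

Context (d' : measure_display) (Omega : measurableType d').
Variables (P : probability Omega R) (Y : nat -> {RV P >-> S}).
Hypothesis iidY : iid_with_law law Y.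

Local Notation rate := (rate K L).
Local Notation lst w t := (cur_list a0 L orc (fun s => Y s w) t).
Local Notation data w m := (epoch_data a0 L orc (fun s => Y s w) m).

Lemma valid_lst w t : valid_list L Pi (epoch t) (lst w t).
Proof. exact: valid_cur_list. Qed.

Lemma run_chernoff (h : nat -> seq (X -> 'I_K) -> S -> R) (t : nat) (c : R) :
  (forall t l, valid_list L Pi (epoch t) l -> measurable_fun setT (h t l)) ->
  (forall t l, valid_list L Pi (epoch t) l ->
    (\int[law]_y (expR (h t l y))%:E <= 1)%E) ->
  high_prob P [set w | \sum_(s < t) h s (lst w s) (Y s w) <= c] (expR (- c)).
Proof.
move=> mh h1.
have da s : @discrete_fun _ (past Y s) _ (fun w => lst w s).
  apply: (discrete_cur_list mPi HPi morc cPi K_gt0 a0 L0 (T := past Y s)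
    (y := fun w s => Y s w)) => i si.
  exact: past_Y_measurable.
have mh' s w : measurable_fun setT (h s (lst w s)) by apply: mh; exact: valid_lst.
have h1' s w : (\int[law]_y (expR (h s (lst w s) y))%:E <= 1)%E.
  by apply: h1; exact: valid_lst.
apply: high_prob_chernoff; first exact: (adapted_sum_measurable da mh').
exact: (exp_supermartingale iidY da mh' h1').
Qed.

(** Exponents that vanish outside one epoch let a bound for that epoch follow from the
    supermartingale started at round 0. *)
Lemma sum_epoch (m : nat) (f : nat -> R) :
  \sum_(t < 2 ^ m.+1) (if (2 ^ m <= t < 2 ^ m.+1)%N then f t else 0) =
  \sum_(i < 2 ^ m) f (2 ^ m + i)%N.
Proof.
rewrite -(big_mkord xpredT (fun t => if (2 ^ m <= t < 2 ^ m.+1)%N then f t else 0)).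
have le2 : (2 ^ m <= 2 ^ m.+1)%N by rewrite leq_exp2l.
rewrite (big_cat_nat (leq0n _) le2)//= big_nat big1 ?add0r => [|t /andP[_ tm]]; last first.
  by rewrite leqNgt tm.
rewrite -{1}[(2 ^ m)%N]add0n big_addn.
have -> : (2 ^ m.+1 - 2 ^ m)%N = (2 ^ m)%N by rewrite expnS mul2n -addnn addnK.
rewrite big_mkord; apply: eq_bigr => i _.
by rewrite addnC leq_addr/= expnS mul2n -addnn ltn_add2l ltn_ord.
Qed.

Lemma average_epoch_data w m (F : Z -> R) :
  average (data w m) F =
  (\sum_(i < 2 ^ m) F (obs a0 L orc (fun s => Y s w) (2 ^ m + i)%N)) / (2 ^ m)%:R.
Proof.
by rewrite /average size_mkseq big_map -(big_mkord xpredT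
  (fun i => F (obs a0 L orc (fun s => Y s w) (2 ^ m + i)%N))) /index_iota subn0.
Qed.

Section Epoch.
Variable m : nat.
Hypothesis am : active K L m.+1.
Let mu := rate m.+1.
Let n : R := (2 ^ m)%:R.

Let mu0 : 0 < mu. Proof. exact: rate_gt0. Qed.
Let n0 : 0 < n. Proof. by rewrite ltr0n expn_gt0. Qed.
Let K0 : 0 < K%:R :> R. Proof. by rewrite ltr0n. Qed.
Let LE : L = mu ^+ 2 * (K%:R * n).
Proof. by rewrite /n natrX (rate_active_sqr L0 K_gt0 am). Qed.

Let obs_ips w i p : (i < 2 ^ m)%N ->
  tnth (obs a0 L orc (fun s => Y s w) (2 ^ m + i)%N).2
    (p (obs a0 L orc (fun s => Y s w) (2 ^ m + i)%N).1) =
  ips_value a0 L m (lst w (2 ^ m)) p (Y (2 ^ m + i) w).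
Proof.
move=> im; rewrite /obs /ips_value /act /draw /cur_prob cur_list_const//=.
rewrite (@epoch_eq m)//.
by rewrite leq_addr/= expnS mul2n -addnn ltn_add2l.
Qed.

Let reward_one_sided p (s rho : R) : Pi p -> `|s| <= mu / 2 ->
  high_prob P [set w |
    n * (s * (emp_reward (data w m) p - mean_reward D p) -
         2 * s ^+ 2 * true_var L D m (lst w (2 ^ m)) p) <= L * rho]
  (expR (- (L * rho))).
Proof.
move=> Pp sm.
have sm' : `|s| <= rate m / 2.
  (* The data of epoch [m] are drawn with the larger rate of that epoch, while the scale is that of
     the design for epoch [m.+1]. *)
  by apply: (le_trans sm); rewrite ler_pM2r// (rateS_le L0 K_gt0).
pose h t l y := if (2 ^ m <= t < 2 ^ m.+1)%N then
  s * (ips_value a0 L m l p y - mean_reward D p) - 2 * s ^+ 2 * true_var L D m l p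
  else 0.
apply: high_prob_sub (@run_chernoff h (2 ^ m.+1) (L * rho) _ _).
- move=> w /=; rewrite /h.
  rewrite (sum_epoch m (fun t =>
    s * (ips_value a0 L m (lst w t) p (Y t w) - mean_reward D p) -
    2 * s ^+ 2 * true_var L D m (lst w t) p)).
  rewrite (eq_bigr (fun i : 'I_(2 ^ m) =>
    s * (ips_value a0 L m (lst w (2 ^ m)) p (Y (2 ^ m + i) w) - mean_reward D p) -
    2 * s ^+ 2 * true_var L D m (lst w (2 ^ m)) p)); last first.
    by move=> i _; rewrite cur_list_const.
  rewrite sumrB -mulr_sumr sumrB !sumr_const card_ord.
  rewrite -[mean_reward D p *+ _]mulr_natr -[(2 * _ * _) *+ _]mulr_natr.
  apply: le_trans; rewrite le_eqVlt; apply/orP; left; apply/eqP.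
  rewrite /emp_reward average_epoch_data.
  rewrite (eq_bigr (fun i : 'I_(2 ^ m) =>
    ips_value a0 L m (lst w (2 ^ m)) p (Y (2 ^ m + i) w))).
    by rewrite -/n; field; rewrite gt_eqF.
  by move=> i _; rewrite obs_ips.
- move=> t l lP; rewrite /h; case tm : (2 ^ m <= t < 2 ^ m.+1)%N; last exact: measurable_cst.
  rewrite (epoch_eq tm) in lP.
  apply: measurable_funB; last exact: measurable_cst.
  apply: measurable_funM; first exact: measurable_cst.
  apply: measurable_funB; last exact: measurable_cst.
  exact: (bounded_rv_ips _ mPi L0 K_gt0 lP Pp).1.
- move=> t l lP; rewrite /h; case tm : (2 ^ m <= t < 2 ^ m.+1)%N.
    rewrite (epoch_eq tm) in lP.
    exact: (ips_exp_le1 a0 D mPi L0 K_gt0 lP Pp sm').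
  under eq_integral do rewrite expR0.
  by rewrite integral_cst// mul1e probability_le1.
Qed.

(** Take [s = mu / 2] and [s = - (mu / 2)], then divide by [n * mu / 2]: the calibration [LE] turns
    the deviation term [2 * L * rho / (n * mu)] into [2 * K * mu * rho]. *)
Lemma hp_reward p (rho : R) : Pi p ->
  high_prob P [set w |
    `|emp_reward (data w m) p - mean_reward D p| <=
    mu * true_var L D m (lst w (2 ^ m)) p + 2 * (K%:R * mu * rho)]
  (2 * expR (- (L * rho))).
Proof.
move=> Pp.
have mu20 : 0 <= mu / 2 by rewrite divr_ge0// ltW.
have h1 := @reward_one_sided p (mu / 2) rho Pp _.
have h2 := @reward_one_sided p (- (mu / 2)) rho Pp _.
have -> : 2 * expR (- (L * rho)) = expR (- (L * rho)) + expR (- (L * rho)) by ring.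
apply: high_prob_sub (high_probI (h1 _) (h2 _)).
- move=> w []/=; set v := emp_reward _ _ - _; set V := true_var _ _ _ _ _.
  have c0 : 0 < n * mu / 2 by rewrite divr_gt0// mulr_gt0.
  rewrite ler_norml {1 2}LE => e1 e2; apply/andP; split.
    rewrite -(ler_pM2l c0).
    have -> : n * mu / 2 * - (mu * V + 2 * (K%:R * mu * rho)) =
      - (n * mu ^+ 2 / 2 * V) - mu ^+ 2 * (K%:R * n) * rho by field.
    move: e2; have -> : n * (- (mu / 2) * v - 2 * (- (mu / 2)) ^+ 2 * V) =
      - (n * mu / 2 * v) - n * mu ^+ 2 / 2 * V by field.
    lra.
  rewrite -(ler_pM2l c0).
  have -> : n * mu / 2 * (mu * V + 2 * (K%:R * mu * rho)) =
    n * mu ^+ 2 / 2 * V + mu ^+ 2 * (K%:R * n) * rho by field.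
  move: e1; have -> : n * ((mu / 2) * v - 2 * (mu / 2) ^+ 2 * V) =
    n * mu / 2 * v - n * mu ^+ 2 / 2 * V by field.
  lra.
- by rewrite ger0_norm.
- by rewrite normrN ger0_norm.
Qed.

(** The level carries a factor [2 / mu] to survive the union bound over all lists of about [1/mu]
    policies. By [LE], dividing by [n * mu / 8] makes its cost only [16 * K * rho]. *)
Lemma hp_sparse (sg : seq (X -> 'I_K)) p (rho : R) : all_in Pi sg -> Pi p ->
  high_prob P [set w |
    expect D (sparse_inv mu sg p) <=
    2 * average (data w m) (sparse_inv mu sg p) + 16 * K%:R * rho]
  (expR (- (2 / mu * (L * rho)))).
Proof.
move=> Psg Pp; set V := expect D _.
have Kmu := rate_active L0 K_gt0 am.
pose h t (l : seq (X -> 'I_K)) (y : S) := if (2 ^ m <= t < 2 ^ m.+1)%N then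
  - (mu / 4) * sparse_inv mu sg p y.1 - - (mu / 8 * V) else 0.
apply: high_prob_sub (@run_chernoff h (2 ^ m.+1) (2 / mu * (L * rho)) _ _).
- move=> w /=; rewrite /h.
  rewrite (sum_epoch m (fun t => - (mu / 4) * sparse_inv mu sg p (Y t w).1 - - (mu / 8 * V))).
  rewrite sumrB -mulr_sumr sumr_const card_ord.
  rewrite -[(- (mu / 8 * V)) *+ _]mulr_natr average_epoch_data -/n.
  rewrite (eq_bigr (fun i : 'I_(2 ^ m) => sparse_inv mu sg p (Y (2 ^ m + i) w).1)); last first.
    by move=> i _; rewrite /sparse_inv.
  set s := \sum_(_ < _) _; rewrite LE => e.
  have c0 : 0 < n * mu / 8 by rewrite divr_gt0// mulr_gt0.
  rewrite -(ler_pM2l c0).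
  have -> : n * mu / 8 * (2 * (s / n) + 16 * K%:R * rho) =
    mu / 4 * s + 2 / mu * (mu ^+ 2 * (K%:R * n) * rho).
    by field; rewrite !gt_eqF.
  by lra.
- move=> t l _; rewrite /h; case: (2 ^ m <= t < 2 ^ m.+1)%N; last exact: measurable_cst.
  apply: measurable_funB; last exact: measurable_cst.
  apply: measurable_funM; first exact: measurable_cst.
  exact: (bounded_rv_fst _ (bounded_rv_sparse_inv mPi mu0 Kmu Psg Pp)).1.
- move=> t l _; rewrite /h; case: (2 ^ m <= t < 2 ^ m.+1)%N.
    exact: (sparse_exp_le1 a0 D mPi K_gt0 mu0 Kmu Psg Pp).
  under eq_integral do rewrite expR0.
  by rewrite integral_cst// mul1e probability_le1.
Qed.

End Epoch.

Lemma hp_regret (pistar : X -> 'I_K) (T : nat) (s c : R) : Pi pistar ->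
  0 <= s -> s <= 1 / 4 ->
  high_prob P [set w |
    s * (\sum_(t < T) (round_regret a0 L (epoch t) (lst w t) pistar (Y t w) -
                       mean_regret a0 L D (epoch t) (lst w t) pistar)) <=
    2 * s ^+ 2 * T%:R + c] (expR (- c)).
Proof.
move=> Pstar s0 s1.
pose h t l y := s * (round_regret a0 L (epoch t) l pistar y -
   mean_regret a0 L D (epoch t) l pistar) - 2 * s ^+ 2.
apply: high_prob_sub (@run_chernoff h T c _ _).
- move=> w /=; rewrite /h sumrB -mulr_sumr sumr_const card_ord.
  by rewrite -[(2 * s ^+ 2) *+ _]mulr_natr; lra.
- move=> t l lP; apply: measurable_funB; last exact: measurable_cst.
  apply: measurable_funM; first exact: measurable_cst.
  apply: measurable_funB; last exact: measurable_cst.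
  have [mr _] := bounded_rv_regret a0 mPi lP Pstar; exact: mr.
- by move=> t l lP; exact: (regret_exp_le1 a0 D mPi lP Pstar s0 s1).
Qed.

End Events.

(** * Regret of the mixtures *)

Section Deterministic.
Context (R : realType) (K : nat) (d : measure_display) (X : measurableType d).
Context (a0 : 'I_K) (L : R) (D : probability (X * K.-tuple R)%type R).
Variables (Pi : set (X -> 'I_K)) (orc : query R K X -> X -> 'I_K).
Hypothesis mPi : forall pi, Pi pi -> measurable_policy pi.
Hypothesis HPi : opt_oracle Pi orc.
Hypotheses (L0 : 0 < L) (K_gt0 : (0 < K)%N).
Variable pistar : X -> 'I_K.
Hypothesis Pstar : Pi pistar.
Hypothesis star_max : forall p, Pi p -> mean_reward D p <= mean_reward D pistar.

Local Notation Z := (X * K.-tuple R)%type.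
Local Notation rate := (rate K L).
Local Notation mean_reward := (mean_reward D).

Variable y : nat -> X * K.-tuple R * R.
Local Notation lst t := (cur_list a0 L orc y t).
Local Notation data m := (epoch_data a0 L orc y m).

Variables (M : nat) (s : nat -> nat).
Definition slack (m : nat) : R := (M - m + 5)%:R.

Hypothesis s_large : forall m, active K L m.+1 -> 1 <= (s m)%:R * rate m.+1.

Hypothesis reward_est : forall m p, (m < M)%N -> active K L m.+1 -> Pi p ->
  `|emp_reward (data m) p - mean_reward p| <=
  rate m.+1 * true_var L D m (lst (2 ^ m)) p + 2 * (K%:R * rate m.+1 * slack m).

Hypothesis sparse_est : forall m sg p, (m < M)%N -> active K L m.+1 ->
  size sg = s m -> all_in Pi sg -> Pi p ->
  expect D (sparse_inv (rate m.+1) sg p) <=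
  2 * average (data m) (sparse_inv (rate m.+1) sg p) + 16 * K%:R * slack m.

Let K0 : 0 < K%:R :> R. Proof. by rewrite ltr0n. Qed.
Let K1 : 1 <= K%:R :> R. Proof. by rewrite ler1n. Qed.
Let rate0 m : 0 < rate m. Proof. exact: rate_gt0. Qed.

Definition mean_gap p : R := mean_reward pistar - mean_reward p.

Let gap0 p : Pi p -> 0 <= mean_gap p.
Proof. by move=> Pp; rewrite subr_ge0; exact: star_max. Qed.

Lemma slack_ge5 m : 5 <= slack m.
Proof. by rewrite ler_nat leq_addl. Qed.

Lemma slackS m : (m < M)%N -> slack m = slack m.+1 + 1.
Proof. by move=> mM; rewrite /slack natr1 -addSn subnSK. Qed.

Lemma true_var_inactive m l p : ~~ active K L m -> true_var L D m l p = K%:R.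
Proof.
move=> am; rewrite /true_var -[RHS](expect_cst D); congr expect.
apply/funext => z; rewrite (act_prob_inactive K_gt0)//.
by rewrite rate_inactive// invrK.
Qed.

Section Step.
Variable m : nat.
Hypotheses (mM : (m < M)%N) (am : active K L m.+1).
Hypothesis var_m : forall p, Pi p ->
  true_var L D m (lst (2 ^ m)) p <= 330 * K%:R * slack m + mean_gap p / (4 * rate m).

Let mu := rate m.+1.
Let l := lst (2 ^ m.+1).
Let al := mu / 8.
Let E := emp_reward (data m).
(** 330 comes from the variance bound [var_m] and 2 from the deviation term of [reward_est]. *)
Let Dm := 332 * (K%:R * mu * slack m).

Let mu0 : 0 < mu. Proof. exact: rate0. Qed.
Let Kmu : K%:R * mu <= 1 / 2. Proof. exact: rate_active. Qed.
Let mu_le : mu <= 1 / 2.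
Proof. by apply: le_trans Kmu; rewrite ler_peMl// ltW. Qed.
Let al0 : 0 <= al. Proof. by rewrite divr_ge0// ltW. Qed.
Let al1 : al <= 1. Proof. by rewrite /al; have := mu_le; lra. Qed.
Let Dm0 : 0 <= Dm.
Proof. by rewrite !mulr_ge0// ltW. Qed.

(** Since rates do not increase, [mu] times the regret term of [var_m] is at most a quarter of the
    regret. This relative error below 1 permits comparing true and estimated regrets in both
    directions, with the constants 5/4 and 4/3. *)
Lemma emp_reward_est p : Pi p -> `|E p - mean_reward p| <= mean_gap p / 4 + Dm.
Proof.
move=> Pp; apply: (le_trans (reward_est mM am Pp)).
have g0 := gap0 Pp.
have h : mu * true_var L D m (lst (2 ^ m)) p <=
    mu * (330 * K%:R * slack m + mean_gap p / (4 * rate m)).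
  by rewrite ler_pM2l// var_m.
have h2 : mu * (mean_gap p / (4 * rate m)) <= mean_gap p / 4.
  have -> : mu * (mean_gap p / (4 * rate m)) = mean_gap p / 4 * (mu / rate m).
    by field; rewrite gt_eqF// rate0.
  rewrite ler_piMr ?divr_ge0// ler_pdivrMr// mul1r.
  exact: (rateS_le L0 K_gt0).
rewrite -/mu; apply: (le_trans (lerD h (lexx _))); rewrite mulrDr /Dm.
move: h2; set u := mu * (mean_gap p / _); set v := mean_gap p / 4.
set k := slack m; clearbody u v k.
have -> : mu * (330 * K%:R * k) = 330 * (K%:R * mu * k) by ring.
set q := K%:R * mu * k; clearbody q; lra.
Qed.

Let spec := epoch_design_spec a0 HPi L0 K_gt0 y am.

Let l0 : ~~ nilp l. Proof. by case: spec. Qed.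
Let lPi : all_in Pi l. Proof. by case: spec. Qed.

Lemma emp_gap_le lead p : Pi lead -> Pi p ->
  E lead - E p <= 5 / 4 * mean_gap p + 2 * Dm.
Proof.
move=> Pl Pp; have := emp_reward_est Pl; have := emp_reward_est Pp.
have := gap0 Pl; rewrite !ler_norml /mean_gap => g0 /andP[e1 e2] /andP[e3 e4]; lra.
Qed.

Lemma mean_gap_le lead p : Pi p ->
  (forall p, Pi p -> E p <= E lead) ->
  mean_gap p <= 4 / 3 * (E lead - E p + 2 * Dm).
Proof.
move=> Pp leadP; have := emp_reward_est Pstar; have := emp_reward_est Pp.
have := leadP _ Pstar; rewrite !ler_norml /mean_gap subrr mul0r.
by move=> g0 /andP[e1 e2] /andP[e3 e4]; lra.
Qed.

(** The regret term reproduces itself: [4 * (5/4) / 20 = 1/4]. The multiple of [K * slack]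
    contracts: 332 returns as [4 * 332 / 10], and after adding 16 and the terms of order [K],
    absorbed by [5 <= slack], the result stays below 330. *)
Lemma true_var_step p : Pi p ->
  true_var L D m.+1 l p <= 330 * K%:R * slack m.+1 + mean_gap p / (4 * mu).
Proof.
move=> Pp; have [_ _ [lead Plead leadP] gapP] := spec.
have sd : (0 < size (data m))%N by rewrite size_mkseq expn_gt0.
have tv : true_var L D m.+1 l p <= 4 * emp_var mu l p (data m) + 16 * K%:R * slack m.
  apply: (sparse_transfer mPi K_gt0 mu0 Kmu l0 lPi Pp (s_large am) sd) => sg ssg Psg.
  exact: sparse_est.
apply: (le_trans tv); have := gapP p Pp; rewrite /gap -/mu -/al -/l -/E.
set V := emp_var _ _ _ _; set Q := mixture _ _ _ => g.
have QE : Q <= E lead.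
  rewrite -[leRHS](mixture_cst al _ l0); exact: (le_mixture al0 al1 lPi).
have V_le : V <= 8 * K%:R + (E lead - E p) / (20 * mu).
  have c0 : 0 < (4 * K%:R)^-1 :> R by rewrite invr_gt0 mulr_gt0.
  have r0 : 0 < reward_weight K mu by rewrite invr_gt0 !mulr_gt0.
  rewrite -(ler_pM2l c0).
  have -> : (4 * K%:R)^-1 * (8 * K%:R + (E lead - E p) / (20 * mu)) =
     2 + reward_weight K mu * (E lead - E p).
    by rewrite /reward_weight; field; rewrite !gt_eqF.
  have : 0 <= reward_weight K mu * (E lead - Q) by rewrite mulr_ge0 ?subr_ge0// ltW.
  set r := reward_weight K mu in g *; clearbody r.
  by lra.
have e := emp_gap_le Plead Pp.
have e' : (E lead - E p) / (20 * mu) <= (5 / 4 * mean_gap p + 2 * Dm) / (20 * mu).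
  by rewrite ler_pM2r// invr_gt0 mulr_gt0.
have -> : 330 * K%:R * slack m.+1 + mean_gap p / (4 * mu) =
   330 * (K%:R * slack m.+1) + 4 * ((5 / 4 * mean_gap p) / (20 * mu)) by field; rewrite gt_eqF.
have e3 : (5 / 4 * mean_gap p + 2 * Dm) / (20 * mu) =
   (5 / 4 * mean_gap p) / (20 * mu) + 332 / 10 * (K%:R * slack m).
  by rewrite /Dm; field; rewrite gt_eqF.
rewrite e3 in e'.
have s5 : K%:R * 5 <= K%:R * slack m.+1 by rewrite ler_pM2l// slack_ge5.
have -> : 16 * K%:R * slack m = 16 * (K%:R * slack m) by ring.
have kS : K%:R * slack m = K%:R * slack m.+1 + K%:R by rewrite (slackS mM); ring.
move: e' V_le; rewrite kS; move: s5; set u := K%:R * slack m.+1; set v := _ / (20 * mu).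
set v' := _ / (20 * mu); clearbody u v v' V; have := K0; lra.
Qed.

(** Apply [gap <= 2] to the empirical leader and drop the nonnegative variance: the estimated regret
    of the mixture is at most [160 * K * mu]. Then [928 = 4/3 * (160 / 5 + 2 * 332)]. *)
Lemma mixture_gap_le : mixture al l mean_gap <= 928 * (K%:R * mu * slack m).
Proof.
have [_ _ [lead Plead leadP] gapP] := spec.
have := gapP lead Plead; rewrite /gap -/mu -/al -/l -/E.
set V := emp_var _ _ _ _; set Q := mixture _ _ E => g.
have V0 : 0 <= (4 * K%:R)^-1 * V.
  apply: mulr_ge0; first by rewrite invr_ge0 ltW// mulr_gt0.
  apply: mulr_ge0; last by rewrite invr_ge0.
  by apply: sumr_ge0 => z _; rewrite invr_ge0 ltW// (act_prob_gt0 K_gt0 mu0 Kmu).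
have gQ : E lead - Q <= 160 * (K%:R * mu).
  have r0 : 0 < reward_weight K mu by rewrite invr_gt0 !mulr_gt0.
  rewrite -(ler_pM2l r0).
  have -> : reward_weight K mu * (160 * (K%:R * mu)) = 2.
    by rewrite /reward_weight; field; rewrite !gt_eqF.
  by apply: le_trans g; rewrite lerDr.
have h1 : mixture al l mean_gap <=
    mixture al l (fun p => - (4 / 3) * E p + (4 / 3) * (E lead + 2 * Dm)).
  apply: (le_mixture al0 al1 lPi) => p Pp.
  by apply: (le_trans (mean_gap_le Pp leadP)); lra.
apply: (le_trans h1); rewrite mixture_lin mixture_cst// -/Q.
have s5 : K%:R * mu * 5 <= K%:R * mu * slack m by rewrite ler_pM2l ?mulr_gt0// slack_ge5.
rewrite /Dm; move: s5 gQ; set u := K%:R * mu * slack m; set v := K%:R * mu.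
by clearbody u v Q; lra.
Qed.

(** Smoothing takes the weight [K * mu] away from the mixture, which costs at most that much reward
    and accounts for the step from 928 to 929. *)
Lemma mean_regret_active : mean_regret a0 L D m.+1 l pistar <=
  929 * (K%:R * mu * slack m).
Proof.
have lP : valid_list L Pi m.+1 l.
  have := valid_cur_list a0 HPi L0 K_gt0 y (2 ^ m.+1); rewrite epoch_pow; exact.
rewrite (mean_regretE a0 D mPi L0 K_gt0 lP Pstar).
have [bm em] := expect_mixture D al (F := fun p => @clipped R K d X p) lPi
  (fun p Pp => bounded_rv_clipped R mPi Pp).
have low : (1 - K%:R * mu) * mixture al l mean_reward <=
    expect D (fun z => \sum_a act_prob mu l z.1 a * clip (tnth z.2 a)).
  rewrite -em -expectZ//; apply: le_expect; first exact: bounded_rvZ.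
    apply: bounded_rv_sum => a; apply: bounded_rvM; last exact: bounded_rv_coord.
    apply: (bounded_rv_discrete (f := fun z : Z => act_prob mu l z.1 a) (g := id) (M := 1)).
      exact: (discrete_act_prob mPi _ _ lPi (@measurable_fst _ _ X _)).
    move=> z; rewrite ger0_norm ?(act_prob_le1 K_gt0 mu0 Kmu)//.
    by rewrite ltW// (act_prob_gt0 K_gt0 mu0 Kmu).
  move=> z; rewrite -mixtureZ.
  apply: (@le_trans _ _ (\sum_a ((1 - K%:R * mu) *
     mixture al l (fun p => (p z.1 == a)%:R)) * clip (tnth z.2 a))).
    under eq_bigr do rewrite mulrC mulrCA -mixtureZ.
    rewrite -mulr_sumr -mixture_sum mixtureZ ler_wpM2l//; first by have := Kmu; lra.
    rewrite le_eqVlt; apply/orP; left; apply/eqP; apply: (eq_mixture al0 al1 lPi) => p _.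
    rewrite (bigD1 (p z.1))//= eqxx mulr1 big1 ?addr0// => a.
    by rewrite eq_sym => /negbTE ->; rewrite mulr0.
  apply: ler_sum => a _; rewrite ler_wpM2r//; first by case/andP: (clip01 (tnth z.2 a)).
  by rewrite /act_prob lerDl ltW.
have mw1 : mixture al l mean_reward <= 1.
  rewrite -[leRHS](mixture_cst al 1 l0); apply: (le_mixture al0 al1 lPi) => p Pp.
  by case/andP: (mean_reward01 D mPi Pp).
have mg : mixture al l mean_gap = mean_reward pistar - mixture al l mean_reward.
  rewrite -[X in X - _](mixture_cst al _ l0) -[X in _ - X]mul1r -mulNr.
  rewrite -[X in X + _]mul1r -mixture_lin.
  by apply: (eq_mixture al0 al1 lPi) => p _; rewrite /mean_gap mul1r mulN1r.
have := mixture_gap_le; rewrite mg => h.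
have Kmu0 : 0 <= K%:R * mu by rewrite mulr_ge0// ltW.
have kmw : K%:R * mu * mixture al l mean_reward <= K%:R * mu by rewrite ler_piMr.
have s5 : K%:R * mu * 5 <= K%:R * mu * slack m by rewrite ler_wpM2l// slack_ge5.
move: low; rewrite -/mu; set e := expect _ _; set w := mixture _ _ mean_reward in h mw1 kmw *.
move: h kmw s5 Kmu0; set u := K%:R * mu * slack m; set v := K%:R * mu.
by clearbody u v e w; lra.
Qed.

End Step.

Lemma true_var_bound m : (m <= M)%N -> forall p, Pi p ->
  true_var L D m (lst (2 ^ m)) p <= 330 * K%:R * slack m + mean_gap p / (4 * rate m).
Proof.
elim: m => [|m ih] mM p Pp.
  rewrite true_var_inactive//.
  have : 0 <= mean_gap p / (4 * rate 0) by rewrite divr_ge0 ?gap0// mulr_ge0// ltW.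
  have := slack_ge5 0; have := K1; nra.
case am : (active K L m.+1); last first.
  rewrite true_var_inactive ?am//.
  have : 0 <= mean_gap p / (4 * rate m.+1) by rewrite divr_ge0 ?gap0// mulr_ge0// ltW.
  have := slack_ge5 m.+1; have := K1; nra.
by apply: true_var_step => // p' Pp'; apply: ih => //; exact: ltnW.
Qed.

Lemma mean_regret_epoch m t : (m < M)%N -> epoch t = m.+1 ->
  mean_regret a0 L D (epoch t) (lst t) pistar <=
  929 * (Num.sqrt (K%:R * L / 2 ^+ m) * slack m).
Proof.
move=> mM et; have t0 : (0 < t)%N by case: t et.
have p0 : 0 < 2 ^+ m :> R by rewrite exprn_gt0.
have tE : lst t = lst (2 ^ m.+1).
  have /andP[b1 b2] := epoch_bounds t0; rewrite et in b1 b2.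
  rewrite -(subnKC b1) cur_list_const// ltn_subLR//.
  by rewrite addnn -mul2n -expnS.
rewrite et tE; case am : (active K L m.+1).
  have -> : Num.sqrt (K%:R * L / 2 ^+ m) = K%:R * rate m.+1.
    apply/eqP; rewrite -(@eqrXn2 _ 2)// ?sqrtr_ge0 ?mulr_ge0 ?ltW//.
    rewrite sqr_sqrtr; last by rewrite divr_ge0 ?mulr_ge0 ?ltW.
    move: (rate_active_sqr L0 K_gt0 am); set r := rate m.+1; clearbody r => e.
    rewrite exprMn -e; apply/eqP; field.
    by rewrite gt_eqF.
  apply: mean_regret_active => // p Pp; apply: true_var_bound => //; exact: ltnW.
have lP : valid_list L Pi m.+1 (lst (2 ^ m.+1)).
  by have := valid_cur_list a0 HPi L0 K_gt0 y (2 ^ m.+1); rewrite epoch_pow.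
(* An inactive epoch is so short that the trivial bound 1 on the regret of a round suffices:
   [2 ^+ m < 4 * K * L] makes the square root at least 1/2. *)
apply: (@le_trans _ _ 1).
  apply: le_trans (ler_norm _) _; exact: (mean_regret_norm a0 D mPi lP Pstar).
have sq : 1 / 2 <= Num.sqrt (K%:R * L / 2 ^+ m).
  rewrite -(@ler_pXn2r _ 2)// ?nnegrE ?sqrtr_ge0 ?divr_ge0//.
  rewrite sqr_sqrtr; last by rewrite divr_ge0 ?mulr_ge0 ?ltW.
  rewrite ler_pdivlMr//; move/negbT: am => /=; rewrite -ltNge => h.
  by lra.
have := slack_ge5 m; nra.
Qed.

End Deterministic.

(** * Summation over the epochs *)

Section Sums.
Context (R : realType).

Let sqrt2_ge : 7 / 5 <= Num.sqrt 2 :> R.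
Proof.
rewrite -(@ler_pXn2r _ 2)// ?nnegrE ?sqrtr_ge0 ?divr_ge0// sqr_sqrtr//.
by rewrite expr_div_n -!natrX ler_pdivrMr// -natrM ler_nat.
Qed.

Let sqrt_powS (M : nat) : Num.sqrt (2 ^+ M.+1) = Num.sqrt 2 * Num.sqrt (2 ^+ M) :> R.
Proof. by rewrite exprS sqrtrM. Qed.

(** The linear weights do not spoil the geometric growth. The coefficients solve the recursion
    exactly when the square root of 2 is replaced by 7/5: [5/2 * (c + 1) + 35/4 + (c + 1) = 7/5 *
    (5/2 * c + 35/4)]. *)
Lemma sum_sqrt_pow_weighted (M c : nat) :
  \sum_(m < M) Num.sqrt (2 ^+ m) * (M - m + c)%:R <=
  Num.sqrt (2 ^+ M) * (5 / 2 * c%:R + 35 / 4) :> R.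
Proof.
elim: M c => [|M ih] c.
  by rewrite big_ord0 mulr_ge0 ?sqrtr_ge0// addr_ge0 ?mulr_ge0 ?divr_ge0.
rewrite big_ord_recr/= subSnn.
rewrite (eq_bigr (fun m : 'I_M => Num.sqrt (2 ^+ m) * (M - m + c.+1)%:R :> R)); last first.
  move=> m _; congr (_ * _%:R).
  by rewrite subSn; [rewrite addSnnS | exact: ltnW].
apply: (le_trans (lerD (ih c.+1) (lexx _))).
have s0 := sqrtr_ge0 (2 ^+ M : R).
rewrite sqrt_powS -mulrDr [Num.sqrt 2 * _]mulrC -[leRHS]mulrA ler_wpM2l//.
have c0 : 0 <= c%:R :> R by [].
rewrite natrD -natr1.
have h : 7 / 5 * (5 / 2 * c%:R + 35 / 4) <= Num.sqrt 2 * (5 / 2 * c%:R + 35 / 4) :> R.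
  by rewrite ler_wpM2r// addr_ge0 ?mulr_ge0 ?divr_ge0.
by lra.
Qed.

Lemma sum_sqrt_pow (M : nat) :
  \sum_(m < M) Num.sqrt (2 ^+ m) <= 5 / 2 * Num.sqrt (2 ^+ M) :> R.
Proof.
elim: M => [|M ih]; first by rewrite big_ord0 mulr_ge0 ?sqrtr_ge0 ?divr_ge0.
rewrite big_ord_recr/= sqrt_powS.
have s0 := sqrtr_ge0 (2 ^+ M : R).
have := ler_wpM2r s0 sqrt2_ge; lra.
Qed.

Lemma sum_blocks (g : nat -> R) (M : nat) :
  \sum_(t < 2 ^ M.+1) g t =
  g 0%N + g 1%N + \sum_(m < M) \sum_(i < 2 ^ m.+1) g (2 ^ m.+1 + i)%N.
Proof.
elim: M => [|M ih]; first by rewrite big_ord0 addr0 expn1 !big_ord_recr big_ord0 /= add0r.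
rewrite [in RHS]big_ord_recr/= addrA -ih.
rewrite -(big_mkord xpredT g) -(big_mkord xpredT (fun i => g (2 ^ M.+1 + i)%N)).
have le2 : (2 ^ M.+1 <= 2 ^ M.+2)%N by rewrite leq_exp2l.
rewrite (big_cat_nat (leq0n _) le2)//= big_mkord; congr (_ + _).
rewrite -{1}[(2 ^ M.+1)%N]add0n big_addn.
have -> : (2 ^ M.+2 - 2 ^ M.+1)%N = (2 ^ M.+1)%N.
  by rewrite [in X in (X - _)%N]expnS mul2n -addnn addnK.
by apply: eq_bigr => i _; rewrite addnC.
Qed.

Lemma epoch_block m i : (i < 2 ^ m)%N -> epoch (2 ^ m + i) = m.
Proof.
by move=> im; apply: epoch_eq; rewrite leq_addr/= expnS mul2n -addnn ltn_add2l.
Qed.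

(** Rounds 0 and 1 form epoch 0 and are bounded by [c] each; the last block may be cut by [T], hence
    the truncated sums. *)
Lemma sum_blocks_le (g : nat -> R) (b : nat -> R) (T M : nat) (c : R) :
  (T <= 2 ^ M.+1)%N -> 0 <= c -> (forall m, 0 <= b m) ->
  (forall t, (t < 2)%N -> g t <= c) ->
  (forall m, (m < M)%N ->
    \sum_(i < 2 ^ m.+1) (if (2 ^ m.+1 + i < T)%N then g (2 ^ m.+1 + i)%N else 0) <= b m) ->
  \sum_(t < T) g t <= 2 * c + \sum_(m < M) b m.
Proof.
move=> TM c0 b0 gc gb.
have -> : \sum_(t < T) g t = \sum_(t < 2 ^ M.+1) (if (t < T)%N then g t else 0).
  by rewrite -big_mkcond (big_ord_widen _ g TM).
rewrite (sum_blocks (fun t => if (t < T)%N then g t else 0)); apply: lerD.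
  have h t : (t < 2)%N -> (if (t < T)%N then g t else 0) <= c.
    by move=> t2; case: ifP => // _; exact: gc.
  by have := h 0%N isT; have := h 1%N isT; lra.
by apply: ler_sum => m _; exact: gb.
Qed.

End Sums.

Section Logs.
Context (R : realType).

Lemma ln_ge_half (x : R) : 2 <= x -> 1 / 2 <= ln x.
Proof.
move=> x2; have x0 : 0 < x by lra.
have := @le_ln1Dx R (x^-1 - 1).
rewrite [1 + _]addrC subrK lnV ?posrE// => h.
have i2 : x^-1 <= 1 / 2 by rewrite div1r lef_pV2 ?posrE.
have i0 : 0 < x^-1 by rewrite invr_gt0.
have : -1 < x^-1 - 1 by lra.
by move/h; lra.
Qed.

End Logs.

(** * Number of oracle calls *)

Section Calls.
Context (R : realType) (K : nat) (X : Type) (a0 : 'I_K) (L : R).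
Variables (Pi : set (X -> 'I_K)) (orc : query R K X -> X -> 'I_K).
Hypotheses (HPi : opt_oracle Pi orc) (L_ge : 1 / 2 <= L) (K_gt0 : (0 < K)%N).

Let L0 : 0 < L. Proof. by have := L_ge; lra. Qed.
Let K0 : 0 < K%:R :> R. Proof. by rewrite ltr0n. Qed.

(** With [a] and [b] the two logarithms, both at least 1/2, one has [ln v <= a + b <= 4 * (a * b)].
    The fuel contributes [16 * 4 = 64]; the two extra calls are at most [v <= 4 * (a * b) * v],
    which makes 68. *)
Lemma design_fuel_le (m T : nat) : active K L m.+1 -> (2 ^ m.+1 < T)%N ->
  (design_fuel (rate K L m.+1)).+1%:R <=
  68 * (ln (T%:R + 2) * ln (K%:R + 2)) * (Num.sqrt (K%:R / L) * Num.sqrt (2 ^+ m)) :> R.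
Proof.
move=> am mT; set mu := rate K L m.+1.
have mu0 : 0 < mu by exact: rate_gt0.
have mu2 : mu <= 1 / 2.
  by apply: le_trans (rate_active L0 K_gt0 am); rewrite ler_peMl ?ler1n// ltW.
have p0 : 0 < 2 ^+ m :> R by rewrite exprn_gt0.
pose v := mu^-1; have v0 : 0 < v by rewrite invr_gt0.
have v2 : 2 <= v by rewrite -[2]invrK lef_pV2 ?posrE ?invr_gt0// -div1r.
have vsq : v ^+ 2 = K%:R * 2 ^+ m / L.
  by rewrite -(rate_active_sqr L0 K_gt0 am) -/mu /v; field; rewrite !gt_eqF.
have vE : v = Num.sqrt (K%:R / L) * Num.sqrt (2 ^+ m).
  rewrite -sqrtrM ?divr_ge0 ?ltW// mulrAC -vsq sqrtr_sqr ger0_norm// ltW//.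
rewrite -vE.
have lT : 1 / 2 <= ln (T%:R + 2) :> R by apply: ln_ge_half; rewrite lerDr.
have lK : 1 / 2 <= ln (K%:R + 2) :> R by apply: ln_ge_half; rewrite lerDr.
set a := ln _ in lT *; set b := ln _ in lK *.
have lnv : - ln mu <= 4 * (a * b).
  rewrite -lnV ?posrE// -/v.
  have v_le : v <= (T%:R + 2) * (K%:R + 2).
    apply: (@le_trans _ _ (v ^+ 2)); first by rewrite expr2 ler_peMl ?ltW//; lra.
    rewrite vsq ler_pdivrMr//.
    have t1 : 2 ^+ m * 2 <= T%:R :> R.
      by rewrite -exprSr -natrX ler_nat ltnW.
    have t0 : 0 <= T%:R :> R by [].
    have k2 : K%:R * (2 ^+ m * 2) <= K%:R * T%:R :> R by rewrite ler_wpM2l.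
    have l2 : (T%:R + 2) * (K%:R + 2) * (1 / 2) <= (T%:R + 2) * (K%:R + 2) * L :> R.
      by rewrite ler_wpM2l// mulr_ge0// addr_ge0.
    apply: le_trans l2; have := K0; nra.
  apply: (@le_trans _ _ (ln ((T%:R + 2) * (K%:R + 2)))).
    by rewrite ler_ln ?posrE// mulr_gt0// ltr_wpDl.
  rewrite lnM ?posrE ?ltr_wpDl// -/a -/b; nra.
rewrite /design_fuel -natr1 -natr1.
have x0 : 0 <= 16 * - ln mu / mu.
  rewrite mulr_ge0 ?invr_ge0 ?ltW// mulr_gt0// oppr_gt0 ln_lt0//.
  by rewrite mu0 (le_lt_trans mu2)//; lra.
have := truncn_le (16 * - ln mu / mu); rewrite x0 => tr.
have ab : 1 <= 4 * (a * b) by nra.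
have e1 : 16 * - ln mu / mu <= 16 * (4 * (a * b)) * v.
  by rewrite -/v ler_pM2r// ler_pM2l.
have e2 : 1 * v <= 4 * (a * b) * v by rewrite ler_pM2r.
have -> : 68 * (a * b) * v = 16 * (4 * (a * b)) * v + 4 * (a * b) * v by ring.
move: tr e1 e2; set x := (_)%:R; set z := 16 * - ln mu / mu.
set q := 16 * _ * v; set r := 4 * _ * v; clearbody x z q r.
by move: v2; clearbody v; lra.
Qed.

(** The bound holds on every run, not just with high probability: the oracle is called at refreshes
    only, so each block has at most one nonzero term. The constant is [340 = 68 * (5/2) * 2], the
    last 2 to insert [ln (L + 2) >= 1/2]. *)
Lemma oracle_calls_le (y : nat -> X * K.-tuple R * R) (T : nat) :
  (oracle_calls (taming X a0 L) orc y T)%:R <=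
  340 * Num.sqrt (K%:R * T%:R / L) * log_factor T K L :> R.
Proof.
have lT : 1 / 2 <= ln (T%:R + 2) :> R by apply: ln_ge_half; rewrite lerDr.
have lK : 1 / 2 <= ln (K%:R + 2) :> R by apply: ln_ge_half; rewrite lerDr.
have lL : 1 / 2 <= ln (L + 2) :> R by apply: ln_ge_half; rewrite lerDr ltW.
have lf0 : 0 <= log_factor T K L by rewrite /log_factor !mulr_ge0//; lra.
have [T0|T_gt0] := posnP T.
  have -> : oracle_calls (taming X a0 L) orc y T = 0%N.
    by rewrite T0 /oracle_calls big_ord0.
  exact: (mulr_ge0 (mulr_ge0 (ler0n _ _) (sqrtr_ge0 _)) lf0).
pose M := trunc_log 2 T.
have /andP[M1 M2] : (2 ^ M <= T < 2 ^ M.+1)%N by exact: trunc_log_bounds.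
pose q := 68 * (ln (T%:R + 2) * ln (K%:R + 2)) * Num.sqrt (K%:R / L) : R.
have q0 : 0 <= q.
  rewrite mulr_ge0 ?sqrtr_ge0// mulr_ge0// mulr_ge0//; lra.
rewrite /oracle_calls natr_sum.
apply: (@le_trans _ _ (2 * 0 + \sum_(m < M) q * Num.sqrt (2 ^+ m))).
  apply: (@sum_blocks_le R
    (fun t => (@round_at R K X (taming X a0 L) orc y (state a0 L orc y t) t).2%:R)
    (fun m => q * Num.sqrt (2 ^+ m)) T M 0 (ltnW M2)) => //.
  - by move=> m; rewrite mulr_ge0 ?sqrtr_ge0.
  - move=> t t2; have := @round_calls_le R K X a0 L orc Pi HPi L0 K_gt0 y t.
    case: ifPn => [/refreshP[m _ te]|_].
      by move: t2; rewrite te ltnNge -[X in (X <= _)%N]expn1 leq_exp2l.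
    by rewrite leqn0 => /eqP ->.
  - move=> m mM.
    have pm : (0 < 2 ^ m.+1)%N by rewrite expn_gt0.
    rewrite (bigD1 (Ordinal pm))//= big1 ?addr0 => [|i i0].
      rewrite addn0; case: ifPn => [mT|_]; last by rewrite mulr_ge0 ?sqrtr_ge0.
      have := @round_calls_le R K X a0 L orc Pi HPi L0 K_gt0 y (2 ^ m.+1).
      case: ifPn => [rt|_ h].
        have [m' am' /eqP] := refreshP rt.
        rewrite eqn_exp2l// => /eqP[me]; rewrite -me in am' => h; rewrite epoch_pow in h.
        apply: (@le_trans _ _ ((design_fuel (rate K L m.+1)).+1%:R)).
          by rewrite ler_nat.
        apply: (le_trans (design_fuel_le am' mT)).
        by rewrite /q -[leRHS]mulrA.
      rewrite leqn0 in h; rewrite (eqP h) mulr_ge0 ?sqrtr_ge0//.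
    case: ifPn => // _.
    have := @round_calls_le R K X a0 L orc Pi HPi L0 K_gt0 y (2 ^ m.+1 + i).
    case: ifPn => [rt|_]; last by rewrite leqn0 => /eqP ->.
    have [m' am' te] := refreshP rt.
    have := epoch_block (ltn_ord i); rewrite te epoch_pow => me.
    move: te; rewrite me => /eqP; rewrite -[X in _ == X]addn0 eqn_add2l => /eqP i00.
    by move: i0; rewrite -val_eqE/= i00.
rewrite mulr0 add0r -mulr_sumr.
apply: (le_trans (ler_wpM2l q0 (sum_sqrt_pow R M))).
have h1 : Num.sqrt (2 ^+ M) <= Num.sqrt T%:R :> R.
  by rewrite ler_wsqrtr// -natrX ler_nat.
have h2 : Num.sqrt (K%:R * T%:R / L) = Num.sqrt (K%:R / L) * Num.sqrt T%:R.
  by rewrite mulrAC sqrtrM// divr_ge0// ltW.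
apply: (@le_trans _ _ (q * (5 / 2 * Num.sqrt T%:R))).
  by rewrite ler_wpM2l// ler_wpM2l ?divr_ge0.
rewrite h2 /q /log_factor.
set a := ln _ in lT *; set b := ln _ in lK *; set c := ln _ in lL *.
set u := Num.sqrt (K%:R / L); set v := Num.sqrt T%:R.
have -> : 68 * (a * b) * u * (5 / 2 * v) = 340 * (u * v) * (a * b * (1 / 2)) by field.
have u0 : 0 <= u by exact: sqrtr_ge0.
have v0 : 0 <= v by exact: sqrtr_ge0.
move: lT lK lL u0 v0; clearbody a b c u v => lT lK lL u0 v0.
apply: ler_wpM2l; first exact: (mulr_ge0 (ler0n _ _) (mulr_ge0 u0 v0)).
by apply: ler_wpM2l => //; apply: mulr_ge0; lra.
Qed.

End Calls.

Lemma enum_policies (U : Type) (Pi : set U) (N : nat) : (Pi #= `I_N)%card ->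
  exists pol : 'I_N -> U,
    (forall i, Pi (pol i)) /\ (forall p, Pi p -> exists i, pol i = p).
Proof.
move=> /card_set_bijP[f [fI finj fsurj]].
have ex (i : 'I_N) : {p | Pi p /\ f p = i}.
  by apply: cid; have [p Pp fp] := fsurj i (ltn_ord i); exists p.
exists (fun i => sval (ex i)); split => [i|p Pp]; first by case: (svalP (ex i)).
have fN : (f p < N)%N by exact: fI.
exists (Ordinal fN); case: (svalP (ex (Ordinal fN))) => Pq fq.
by apply: finj; rewrite ?inE.
Qed.

Lemma all_in_map (U : Type) (Pi : set U) (I : Type) (pol : I -> U) (l : seq I) :
  (forall i, Pi (pol i)) -> all_in Pi (map pol l).
Proof. by move=> Ppol; elim: l. Qed.

Lemma all_in_enum (U : Type) (Pi : set U) (I : Type) (pol : I -> U) (l : seq U) :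
  (forall p, Pi p -> exists i, pol i = p) -> all_in Pi l ->
  exists l' : seq I, map pol l' = l.
Proof.
move=> polP; elim: l => [_|p l ih] /=; first by exists [::].
by move=> [/polP[i <-] /ih[l' <-]]; exists (i :: l').
Qed.

Lemma sum_half_pow (R : realType) (M c : nat) :
  \sum_(m < M) (1 / 2) ^+ (M - m + c) <= (1 / 2) ^+ c :> R.
Proof.
elim: M c => [|M ih] c; first by rewrite big_ord0 exprn_ge0// divr_ge0.
rewrite big_ord_recr/= subSnn.
rewrite (eq_bigr (fun m : 'I_M => (1 / 2) ^+ (M - m + c.+1) : R)); last first.
  move=> m _; congr (_ ^+ _).
  by rewrite subSn; [rewrite addSnnS | exact: ltnW].
apply: (le_trans (lerD (ih c.+1) (lexx _))); rewrite add1n !exprS.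
by lra.
Qed.

(** * Failure probabilities and the regret bound *)

Section Main.
Context (R : realType) (K : nat) (d : measure_display) (X : measurableType d).
Context (a0 : 'I_K) (N : nat) (delta : R) (D : probability (X * K.-tuple R)%type R).
Variables (Pi : set (X -> 'I_K)) (orc : query R K X -> X -> 'I_K).
Hypothesis mPi : forall pi, Pi pi -> measurable_policy pi.
Hypotheses (HPi : opt_oracle Pi orc) (morc : measurable_oracle Pi orc).
Hypothesis NPi : (Pi #= `I_N)%card.
Hypotheses (K_gt0 : (0 < K)%N) (N_gt0 : (0 < N)%N).
Hypotheses (delta_gt0 : 0 < delta) (delta_lt1 : delta < 1).

Let L : R := ln (N%:R / delta).
Hypothesis L_ge2 : ln 2 <= L.

Local Notation S := (X * K.-tuple R * measurableTypeR R)%type.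
Local Notation law := (D \x uniform_prob (@ltr01 R))%E.

Context (d' : measure_display) (Omega : measurableType d').
Variables (P : probability Omega R) (Y : nat -> {RV P >-> S}).
Hypothesis iidY : iid_with_law law Y.

Variable pistar : X -> 'I_K.
Hypothesis Pstar : Pi pistar.
Hypothesis star_max : forall p, Pi p -> mean_reward D p <= mean_reward D pistar.

Local Notation rate := (rate K L).
Local Notation lst w t := (cur_list a0 L orc (fun s => Y s w) t).
Local Notation data w m := (epoch_data a0 L orc (fun s => Y s w) m).

Let ln2_ge : 1 / 2 <= ln 2 :> R. Proof. exact: ln_ge_half. Qed.
Let L_ge : 1 / 2 <= L. Proof. exact: le_trans L_ge2. Qed.
Let L0 : 0 < L. Proof. by have := L_ge; lra. Qed.
Let K0 : 0 < K%:R :> R. Proof. by rewrite ltr0n. Qed.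
Let K1 : 1 <= K%:R :> R. Proof. by rewrite ler1n. Qed.
Let N0 : 0 < N%:R :> R. Proof. by rewrite ltr0n. Qed.
Let rate0 m : 0 < rate m. Proof. exact: rate_gt0. Qed.

Let expNL : expR (- L) = delta / N%:R.
Proof. by rewrite expRN /L lnK ?posrE ?divr_gt0// invf_div. Qed.

Let expNL_le : expR (- L) <= 1 / 2.
Proof.
rewrite expRN div1r lef_pV2 ?posrE ?expR_gt0//.
by rewrite -[leLHS](@lnK R) ?posrE// ler_expR.
Qed.

Variable T : nat.
Hypothesis T_gt0 : (0 < T)%N.
Let M := trunc_log 2 T.
Let slk m : R := slack R M m.

Definition draws (m : nat) : nat := (Num.truncn (rate m.+1)^-1).+1.

Let draws_large m : 1 <= (draws m)%:R * rate m.+1.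
Proof.
rewrite -ler_pdivrMr// div1r ltW//; exact: truncnS_gt.
Qed.

Let draws_le m : active K L m.+1 -> (draws m).+1%:R <= 2 / rate m.+1.
Proof.
move=> am; set mu := rate m.+1; have mu0 : 0 < mu := rate0 _.
have mu2 : mu <= 1 / 2.
  by apply: le_trans (rate_active L0 K_gt0 am); rewrite ler_peMl// ltW.
have v2 : 2 <= mu^-1.
  by rewrite -[2]invrK lef_pV2 ?posrE ?invr_gt0// -div1r.
have := truncn_le mu^-1; rewrite invr_ge0 (ltW mu0).
by rewrite /draws -/mu -!natr1; set k := (_)%:R; set v := mu^-1 in v2 *; clearbody k v; lra.
Qed.

Let fail m : R := N%:R * expR (- (L * slk m)).

(** One factor [expR (- L) = delta / N] pays for the union over the policies and for [delta]; each
    of the others is at most 1/2 because [ln 2 <= L]. *)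
Let fail_le m : fail m <= delta * (1 / 2) ^+ (M - m + 4).
Proof.
rewrite /fail /slk /slack -mulNr expRM_natr addnS exprS expNL mulrA.
rewrite [N%:R * _]mulrC divfK ?gt_eqF// ler_pM2l//.
by rewrite -expNL; apply: lerXn2r; rewrite ?nnegrE ?expR_ge0 ?divr_ge0// expNL_le.
Qed.

Let fail_ge0 m : 0 <= fail m.
Proof. by rewrite mulr_ge0 ?expR_ge0. Qed.

Let fail_le1 m : fail m <= 1.
Proof.
apply: (le_trans (fail_le m)).
have h0 : 0 <= 1 / 2 :> R by rewrite divr_ge0.
apply: mulr_ile1; [exact: ltW|exact: exprn_ge0|exact: ltW|].
by apply: exprn_ile1 => //; lra.
Qed.

Definition reward_event (w : Omega) : Prop :=
  forall m p, (m < M)%N -> active K L m.+1 -> Pi p ->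
  `|emp_reward (data w m) p - mean_reward D p| <=
  rate m.+1 * true_var L D m (lst w (2 ^ m)) p + 2 * (K%:R * rate m.+1 * slk m).

Definition sparse_event (w : Omega) : Prop :=
  forall m sg p, (m < M)%N -> active K L m.+1 ->
  size sg = draws m -> all_in Pi sg -> Pi p ->
  expect D (sparse_inv (rate m.+1) sg p) <=
  2 * average (data w m) (sparse_inv (rate m.+1) sg p) + 16 * K%:R * slk m.

Let cPi : countable Pi.
Proof. by apply: finite_set_countable; exists N. Qed.

Lemma hp_reward_event : high_prob P reward_event (\sum_(m < M) 2 * fail m).
Proof.
have [pol [Ppol polP]] := enum_policies NPi.
have h (m : 'I_M) : high_prob P [set w | forall i : 'I_N, active K L m.+1 ->
  `|emp_reward (data w m) (pol i) - mean_reward D (pol i)| <=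
  rate m.+1 * true_var L D m (lst w (2 ^ m)) (pol i) + 2 * (K%:R * rate m.+1 * slk m)]
  (2 * fail m).
  have -> : 2 * fail m = \sum_(i < N) 2 * expR (- (L * slk m)).
    by rewrite sumr_const card_ord -[RHS]mulr_natl /fail; ring.
  apply: (@high_prob_bigcap _ _ _ P 'I_N (fun i => [set w | active K L m.+1 ->
    `|emp_reward (data w m) (pol i) - mean_reward D (pol i)| <=
    rate m.+1 * true_var L D m (lst w (2 ^ m)) (pol i) + 2 * (K%:R * rate m.+1 * slk m)])).
  move=> i; case am : (active K L m.+1).
    apply: high_prob_sub (hp_reward a0 mPi HPi morc cPi L0 K_gt0 iidY am (slk m) (Ppol i)).
    by move=> w /= + _.
  apply: (@high_probW _ _ _ _ _ 0); first by rewrite mulr_ge0// expR_ge0.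
  by apply: high_prob_sub (high_prob_setT P) => w.
apply: high_prob_sub (high_prob_bigcap h) => w /= hw m p mM am /polP[i <-].
exact: (hw (Ordinal mM)).
Qed.

Lemma hp_sparse_event : high_prob P sparse_event (\sum_(m < M) fail m).
Proof.
have [pol [Ppol polP]] := enum_policies NPi.
have h (m : 'I_M) : high_prob P [set w |
  forall (v : (draws m).-tuple 'I_N * 'I_N), active K L m.+1 ->
  expect D (sparse_inv (rate m.+1) (map pol v.1) (pol v.2)) <=
  2 * average (data w m) (sparse_inv (rate m.+1) (map pol v.1) (pol v.2)) + 16 * K%:R * slk m]
  (fail m).
  case am : (active K L m.+1); last first.
    apply: (@high_probW _ _ _ _ _ 0) => //.
    by apply: high_prob_sub (high_prob_setT P) => w.
  apply: (@high_probW _ _ _ _ _ (\sum_(v : (draws m).-tuple 'I_N * 'I_N)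
     expR (- (2 / rate m.+1 * (L * slk m))))).
    rewrite sumr_const card_prod card_tuple card_ord -expnSr -[leLHS]mulr_natl natrX.
    (* There are [draws m] policies in the list and one more is tested. As [(draws m).+1 <= 2 / mu],
       the union bound is at most a power of [fail m], hence at most [fail m] itself. *)
    apply: (@le_trans _ _ (N%:R ^+ (draws m).+1 * expR (- ((draws m).+1%:R * (L * slk m))))).
      rewrite ler_wpM2l ?exprn_ge0// ler_expR lerN2 ler_wpM2r//.
        by apply: mulr_ge0; [exact: ltW|exact: ler0n].
      exact: draws_le.
    rewrite -mulrN expRM_natl -exprMn -/(fail m) exprS ler_piMr//.
    by apply: exprn_ile1.
  have hv (v : (draws m).-tuple 'I_N * 'I_N) := hp_sparse a0 mPi HPi morc cPi L0 K_gt0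
    iidY am (slk m) (all_in_map v.1 Ppol) (Ppol v.2).
  by apply: high_prob_sub (high_prob_bigcap hv) => w /= hw v _; exact: hw.
apply: high_prob_sub (high_prob_bigcap h) => w /= hw m sg p mM am ssg Psg /polP[i <-].
have [l lE] := all_in_enum polP Psg; rewrite -lE in ssg *.
have sl : size l == draws m by rewrite -ssg size_map.
exact: (hw (Ordinal mM) (Tuple sl, i) am).
Qed.

(** The failure probabilities sum geometrically to at most [delta / 16], used three times; the
    deviation of the regret costs at most [delta / 2]. *)
Lemma events_budget :
  \sum_(m < M) 2 * fail m + \sum_(m < M) fail m + expR (- (2 * L)) <= delta.
Proof.
have h : \sum_(m < M) fail m <= delta / 16.
  apply: (@le_trans _ _ (\sum_(m < M) delta * (1 / 2) ^+ (M - m + 4))).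
    by apply: ler_sum => m _; exact: fail_le.
  rewrite -mulr_sumr ler_pM2l//; apply: (le_trans (sum_half_pow _ _ _)).
  by rewrite expr_div_n expr1n -natrX div1r.
have e2 : expR (- (2 * L)) <= delta / 2.
  rewrite -mulrN expRM_natl expr2 {1}expNL.
  apply: (@le_trans _ _ (delta * (1 / 2))); last by lra.
  apply: ler_pM; [by rewrite divr_ge0// ltW|exact: expR_ge0| |exact: expNL_le].
  by rewrite ler_pdivrMr// ler_peMr ?ler1n// ltW.
rewrite -mulr_sumr; have := delta_gt0; lra.
Qed.

Let Mbounds : (2 ^ M <= T < 2 ^ M.+1)%N.
Proof. exact: trunc_log_bounds. Qed.

Let root : R := Num.sqrt (K%:R * T%:R * L).

Let root_ge0 : 0 <= root. Proof. exact: sqrtr_ge0. Qed.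

Let T1 : 1 <= T%:R :> R. Proof. by rewrite ler1n. Qed.

Let root_ge : 2 / 3 <= root.
Proof.
have KT : 1 <= K%:R * T%:R :> R by rewrite -natrM ler1n muln_gt0 K_gt0.
have h : 1 / 2 <= K%:R * T%:R * L by apply: le_trans L_ge _; rewrite ler_peMl// ltW.
rewrite /root -(@ler_pXn2r _ 2)// ?nnegrE ?sqrtr_ge0 ?divr_ge0// sqr_sqrtr.
  by apply: le_trans h; lra.
by apply: le_trans h; rewrite divr_ge0.
Qed.

(** Epoch [m.+1] has [2 ^ m.+1] rounds, whence [1858 = 2 * 929]; [85/4] is the weighted geometric
    sum at [c = 5]. *)
Lemma sum_mean_regret_le w : reward_event w -> sparse_event w ->
  \sum_(t < T) mean_regret a0 L D (epoch t) (lst w t) pistar <=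
  2 + 1858 * (85 / 4) * root.
Proof.
move=> rE sE; have /andP[M1 M2] := Mbounds.
have vl t := valid_lst a0 HPi L0 K_gt0 Y w t.
have bE t m : (m < M)%N -> epoch t = m.+1 ->
    mean_regret a0 L D (epoch t) (lst w t) pistar <=
    929 * (Num.sqrt (K%:R * L / 2 ^+ m) * slk m).
  move=> mM et.
  exact: (mean_regret_epoch mPi HPi L0 K_gt0 Pstar star_max (s := draws)
    (fun m _ => draws_large m) rE sE mM et).
pose b m : R := 1858 * Num.sqrt (K%:R * L) * (Num.sqrt (2 ^+ m) * (M - m + 5)%:R).
have KL0 : 0 <= K%:R * L by rewrite mulr_ge0// ltW.
have b0 m : 0 <= b m.
  apply: mulr_ge0; last by rewrite mulr_ge0 ?sqrtr_ge0.
  by apply: mulr_ge0; [exact: ler0n|exact: sqrtr_ge0].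
have b1 m : 2 ^+ m.+1 * (929 * (Num.sqrt (K%:R * L / 2 ^+ m) * slk m)) = b m.
  have p0 : 0 < 2 ^+ m :> R by rewrite exprn_gt0.
  have p2 : 2 ^+ m = Num.sqrt (2 ^+ m) ^+ 2 :> R by rewrite sqr_sqrtr// ltW.
  rewrite sqrtrM// sqrtrV ?ltW// /b /slk /slack exprS {1}p2.
  have : Num.sqrt (2 ^+ m) != 0 :> R by rewrite gt_eqF// sqrtr_gt0.
  set u := Num.sqrt (2 ^+ m); set v := Num.sqrt (K%:R * L).
  set k := (M - m + 5)%:R; clearbody u v k => u0.
  by field.
apply: (@le_trans _ _ (2 * 1 + \sum_(m < M) b m)).
  apply: (@sum_blocks_le R (fun t => mean_regret a0 L D (epoch t) (lst w t) pistar)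
    b T M 1 (ltnW M2)) => //.
  - move=> t _; apply: le_trans (ler_norm _) _.
    exact: (mean_regret_norm a0 D mPi (vl t) Pstar).
  - move=> m mM; rewrite -b1.
    apply: (@le_trans _ _ (\sum_(i < 2 ^ m.+1)
        929 * (Num.sqrt (K%:R * L / 2 ^+ m) * slk m))).
      apply: ler_sum => i _; case: ifP => _; first by apply: bE => //; exact: epoch_block.
      apply: mulr_ge0; first exact: ler0n.
      by apply: mulr_ge0; [exact: sqrtr_ge0|exact: ler0n].
    by rewrite sumr_const card_ord -[leLHS]mulr_natl natrX.
rewrite mulr1 lerD2l /b -mulr_sumr.
apply: (le_trans (ler_wpM2l (mulr_ge0 (ler0n _ _) (sqrtr_ge0 _))
  (sum_sqrt_pow_weighted R M 5))).
have h : Num.sqrt (2 ^+ M) <= Num.sqrt T%:R :> R.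
  by rewrite ler_wsqrtr// -natrX ler_nat.
have rE' : root = Num.sqrt (K%:R * L) * Num.sqrt T%:R.
  by rewrite /root mulrAC sqrtrM.
rewrite rE'; have := sqrtr_ge0 (K%:R * L).
move: h; set u := Num.sqrt (2 ^+ M); set v := Num.sqrt T%:R; set k := Num.sqrt _.
clearbody u v k => uv k0; have := ler_wpM2l k0 uv; lra.
Qed.

Definition regret_event (c : R) (w : Omega) : Prop :=
  \sum_(t < T) round_regret a0 L (epoch t) (lst w t) pistar (Y t w) <= c.

Lemma hp_round_regret :
  high_prob P (regret_event (2000 * 20 * root)) delta.
Proof.
have rr w t : round_regret a0 L (epoch t) (lst w t) pistar (Y t w) <= 1.
  by apply: le_trans (ler_norm _) _; exact: round_regret_norm.
have LT0 : 0 <= L * T%:R by rewrite mulr_ge0// ltW.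
have rootLT : Num.sqrt (L * T%:R) <= root.
  rewrite ler_wsqrtr//.
  have -> : K%:R * T%:R * L = K%:R * (L * T%:R) by ring.
  by rewrite ler_peMl.
(* The martingale bound needs a scale of at most 1/4. For smaller [T], the trivial bound [T] is
   itself at most four times the square root of [L * T]. *)
have [big|small] := leP (16 * L) T%:R; last first.
  apply: (@high_probW _ _ _ _ _ 0); first exact: ltW.
  apply: high_prob_sub (high_prob_setT P) => w _.
  rewrite /regret_event; apply: (@le_trans _ _ T%:R).
    rewrite -[X in _ <= X%:R](card_ord T) -sumr_const.
    by apply: ler_sum => t _; exact: rr.
  have e4 : T%:R <= 4 * Num.sqrt (L * T%:R).
    rewrite -(@ler_pXn2r _ 2)// ?nnegrE ?mulr_ge0 ?sqrtr_ge0// exprMn sqr_sqrtr//.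
    rewrite expr2; have -> : 4 ^+ 2 * (L * T%:R) = 16 * L * T%:R by ring.
    by rewrite ler_pM2r ?ltr0n// ltW.
  move: e4 rootLT root_ge0; set u := Num.sqrt _; set v := root; set q := T%:R.
  by clearbody u v q; lra.
(* This scale balances the variance term [2 * s ^+ 2 * T] with the deviation level [2 * L]. *)
pose s := Num.sqrt (L / T%:R).
have LT1 : 0 <= L / T%:R by rewrite divr_ge0// ltW.
have s2 : s ^+ 2 = L / T%:R by rewrite sqr_sqrtr.
have T0 : 0 < T%:R :> R by rewrite ltr0n.
have s0 : 0 < s by rewrite sqrtr_gt0 divr_gt0.
have s4 : s <= 1 / 4.
  rewrite -(@ler_pXn2r _ 2)// ?nnegrE ?divr_ge0 ?(ltW s0)// s2 ler_pdivrMr//.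
  by rewrite expr_div_n expr1n; lra.
have sT : s * T%:R = Num.sqrt (L * T%:R).
  have -> : L * T%:R = L / T%:R * T%:R ^+ 2 by field; rewrite gt_eqF.
  by rewrite sqrtrM// sqrtr_sqr ger0_norm// ltW.
have h3 := hp_regret a0 mPi HPi morc cPi L0 K_gt0 iidY T (2 * L) Pstar (ltW s0) s4.
apply: (high_probW events_budget).
apply: high_prob_sub (high_probI (high_probI hp_reward_event hp_sparse_event) h3).
move=> w [[rE sE] /=]; rewrite sumrB.
have mr := sum_mean_regret_le rE sE.
move: mr; rewrite /regret_event; set A := \sum_(t < T) mean_regret _ _ _ _ _ _.
set B := \sum_(t < T) round_regret _ _ _ _ _ _ => mr.
have -> : 2 * s ^+ 2 * T%:R + 2 * L = s * (4 * (s * T%:R)).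
  have -> : s * (4 * (s * T%:R)) = 4 * s ^+ 2 * T%:R by ring.
  by rewrite s2; field; rewrite gt_eqF.
rewrite ler_pM2l// sT.
move: rootLT root_ge mr; set u := Num.sqrt _; set v := root.
by clearbody u v A B; lra.
Qed.

End Main.

(** * Almost sure boundedness of the rewards *)

Section UnitRewards.
Context (R : realType) (K : nat) (d : measure_display) (X : measurableType d).
Variable D : probability (X * K.-tuple R)%type R.

Local Notation Z := (X * K.-tuple R)%type.

Definition unit_rewards : set Z := [set z | forall a, 0 <= tnth z.2 a <= 1].

Lemma measurable_unit_rewards : measurable unit_rewards.
Proof.
have -> : unit_rewards = \bigcap_(a in [set: 'I_K])
    [set z : Z | (0 <= tnth z.2 a) && (tnth z.2 a <= 1)].
  by apply/seteqP; split => z /= h; [move=> a _|move=> a]; exact: h.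
apply: fin_bigcap_measurable => // a _.
have mt : measurable_fun setT (fun z : Z => tnth z.2 a).
  exact: (measurableT_comp (measurable_tnth a) (@measurable_snd _ _ X _)).
have mb : measurable_fun setT (fun z : Z => (0 <= tnth z.2 a) && (tnth z.2 a <= 1)).
  by apply: measurable_and; apply: measurable_fun_ler => //; exact: measurable_cst.
by have := mb measurableT [set true] I; rewrite setTI.
Qed.

Lemma clip_id (r : R) : 0 <= r <= 1 -> clip r = r.
Proof. by move=> /andP[r0 r1]; rewrite /clip (min_idPr r1) (max_idPr r0). Qed.

Hypothesis D_unit : D unit_rewards = 1%E.

Lemma unit_rewards_compl : D (~` unit_rewards) = 0%E.
Proof.
rewrite probability_setC ?D_unit ?subee//.
exact: measurable_unit_rewards.
Qed.

Lemma expected_rewardE (Pi : set (X -> 'I_K)) (p : X -> 'I_K) :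
  (forall pi, Pi pi -> measurable_policy pi) -> Pi p ->
  expected_reward D p = (mean_reward D p)%:E.
Proof.
move=> mPi Pp; have bc := bounded_rv_clipped R mPi Pp.
rewrite /expected_reward unlock /mean_reward /expect /Rintegral fineK; last first.
  exact: (integrable_fin_num measurableT (bounded_rv_integrable D bc)).
apply: ae_eq_integral => //.
- apply/measurable_EFinP.
  exact: (@measurable_policy_reward R K _ X Pi mPi _ _ p id Pp (@measurable_id _ _ _)).
- by apply/measurable_EFinP; exact: bc.1.
- exists (~` unit_rewards); split.
  + by apply: measurableC; exact: measurable_unit_rewards.
  + exact: unit_rewards_compl.
  + move=> z /= h u; apply: h => _; congr (_%:E).
    by rewrite /clipped clip_id.
Qed.

Local Notation S := (X * K.-tuple R * measurableTypeR R)%type.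
Local Notation law := (D \x uniform_prob (@ltr01 R))%E.

Context (d' : measure_display) (Omega : measurableType d').
Variables (P : probability Omega R) (Y : nat -> {RV P >-> S}).
Hypothesis iidY : iid_with_law law Y.

(** The product formula with the whole space for all earlier rounds. *)
Lemma iid_marginal t (C : set S) : measurable C -> P (Y t @^-1` C) = law C.
Proof.
move=> mC; have := @iidY t.+1 (fun s => if s == t then C else setT).
rewrite (_ : \bigcap_(_ in _) _ = Y t @^-1` C); last first.
  apply/seteqP; split => [w /(_ t (ltnSn t))/=|w Cw s _ /=]; first by rewrite eqxx.
  by case: eqP => // ->.
move=> -> => [|s]; last by case: ifP.
rewrite big_ord_recr/= eqxx big1 ?mul1e// => i _.
by rewrite (ltn_eqF (ltn_ord i)) probability_setT.
Qed.

Lemma hp_unit_rewards (T : nat) :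
  high_prob P [set w | forall t : 'I_T, unit_rewards (Y t w).1] 0.
Proof.
have mU : measurable (~` unit_rewards).
  by apply: measurableC; exact: measurable_unit_rewards.
have mC : measurable ((~` unit_rewards) `*` setT : set S) by exact: measurableX.
have h (t : 'I_T) : high_prob P [set w | unit_rewards (Y t w).1] 0.
  exists (Y t @^-1` ((~` unit_rewards) `*` setT)); split.
  - by rewrite -[X in measurable X]setTI; apply: measurable_funP.
  - by move=> w /= uw; split.
  - by rewrite iid_marginal// product_measure1E// [X in (X * _)%E]unit_rewards_compl mul0e.
by have := high_prob_bigcap h; rewrite big1.
Qed.

End UnitRewards.

(** * The guarantee for at least two policies or small [delta] *)

Section Guarantee.
Context (R : realType) (K : nat) (d : measure_display) (X : measurableType d).
Context (a0 : 'I_K) (N : nat) (delta : R) (D : probability (X * K.-tuple R)%type R).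
Variables (Pi : set (X -> 'I_K)) (orc : query R K X -> X -> 'I_K).
Hypothesis mPi : forall pi, Pi pi -> measurable_policy pi.
Hypotheses (HPi : opt_oracle Pi orc) (morc : measurable_oracle Pi orc).
Hypothesis NPi : (Pi #= `I_N)%card.
Hypotheses (K_gt0 : (0 < K)%N) (N_gt0 : (0 < N)%N).
Hypotheses (delta_gt0 : 0 < delta) (delta_lt1 : delta < 1).
Hypothesis D_unit : D (@unit_rewards R K d X) = 1%E.

Let L : R := ln (N%:R / delta).
Hypothesis L_ge2 : ln 2 <= L.

Local Notation S := (X * K.-tuple R * measurableTypeR R)%type.
Local Notation law := (D \x uniform_prob (@ltr01 R))%E.

Context (d' : measure_display) (Omega : measurableType d').
Variables (P : probability Omega R) (Y : nat -> {RV P >-> S}).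
Hypothesis iidY : iid_with_law law Y.

Variable pistar : X -> 'I_K.
Hypothesis Pstar : Pi pistar.
Hypothesis star_max : forall p, Pi p ->
  (expected_reward D p <= expected_reward D pistar)%E.

Let L_ge : 1 / 2 <= L. Proof. by apply: le_trans L_ge2; exact: ln_ge_half. Qed.
Let L0 : 0 < L. Proof. by have := L_ge; lra. Qed.

Let alg := taming X a0 L.

Lemma measurable_regret (T : nat) :
  measurable_fun setT (fun w => regret alg orc (fun t => Y t w) pistar T).
Proof.
have mY t : measurable_fun setT (fun w => Y t w) by exact: measurable_funP.
have mY1 t : measurable_fun setT (fun w => (Y t w).1).
  exact: (measurableT_comp (@measurable_fst _ _ (X * K.-tuple R)%type _) (mY t)).
apply: measurable_sum => t; apply: measurable_funB.
  exact: (measurable_policy_reward mPi Pstar (mY1 t)).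
rewrite (_ : (fun w => _) = (fun w => tnth (Y t w).1.2
    (act a0 L orc (fun s => Y s w) t))); last first.
  by apply/funext => w; rewrite action_atE.
have cPi : countable Pi by apply: finite_set_countable; exists N.
apply: (@measurable_bind _ Omega _ _ _ (fun w => act a0 L orc (fun s => Y s w) t)
  (fun a w => tnth (Y t w).1.2 a)).
  apply: (discrete_action mPi HPi morc cPi K_gt0 a0 L0 (y := fun w s => Y s w)) => s _.
  exact: mY.
move=> w; apply: (measurableT_comp (measurable_tnth _)).
exact: (measurableT_comp (@measurable_snd _ _ X (K.-tuple R)) (mY1 t)).
Qed.

Lemma regret_unit (T : nat) w : (forall t : 'I_T, unit_rewards (Y t w).1) ->
  regret alg orc (fun t => Y t w) pistar T =
  \sum_(t < T) round_regret a0 L (epoch t)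
    (cur_list a0 L orc (fun s => Y s w) t) pistar (Y t w).
Proof.
move=> u; apply: eq_bigr => t _; rewrite action_atE /round_regret /clipped.
by rewrite !clip_id; [|exact: u|exact: u].
Qed.

Lemma hp_regret_bound (T : nat) :
  high_prob P [set w | regret alg orc (fun t => Y t w) pistar T <=
    2000 * 20 * Num.sqrt (K%:R * T%:R * L)] delta.
Proof.
have [->|T_gt0] := posnP T.
  apply: (@high_probW _ _ _ _ _ 0); first exact: ltW.
  apply: high_prob_sub (high_prob_setT P) => w _ /=.
  rewrite /regret big_ord0 mulr0 mul0r sqrtr0 mulr0//.
have star p : Pi p -> mean_reward D p <= mean_reward D pistar.
  move=> Pp; have := star_max Pp.
  by rewrite (expected_rewardE D_unit mPi Pp) (expected_rewardE D_unit mPi Pstar) lee_fin.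
have h := hp_round_regret a0 mPi HPi morc NPi K_gt0 N_gt0 delta_gt0 delta_lt1 L_ge2
  iidY Pstar star T_gt0.
have := high_probI h (hp_unit_rewards D_unit iidY T); rewrite addr0.
apply: high_prob_sub => w [rw uw] /=; rewrite regret_unit//.
Qed.

Lemma taming_guarantee (T : nat) :
  let good := [set w |
    regret alg orc (fun t => Y t w) pistar T
      <= 2000 * 20 * Num.sqrt (K%:R * T%:R * L) /\
    (oracle_calls alg orc (fun t => Y t w) T)%:R
      <= 2000 * 20 * Num.sqrt (K%:R * T%:R / L) * log_factor T K L ^+ 1] in
  measurable good /\ ((1 - delta)%:E <= P good)%E.
Proof.
move=> good; pose c := 2000 * 20 * Num.sqrt (K%:R * T%:R * L).
(* The bound on the calls holds on every run, so only the regret can fail. *)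
have goodE : good = [set w | regret alg orc (fun t => Y t w) pistar T <= c].
  apply/seteqP; split => w; first by case.
  move=> rw; split => //; rewrite expr1.
  apply: (le_trans (oracle_calls_le a0 HPi L_ge K_gt0 _ T)).
  have lf : 0 <= Num.sqrt (K%:R * T%:R / L) * log_factor T K L.
    rewrite mulr_ge0 ?sqrtr_ge0//.
    have lT : 1 / 2 <= ln (T%:R + 2) :> R by apply: ln_ge_half; rewrite lerDr.
    have lK : 1 / 2 <= ln (K%:R + 2) :> R by apply: ln_ge_half; rewrite lerDr.
    have lL : 1 / 2 <= ln (L + 2) :> R by apply: ln_ge_half; rewrite lerDr ltW.
    by rewrite /log_factor; apply: mulr_ge0; [apply: mulr_ge0|]; lra.
  move: lf; set u := Num.sqrt _; set v := log_factor _ _ _; clearbody u v => uv.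
  by lra.
have mgood : measurable good.
  rewrite goodE.
  have mb := measurable_fun_ler (measurable_regret T) (@measurable_cst _ _ _ _ setT c).
  by have := mb measurableT [set true] I; rewrite setTI.
split => //; have [B [mB gB PB]] := hp_regret_bound T.
have Pc : (P (~` good) <= delta%:E)%E.
  apply: le_trans PB; apply: le_measure; rewrite ?inE//; first exact: measurableC.
  by rewrite goodE.
rewrite -[good]setCK probability_setC; last exact: measurableC.
by rewrite EFinB leeB.
Qed.

End Guarantee.


(** As [delta] tends to 1 with [N = 1], the regret bound tends to 0 and allows no exploration, so
    the only policy must be followed from round 0. The empty query reveals it, since the oracle
    always answers a nonnegative query by a member of [Pi]. *)
Definition single_policy (R : realType) (K : nat) (X : Type) :
    bandit_algorithm R K X :=
  {| alg_state := option (X -> 'I_K);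
     alg_init := None;
     alg_round := fun s x _ =>
       if s is Some p then Ret (p x, fun _ => Some p)
       else Ask [::] (fun p => Ret (p x, fun _ => Some p)) |}.

(** * A single policy *)

Section SinglePolicy.
Context (R : realType) (K : nat) (X : Type).
Variables (orc : query R K X -> X -> 'I_K) (y : nat -> X * K.-tuple R * R).

Local Notation alg := (single_policy R K X).

Lemma single_state (t : nat) :
  state_at alg orc y t = if t is 0 then None else Some (orc [::]).
Proof.
elim: t => // t ih; have -> : state_at alg orc y t.+1 =
  let o := (round_at orc y (state_at alg orc y t) t).1 in
  o.2 (tnth (y t).1.2 o.1) by [].
by rewrite ih; case: (t).
Qed.

Lemma single_action (t : nat) : action_at alg orc y t = orc [::] (y t).1.1.
Proof. by rewrite /action_at single_state; case: t. Qed.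

Lemma single_regret (T : nat) : regret alg orc y (orc [::]) T = 0.
Proof. by rewrite /regret big1// => t _; rewrite single_action subrr. Qed.

Lemma single_calls (T : nat) : oracle_calls alg orc y T = (0 < T)%N.
Proof.
case: T => [|T]; first by rewrite /oracle_calls big_ord0.
rewrite /oracle_calls big_ord_recl big1 ?addn0// => t _.
by rewrite single_state.
Qed.

End SinglePolicy.

(** The constant 8 pays for the single call: [L < ln 2 <= 1] makes the square root at least 1, and
    the log factor is a product of three logarithms, each at least 1/2. *)
Lemma single_policy_guarantee (R : realType) (K N : nat) (d d' : measure_display)
    (X : measurableType d) (Omega : measurableType d') (P : probability Omega R)
    (C delta : R) (Pi : set (X -> 'I_K)) (orc : query R K X -> X -> 'I_K)
    (Y : nat -> Omega -> X * K.-tuple R * R) (pistar : X -> 'I_K) (T : nat) :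
  let L := ln (N%:R / delta) in
  8 <= C -> (0 < K)%N -> (0 < N)%N -> 0 < delta -> delta < 1 -> L < ln 2 ->
  (Pi #= `I_N)%card -> opt_oracle Pi orc -> Pi pistar ->
  let good := [set w |
    regret (single_policy R K X) orc (fun t => Y t w) pistar T
      <= C * Num.sqrt (K%:R * T%:R * L) /\
    (oracle_calls (single_policy R K X) orc (fun t => Y t w) T)%:R
      <= C * Num.sqrt (K%:R * T%:R / L) * log_factor T K L ^+ 1] in
  measurable good /\ ((1 - delta)%:E <= P good)%E.
Proof.
move=> L C8 K_gt0 N_gt0 delta_gt0 delta_lt1 L_lt2 NPi HPi Pstar good.
have C0 : 0 <= C by apply: le_trans C8.
have Nd : 0 < N%:R / delta by rewrite divr_gt0// ltr0n.
have N1 : N = 1%N.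
  apply/eqP; rewrite eqn_leq N_gt0 andbT -ltnS -(ltr_nat R).
  have : N%:R / delta < 2 by rewrite -(ltr_ln) ?posrE.
  by rewrite ltr_pdivrMr// => /lt_trans; apply; lra.
have starE : pistar = orc [::].
  rewrite N1 in NPi; have [pol [_ polP]] := enum_policies NPi.
  have [i <-] := polP _ Pstar; have [j <-] := polP _ (HPi [::] isT).1.
  by rewrite !ord1.
have L0 : 0 < L by rewrite ln_gt0// N1 mul1r invf_gt1.
suff -> : good = setT by split; [exact: measurableT|rewrite probability_setT lee_fin; lra].
apply/seteqP; split => // w _; split.
  by rewrite starE single_regret mulr_ge0 ?sqrtr_ge0.
rewrite single_calls expr1; case: T {good} => [|T].
  by rewrite mulr0 mul0r sqrtr0 mulr0 mul0r.
set T' := T.+1.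
have lT : 1 / 2 <= ln (T'%:R + 2) :> R by apply: ln_ge_half; rewrite lerDr.
have lK : 1 / 2 <= ln (K%:R + 2) :> R by apply: ln_ge_half; rewrite lerDr.
have lL : 1 / 2 <= ln (L + 2) :> R by apply: ln_ge_half; rewrite lerDr ltW.
have s1 : 1 <= Num.sqrt (K%:R * T'%:R / L).
  rewrite -[leLHS]sqrtr1 ler_wsqrtr// ler_pdivlMr// mul1r.
  have l2 : ln 2 <= 1 :> R by apply: le_trans (le_ln1Dx _) _; lra.
  apply: (@le_trans _ _ 1); first by apply: ltW; exact: lt_le_trans L_lt2 _.
  by rewrite -natrM ler1n muln_gt0 K_gt0.
have lf : 1 / 8 <= log_factor T' K L.
  have h : 1 / 2 * (1 / 2) <= ln (T'%:R + 2) * ln (K%:R + 2) :> R.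
    by apply: ler_pM => //; lra.
  apply: (@le_trans _ _ (1 / 2 * (1 / 2) * (1 / 2))); first by lra.
  by apply: ler_pM => //; lra.
have h : 1 * (1 / 8) <= Num.sqrt (K%:R * T'%:R / L) * log_factor T' K L.
  by apply: ler_pM => //; lra.
rewrite -mulrA; apply: le_trans (ler_wpM2l C0 h).
by rewrite -[leLHS]/1; lra.
Qed.

Theorem theorem1 (R : realType) :
  exists (C : R) (p : nat),
  forall (d : measure_display) (X : measurableType d) (K N : nat) (delta : R),
    (0 < K)%N -> (0 < N)%N -> 0 < delta -> delta < 1 ->
  exists alg : bandit_algorithm R K X,
  forall (Pi : set (X -> 'I_K)) (orc : query R K X -> X -> 'I_K)
         (D : probability (X * K.-tuple R)%type R),
    (Pi #= `I_N)%card ->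
    (forall pi, Pi pi -> measurable_policy pi) ->
    opt_oracle Pi orc ->
    measurable_oracle Pi orc ->
    D [set z | forall a, 0 <= tnth z.2 a <= 1] = 1%E ->
  forall (d' : measure_display) (Omega : measurableType d')
         (P : probability Omega R)
         (Y : nat -> {RV P >-> (X * K.-tuple R * measurableTypeR R)%type}),
    iid_with_law (D \x uniform_prob (@ltr01 R))%E Y ->
  forall (pistar : X -> 'I_K) (T : nat),
    Pi pistar ->
    (forall pi, Pi pi ->
      (expected_reward D pi <= expected_reward D pistar)%E) ->
  let L := ln (N%:R / delta) in
  let good := [set w |
    regret alg orc (fun t => Y t w) pistar T
      <= C * Num.sqrt (K%:R * T%:R * L) /\
    (oracle_calls alg orc (fun t => Y t w) T)%:R
      <= C * Num.sqrt (K%:R * T%:R / L) * log_factor T K L ^+ p] in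
  measurable good /\ ((1 - delta)%:E <= P good)%E.
Proof.
exists (2000 * 20), 1%N => d X K N delta K_gt0 N_gt0 delta_gt0 delta_lt1.
(* The case distinction involves only [N] and [delta], so the algorithm is fixed before the policy
   set, the oracle and the distribution. *)
have [L_ge2|L_lt2] := leP (ln 2) (ln (N%:R / delta)).
  exists (taming X (Ordinal K_gt0) (ln (N%:R / delta))).
  move=> Pi orc D NPi mPi HPi morc D_unit d' Omega P Y iidY pistar T Pstar star_max.
  exact: (taming_guarantee (Ordinal K_gt0) mPi HPi morc NPi K_gt0 N_gt0 delta_gt0
    delta_lt1 D_unit L_ge2 iidY Pstar star_max).
exists (single_policy R K X).
move=> Pi orc D NPi _ HPi _ _ d' Omega P Y _ pistar T Pstar _.
have C8 : 8 <= 2000 * 20 :> R by lra.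
exact: (single_policy_guarantee P Y T C8 K_gt0 N_gt0 delta_gt0 delta_lt1 L_lt2 NPi HPi Pstar).
Qed.
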